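(* Let $n,d\ge 1$ be integers and let $X_1,\dots,X_n$ be random row vectors in $\mathbb R^d$ (with arbitrary joint distribution) satisfying the orthant symmetry condition. Let $R=(R^2)^{1/2}\ge 0$, where $R^2$ is the statistic defined in the context. Then for all $u\ge 0$ $$\mathbf P(n^{1/2}R\ge u)\le Q_d(u)<\frac{2e^3}{9}\,\mathbf P(\chi_d\ge u).$$
   Context: Orthant symmetry condition: $(X_1,\dots,X_n)$ has the same joint distribution as $(\epsilon_1X_1,\dots,\epsilon_nX_n)$, where $\epsilon_1,\dots,\epsilon_n$ are i.i.d., independent of $(X_1,\dots,X_n)$, with $\mathbf P(\epsilon_i=1)=\mathbf P(\epsilon_i=-1)=\frac12$. Statistic: $\overline X=\frac1n\sum_{i=1}^nX_i$, $S=\frac1n\sum_{i=1}^nX_i^TX_i$ (a $d\times d$ matrix), and $R^2=\lim_{\varepsilon\downarrow0}\overline X(S+\varepsilon I)^{-1}\overline X^T$ (the limit always exists). Equivalently, $nR^2=\nu^TP\nu$, where $\nu=(1,\dots,1)^T\in\mathbb R^n$ and $P$ is the matrix of the orthogonal projector of $\mathbb R^n$ onto the column space of the $n\times d$ matrix whose $i$th row is $X_i$. ($R^2=T^2/(1+T^2)$ with $T^2$ Hotelling's statistic.) $\chi_d$ denotes the nonnegative square root of a random variable having the chi-square distribution with $d$ degrees of freedom. $C^2_{conv}$ is the class of all even functions $f:\mathbb R\to\mathbb R$ having a finite and convex second derivative $f''$ on $\mathbb R$. $C^2_{\uparrow,conv}$ is the class of all $f\in C^2_{conv}$ with $f(0)\ge0$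 and $f''(0)\ge0$. For $u\ge 0$, $$Q_d(u)=\inf\{\mathbf E f(\chi_d)/f(u):\ f\in C^2_{\uparrow,conv},\ f(u)>0\}.$$ *)

(* Defs.v *)
From HB Require Import structures.
From mathcomp Require Import all_boot all_order all_algebra.
From mathcomp Require Import all_classical all_reals all_analysis.

Set Implicit Arguments.
Unset Strict Implicit.
Unset Printing Implicit Defensive.

Import Order.TTheory GRing.Theory Num.Theory.
Import numFieldNormedType.Exports.

Local Open Scope classical_set_scope.
Local Open Scope ring_scope.

(* A random row vector in R^d is a random variable with values in d.-tuple R,
   whose sigma-algebra is generated by the coordinates (the Borel sets of R^d);
   an n-tuple of such vectors takes values in n.-tuple (d.-tuple R). *)

Section Laws.
Context {R : realType} {d1 : measure_display} {T : measurableType d1}.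
Variable P : probability T R.

Definition joint (n : nat) (U : Type) (X : 'I_n -> T -> U) (w : T) :
    n.-tuple U := [tuple X i w | i < n].

Definition same_law (d2 d3 : measure_display) (T' : measurableType d2)
    (U : measurableType d3) (f : T -> U) (P' : probability T' R) (g : T' -> U)
    : Prop :=
  forall A : set U, measurable A -> P (f @^-1` A) = P' (g @^-1` A).

Definition independent (d2 d3 : measure_display) (U : measurableType d2)
    (V : measurableType d3) (f : T -> U) (g : T -> V) : Prop :=
  forall (A : set U) (B : set V), measurable A -> measurable B ->
    P (f @^-1` A `&` g @^-1` B) = (P (f @^-1` A) * P (g @^-1` B))%E.

(* The product rule for subfamilies is the case A i = setT off the subfamily. *)
Definition mutually_independent (n : nat) (d2 : measure_display)
    (U : measurableType d2) (X : 'I_n -> T -> U) : Prop :=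
  forall A : 'I_n -> set U, (forall i, measurable (A i)) ->
    P (\bigcap_i (X i @^-1` A i)) = (\prod_(i < n) P (X i @^-1` A i))%E.

Definition rademacher (e : T -> R) : Prop :=
  P [set w | e w = 1] = (2^-1)%:E /\ P [set w | e w = -1] = (2^-1)%:E.

End Laws.

(* The original probability space need not carry the signs, so they live, with
   a copy Y of X, on an auxiliary space. *)
Definition orthant_symmetric (R : realType) (n d : nat)
    (d1 : measure_display) (T : measurableType d1) (P : probability T R)
    (X : 'I_n -> {RV P >-> d.-tuple R}) : Prop :=
  exists (d2 : measure_display) (T' : measurableType d2)
    (P' : probability T' R) (Y : 'I_n -> {RV P' >-> d.-tuple R})
    (eps : 'I_n -> {RV P' >-> R}),
    [/\ same_law P (joint X) P' (joint Y),
        mutually_independent P' eps,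
        (forall i, rademacher P' (eps i)),
        independent P' (joint eps) (joint Y) &
        same_law P (joint X) P'
          (joint (fun i w => [tuple eps i w * tnth (Y i w) j | j < d]))].

Section Statistic.
Context {R : realType} {n d : nat}.

Definition rowvec (x : d.-tuple R) : 'rV[R]_d := \row_j tnth x j.

Definition sample_mean (x : 'I_n -> 'rV[R]_d) : 'rV[R]_d :=
  n%:R^-1 *: \sum_(i < n) x i.

Definition sample_S (x : 'I_n -> 'rV[R]_d) : 'M[R]_d :=
  n%:R^-1 *: \sum_(i < n) ((x i)^T *m x i).

Definition Rsquared (x : 'I_n -> 'rV[R]_d) : R :=
  lim ((fun eps : R =>
    (sample_mean x *m invmx (sample_S x + eps%:M) *m (sample_mean x)^T) 0 0)
    @ 0^'+).

Definition Rstat (x : 'I_n -> 'rV[R]_d) : R := Num.sqrt (Rsquared x).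

End Statistic.

Section ProductProbability.
Context {R : realType} {d1 d2 : measure_display}.
Context {T1 : measurableType d1} {T2 : measurableType d2}.
Variables (P1 : probability T1 R) (P2 : probability T2 R).

Definition product_prob : set (T1 * T2) -> \bar R := (P1 \x P2)%E.

Let product_prob0 : product_prob set0 = 0%E.
Proof. exact: measure0. Qed.

Let product_prob_ge0 A : (0 <= product_prob A)%E.
Proof. exact: measure_ge0. Qed.

Let product_prob_sigma_additive : semi_sigma_additive product_prob.
Proof. exact: measure_semi_sigma_additive. Qed.

HB.instance Definition _ := isMeasure.Build _ _ _ product_prob
  product_prob0 product_prob_ge0 product_prob_sigma_additive.

Let product_prob_setT : product_prob setT = 1%E.
Proof.
rewrite /product_prob -setXTT product_measure1E//.
transitivity (P1 setT * P2 setT)%E => //.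
by rewrite !probability_setT mule1.
Qed.

HB.instance Definition _ :=
  Measure_isProbability.Build _ _ _ product_prob product_prob_setT.

End ProductProbability.

Section ChiSquare.
Context {R : realType}.

Definition add_sqr (p : measurableTypeR R * measurableTypeR R) :
  measurableTypeR R := p.1 + p.2 ^+ 2.

Lemma measurable_add_sqr : measurable_fun setT add_sqr.
Proof.
apply: measurable_realfun.measurable_funD => //.
exact: measurable_realfun.measurable_funX.
Qed.

HB.instance Definition _ :=
  isMeasurableFun.Build _ _ _ _ add_sqr measurable_add_sqr.

(* The law of Z_1^2 + ... + Z_d^2 for independent standard normal Z_i, obtained
   by adding one independent squared term at a time. *)
Fixpoint chi_square (d : nat) : probability (measurableTypeR R) R :=
  if d is d'.+1 then
    distribution (product_prob (chi_square d') (normal_prob (0 : R) 1)) add_sqr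
  else \d_(0 : measurableTypeR R).

End ChiSquare.

Section ExtremalRatio.
Context {R : realType}.

Definition C2conv (f : R -> R) : Prop :=
  [/\ forall x, f (- x) = f x,
      forall x, derivable f x 1,
      forall x, derivable (derive1 f) x 1 &
      convex_function [set: R^o] (derive1n 2 f)].

Definition C2upconv (f : R -> R) : Prop :=
  [/\ C2conv f, 0 <= f 0 & 0 <= derive1n 2 f 0].

(* Expectations lie in [0, +oo]: each f in C2upconv is nonnegative, but
   f (chi_d) need not be integrable. *)
Definition Q (d : nat) (u : R) : \bar R :=
  ereal_inf [set ('E_(chi_square d)[fun y => f (Num.sqrt y)]
                  * ((f u)^-1)%:E)%E
            | f in [set f | C2upconv f /\ 0 < f u]].

End ExtremalRatio.

(* Main.v *)
Require Import Defs.
From HB Require Import structures.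
From mathcomp Require Import all_boot all_order all_algebra.
From mathcomp Require Import all_classical all_reals all_analysis.
From mathcomp Require Import measurable_realfun ring lra.

(** Both halves of the theorem come down to estimating [E f(chi_d)] for test
    functions [f] of the class defining [Q].

    First inequality. Conditionally on the sample the rows carry independent
    signs [e_i]. If the columns of the n x r matrix [U] are an orthonormal basis
    of the column space of the sample, then multiplying its rows by the signs
    gives such a basis for the signed sample, and [n R^2] is the squared length
    of the vector [sum_i e_i U_i], where [U_i] is the i-th row of [U]
    ([Rstat_signs]). Replacing every sign by a standard normal variable turns
    this vector into a standard normal vector of [R^r], with [r <= d], of
    length [chi_r] ([gauss_avgs_chi]). The replacement increases the mean of [f]
    of the length, one sign at a time ([sign_avgs_le_gauss]): for fixed vectors
    [v] and [w], the function [p(x) = f |v + x w| + f |v - x w|] has an even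
    convex second derivative, so that [p(x) - m x^2] is smallest at [x = 1] for a
    suitable [m >= 0]; integrate against the normal law, whose second moment is 1
    ([parabola_support], [sign_le_gauss_radial]). That the second derivative of
    [f |v + x w|] in [x] is convex ([cvx_hess]) is checked by approximating [f'']
    by sums of a constant and of hinges [(x - t)_+], for which it is an explicit
    computation ([cvx_hess_hinge]). As [f] increases on the half-line, Markov's inequality
    bounds the tail by [E f(chi_d) / f(u)]; take the infimum over [f]
    ([signed_tail_le], [exceeds_le_Q]).

    Second inequality. The density [p] of [chi_d] is strongly log-concave
    ([chi_tangent]). Compare it with the exponential function [expo] that agrees
    with [p] at [u] and has the same tail mass [q] past [u]. Then [p <= expo]
    before [u], and past [u] the difference [expo - p] has integral 0 and changes
    sign once, from negative to positive; so nondecreasing functions have a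
    larger integral against [expo] ([tail_compare]). The exponential integrals
    are explicit. With [l] the decay rate of [expo] and [v = l u], the test
    functions 1, [x^2] and [(|x| - u + 3 / l)_+ ^ 3] give the constant [2 e^3 / 9]
    for [v <= 29/20], [29/20 < v < 3] and [3 <= v] respectively ([Q_lt]). *)

Set Implicit Arguments.
Unset Strict Implicit.
Unset Printing Implicit Defensive.

Import Order.TTheory GRing.Theory Num.Theory.
Import numFieldNormedType.Exports.

Local Open Scope classical_set_scope.
Local Open Scope ring_scope.

(** * Convexity and derivatives on the line *)

Section Convexity.
Context {R : realType}.
Implicit Types (f g df F : R -> R) (x y z t : R).

(** [convex_function] on the whole line with the weight as a plain real, in the
    form that arithmetic tactics consume. *)
Definition cvx f := forall t x y, 0 <= t <= 1 ->
  f (t * x + (1 - t) * y) <= t * f x + (1 - t) * f y.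

Lemma cvx_of_convex_function f : convex_function [set: R^o] f -> cvx f.
Proof.
move=> cf t x y /andP[t0 t1].
have t01 : (0 <= t <= 1)%R by rewrite t0 t1.
pose p : {i01 R} := Itv01 t0 t1.
by have := cf p x y (in_setT _) (in_setT _); rewrite !convRE.
Qed.

Lemma convex_function_of_cvx f : cvx f -> convex_function [set: R^o] f.
Proof.
move=> cf t x y _ _; rewrite !convRE; apply: cf.
by apply/andP; split.
Qed.

(** A point of [0, y] is a convex combination of [y] and [- y], where [A] takes
    the same value. *)
Lemma cvx_even_homo A : cvx A -> (forall x, A (- x) = A x) ->
  forall x y, 0 <= x -> x <= y -> A x <= A y.
Proof.
move=> cA eA x y x0 xy; have [y0|yn0] := eqVneq y 0.
  by have -> : x = y by apply/eqP; rewrite eq_le xy y0.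
have y0 : 0 < y by rewrite lt_def yn0 (le_trans x0).
pose t := (y + x) / (2 * y).
have t01 : 0 <= t <= 1.
  rewrite divr_ge0 ?addr_ge0 ?mulr_ge0 ?(ltW y0)//=.
  by rewrite ler_pdivrMr ?mulr_gt0//; lra.
have := cA t y (- y) t01; rewrite eA.
have -> : t * y + (1 - t) * - y = x by rewrite /t; field.
lra.
Qed.

(** The differentiation rules on explicit lambda-abstractions, so that the
    derivative of a formula is found by unification. *)
Lemma der_cst (a x : R) : is_derive x 1 (fun=> a) 0.
Proof. exact: is_derive_cst. Qed.

Lemma der_id (x : R) : is_derive x 1 (fun x : R => x) 1.
Proof. exact: is_derive_id. Qed.

Lemma derD f g (x a b : R) : is_derive x 1 f a -> is_derive x 1 g b ->
  is_derive x 1 (fun x => f x + g x) (a + b).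
Proof. by move=> df dg; exact: is_deriveD. Qed.

Lemma derB f g (x a b : R) : is_derive x 1 f a -> is_derive x 1 g b ->
  is_derive x 1 (fun x => f x - g x) (a - b).
Proof. by move=> df dg; exact: is_deriveB. Qed.

Lemma derM f g (x a b : R) : is_derive x 1 f a -> is_derive x 1 g b ->
  is_derive x 1 (fun x => f x * g x) (a * g x + f x * b).
Proof.
move=> df dg; rewrite (mulrC a) addrC.
exact: (@is_deriveM _ _ f g x 1 _ _ df dg).
Qed.

Lemma derZ (k : R) f (x a : R) : is_derive x 1 f a ->
  is_derive x 1 (fun x => k * f x) (k * a).
Proof. by move=> df; exact: (@is_deriveZ _ _ _ f k). Qed.

Lemma derX n f (x a : R) : is_derive x 1 f a ->
  is_derive x 1 (fun x => f x ^+ n.+1) (n.+1%:R * f x ^+ n * a).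
Proof.
move=> df; have -> : (fun x => f x ^+ n.+1) = f ^+ n.+1.
  by apply/funext => z; rewrite exprfctE.
exact: (is_deriveX n.+1 df).
Qed.

Lemma der_comp f g (x a b : R) : is_derive (g x) 1 f a -> is_derive x 1 g b ->
  is_derive x 1 (fun x => f (g x)) (a * b).
Proof. by move=> df dg; exact: (@is_derive1_comp _ f g x). Qed.

Lemma derN_arg f (x a : R) : is_derive (- x) 1 f a ->
  is_derive x 1 (fun x => f (- x)) (- a).
Proof.
move=> df; have d1 : is_derive x 1 (fun z : R => - z) (-1) by exact: is_deriveNid.
by rewrite -mulrN1; exact: (der_comp (g := fun z => - z) df d1).
Qed.

Lemma der_eq f (x a b : R) : is_derive x 1 f a -> a = b -> is_derive x 1 f b.
Proof. by move=> + <-. Qed.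

Lemma der_continuous f df : (forall x, is_derive x 1 f (df x)) -> continuous f.
Proof.
move=> h x; apply: differentiable_continuous; apply/derivable1_diffP.
by have [] := h x.
Qed.

Lemma mvt f df x y : x <= y ->
  (forall z, x <= z <= y -> is_derive z 1 f (df z)) ->
  exists2 c, x <= c <= y & f y - f x = df c * (y - x).
Proof.
move=> xy fdf.
have [c cxy E] : exists2 c, c \in `[x, y] & f y - f x = df c * (y - x).
  apply: MVT_segment => //.
    by move=> z; rewrite in_itv/= => /andP[xz zy]; apply: fdf; rewrite !ltW.
  apply: derivable_within_continuous => z; rewrite in_itv/= => zxy.
  by have [] := fdf z zxy.
by exists c => //; move: cxy; rewrite in_itv.
Qed.

Lemma tangent_le f df a : (forall z, a <= z -> is_derive z 1 f (df z)) ->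
  (forall z w, a <= z -> z <= w -> df z <= df w) ->
  forall w x, a <= w -> a <= x -> f w + df w * (x - w) <= f x.
Proof.
move=> fdf dfm w x aw ax; have [wx|/ltW xw] := leP w x.
  have [c /andP[wc cx] E] := mvt wx (fun z h => fdf z (le_trans aw (proj1 (andP h)))).
  have := dfm w c aw wc; have : 0 <= x - w by rewrite subr_ge0.
  nra.
have [c /andP[xc cw] E] := mvt xw (fun z h => fdf z (le_trans ax (proj1 (andP h)))).
have := dfm c w (le_trans ax xc) cw; have : 0 <= w - x by rewrite subr_ge0.
nra.
Qed.

(** The map [y |-> max |y| a] is convex, and [f] is convex and nondecreasing on
    its range [a, +oo[. *)
Lemma cvx_even_ext f df a : 0 <= a ->
  (forall z, a <= z -> is_derive z 1 f (df z)) ->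
  (forall z w, a <= z -> z <= w -> df z <= df w) ->
  (forall z, a <= z -> 0 <= df z) ->
  cvx (fun y => f (Num.max `|y| a)).
Proof.
move=> a0 fdf dfm df0 t x y /andP[t0 t1].
set w := Num.max `|t * x + (1 - t) * y| a.
set u := Num.max `|x| a; set v := Num.max `|y| a.
have aw : a <= w by rewrite le_max lexx orbT.
have au : a <= u by rewrite le_max lexx orbT.
have av : a <= v by rewrite le_max lexx orbT.
have wuv : w <= t * u + (1 - t) * v.
  have xu : `|x| <= u by rewrite le_max lexx.
  have yv : `|y| <= v by rewrite le_max lexx.
  rewrite ge_max; apply/andP; split; last by nra.
  apply: (le_trans (ler_normD _ _)); rewrite !normrM (ger0_norm t0).
  by rewrite (@ger0_norm _ (1 - t)) ?subr_ge0//; nra.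
have := tangent_le fdf dfm aw au.
have := tangent_le fdf dfm aw av.
have := df0 w aw.
nra.
Qed.

(** The even convex second derivative of
    [p(x) = F (c + b x) + F (c - b x)] increases on the half-line. Choose [m] so
    that the derivative of [p(x) - m x^2] vanishes at 1, as it does at 0: being
    convex, the derivative is at most 0 in between and at least 0 afterwards, and
    1 is a minimum. *)
Lemma parabola_support F F1 F2 (b c : R) :
  (forall x, is_derive x 1 F (F1 x)) -> (forall x, is_derive x 1 F1 (F2 x)) ->
  cvx F2 -> (forall x, 0 <= F2 x) ->
  exists2 m, 0 <= m & forall x,
    F (c + b) + F (c - b) + m * x ^+ 2 <= F (c + b * x) + F (c - b * x) + m.
Proof.
move=> dF dF1 cF2 F20.
pose p x := F (c + b * x) + F (c - b * x).
pose p1 x := b * (F1 (c + b * x) - F1 (c - b * x)).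
pose p2 x := b ^+ 2 * (F2 (c + b * x) + F2 (c - b * x)).
have dl (e x : R) : is_derive x 1 (fun x => c + e * x) e.
  apply: der_eq (derD (der_cst _ _) (derZ _ (der_id _))) _; ring.
have dcomp f df e x : (forall z, is_derive z 1 f (df z)) ->
    is_derive x 1 (fun x => f (c + e * x)) (df (c + e * x) * e).
  by move=> fdf; exact: der_comp (fdf _) (dl _ _).
have dr f df x : (forall z, is_derive z 1 f (df z)) ->
    is_derive x 1 (fun x => f (c - b * x)) (- df (c - b * x) * b).
  move=> fdf; have := dcomp f df (- b) x fdf.
  by rewrite (_ : (fun x => f (c + - b * x)) = (fun x => f (c - b * x)));
    [move/der_eq; apply; rewrite mulNr; ring|apply/funext => z; rewrite mulNr].
have dp x : is_derive x 1 p (p1 x).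
  by apply: der_eq (derD (dcomp _ _ _ _ dF) (dr _ _ _ dF)) _; rewrite /p1; ring.
have dp1 x : is_derive x 1 p1 (p2 x).
  apply: der_eq (derZ _ (derB (dcomp _ _ _ _ dF1) (dr _ _ _ dF1))) _.
  by rewrite /p2; ring.
have cp2 : cvx p2.
  move=> t x y t01; rewrite /p2.
  have := cF2 t (c + b * x) (c + b * y) t01.
  have := cF2 t (c - b * x) (c - b * y) t01.
  have -> : t * (c - b * x) + (1 - t) * (c - b * y) = c - b * (t * x + (1 - t) * y) by ring.
  have -> : t * (c + b * x) + (1 - t) * (c + b * y) = c + b * (t * x + (1 - t) * y) by ring.
  have := sqr_ge0 b; nra.
have ep2 x : p2 (- x) = p2 x by rewrite /p2 mulrN opprK addrC.
have p2mono := cvx_even_homo cp2 ep2.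
have p20 x : 0 <= p2 x by rewrite mulr_ge0 ?sqr_ge0// addr_ge0.
pose m := p1 1 / 2.
have p10 : p1 0 = 0 by rewrite /p1 !mulr0 addr0 subr0 subrr mulr0.
have m0 : 0 <= m.
  rewrite divr_ge0//; have [e _] := mvt (@ler01 R) (fun z _ => dp1 z).
  by rewrite p10 subr0 subr0 mulr1 => ->.
exists m => //.
pose D x := p x - m * x ^+ 2.
pose D1 x := p1 x - m * (2 * x).
pose D2 x := p2 x - m * 2.
have dD x : is_derive x 1 D (D1 x).
  by apply: der_eq (derB (dp x) (derZ _ (derX 1 (der_id _)))) _; rewrite /D1; ring.
have dD1 x : is_derive x 1 D1 (D2 x).
  by apply: der_eq (derB (dp1 x) (derZ _ (derZ _ (der_id _)))) _; rewrite /D2; ring.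
have D10 : D1 0 = 0 by rewrite /D1 p10; ring.
have D11 : D1 1 = 0 by rewrite /D1 /m; field.
have D2m x y : 0 <= x -> x <= y -> D2 x <= D2 y.
  by move=> x0 xy; rewrite lerD2r p2mono.
have D1le x : 0 <= x <= 1 -> D1 x <= 0.
  move=> /andP[x0 x1]; rewrite leNgt; apply/negP => Dx.
  have [a /andP[a0 ax] Ea] := mvt x0 (fun z _ => dD1 z).
  have [e /andP[xe e1] Ee] := mvt x1 (fun z _ => dD1 z).
  have ae : D2 a <= D2 e by apply: D2m => //; exact: le_trans xe.
  rewrite D10 !subr0 in Ea; rewrite D11 in Ee.
  have D2a : 0 < D2 a by nra.
  nra.
have D1ge x : 1 <= x -> 0 <= D1 x.
  move=> x1.
  have [a /andP[a0 a1] Ea] := mvt (@ler01 R) (fun z _ => dD1 z).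
  have [e /andP[e1 ex] Ee] := mvt x1 (fun z _ => dD1 z).
  have ae : D2 a <= D2 e by apply: D2m => //; exact: le_trans e1.
  rewrite D11 subr0 in Ee; rewrite D10 D11 in Ea.
  nra.
have Dmin x : 0 <= x -> D 1 <= D x.
  move=> x0; have [x1|/ltW x1] := leP x 1.
    have [e /andP[xe e1] Ee] := mvt x1 (fun z _ => dD z).
    have : D1 e <= 0 by apply: D1le; rewrite e1 (le_trans x0).
    nra.
  have [e /andP[xe e1] Ee] := mvt x1 (fun z _ => dD z).
  have := D1ge e xe.
  nra.
move=> x; have := Dmin `|x| (normr_ge0 _).
rewrite /D /p !mulr1 expr1n mulr1 real_normK ?num_real//.
have [_|_] := ger0P x; rewrite ?mulrN ?opprK; lra.
Qed.
End Convexity.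

(** * The second derivative of a radial function along a line *)

Section Radial.
Context {R : realType}.
Implicit Types (f A I S : R -> R) (x y z t k : R).

(** The norm of a point moving along a line at distance [k] from the origin. *)
Definition hyp k y : R := Num.sqrt (y ^+ 2 + k ^+ 2).

Lemma hyp_sqr k y : hyp k y ^+ 2 = y ^+ 2 + k ^+ 2.
Proof. by rewrite sqr_sqrtr// addr_ge0// sqr_ge0. Qed.

Lemma hyp_ge k y : 0 < k -> k <= hyp k y.
Proof.
move=> k0; rewrite -(ler_pXn2r (n := 2))// ?nnegrE ?sqrtr_ge0 ?(ltW k0)//.
by rewrite hyp_sqr lerDr sqr_ge0.
Qed.

Lemma hyp_gt0 k y : 0 < k -> 0 < hyp k y.
Proof. by move=> k0; rewrite (lt_le_trans k0)// hyp_ge. Qed.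

Lemma hyp_abs k y : hyp k `|y| = hyp k y.
Proof. by rewrite /hyp real_normK// num_real. Qed.

Lemma der_hyp k y : 0 < k -> is_derive y 1 (hyp k) (y / hyp k y).
Proof.
move=> k0; have r0 := hyp_gt0 y k0.
have y0 : 0 < y ^+ 2 + k ^+ 2 by rewrite -hyp_sqr exprn_gt0.
have h := @is_derive1_sqrt R _ y0.
apply: der_eq (der_comp (g := fun z => z ^+ 2 + k ^+ 2) h
  (derD (derX 1 (der_id y)) (der_cst (k ^+ 2) y))) _.
by rewrite -/(hyp k y); field; rewrite gt_eqF.
Qed.

Lemma der_hypV k y : 0 < k ->
  is_derive y 1 (fun y => (hyp k y)^-1) (- y * (hyp k y)^-1 ^+ 3).
Proof.
move=> k0; have r0 := hyp_gt0 y k0.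
have n0 : hyp k y != 0 by rewrite gt_eqF.
apply: der_eq (@is_deriveV R (hyp k) y _ 1 n0 (der_hyp y k0)) _.
by rewrite /GRing.scale/=; field; rewrite gt_eqF.
Qed.

(** The second derivative of [y |-> f (hyp k y)] when [A] and [I] are the second
    and first derivatives of [f]. *)
Definition hess k A I y : R :=
  (y / hyp k y) ^+ 2 * A (hyp k y) + k ^+ 2 * (hyp k y)^-1 ^+ 3 * I (hyp k y).

Lemma der_radial f f1 k y : 0 < k -> (forall x, is_derive x 1 f (f1 x)) ->
  is_derive y 1 (fun y => f (hyp k y)) (f1 (hyp k y) * (y / hyp k y)).
Proof. by move=> k0 df; exact: (der_comp (g := hyp k) (df _) (der_hyp _ k0)). Qed.

Lemma der2_radial f1 f2 k y : 0 < k -> (forall x, is_derive x 1 f1 (f2 x)) ->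
  is_derive y 1 (fun y => f1 (hyp k y) * (y / hyp k y)) (hess k f2 f1 y).
Proof.
move=> k0 df; have r0 := hyp_gt0 y k0.
apply: der_eq (derM (der_radial _ k0 df) (derM (der_id _) (der_hypV _ k0))) _.
rewrite /hess.
have -> : 1 * (hyp k y)^-1 + y * (- y * (hyp k y)^-1 ^+ 3) =
    (hyp k y ^+ 2 - y ^+ 2) * (hyp k y)^-1 ^+ 3 by field; rewrite gt_eqF.
by rewrite hyp_sqr; ring.
Qed.

Definition hinge t x : R := Num.max (x - t) 0.

Lemma hinge_is0 t x : x <= t -> hinge t x = 0.
Proof. by move=> xt; rewrite /hinge (max_idPr _)// subr_le0. Qed.

Lemma hinge_isB t x : t <= x -> hinge t x = x - t.
Proof. by move=> xt; rewrite /hinge (max_idPl _)// subr_ge0. Qed.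

Lemma continuous_hinge t : continuous (hinge t).
Proof.
move=> x; apply: (@continuous_max _ _ (fun x => x - t) (cst 0)).
  by apply: cvgB; [exact: cvg_id|exact: cvg_cst].
exact: cvg_cst.
Qed.

Lemma der_hingeX n t x :
  is_derive x 1 (fun x => hinge t x ^+ n.+2) (n.+2%:R * hinge t x ^+ n.+1).
Proof.
have [xt|tx|->] := ltgtP x t.
- rewrite hinge_is0 ?(ltW xt)// expr0n mulr0.
  apply: near_eq_is_derive (der_cst 0 x).
  by near=> z; rewrite hinge_is0 ?expr0n//= ltW//; near: z; exact: lt_nbhsl.
- rewrite hinge_isB ?(ltW tx)//.
  have := derX n.+1 (derB (der_id x) (der_cst t x)).
  rewrite subr0 mulr1; apply: near_eq_is_derive.
  by near=> z; rewrite hinge_isB// ltW//; near: z; exact: lt_nbhsr.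
- rewrite hinge_is0// expr0n mulr0.
  apply/is_derive1_caratheodory; exists (fun z => hinge t z ^+ n.+1); split.
  + move=> z; rewrite [hinge t t]hinge_is0// expr0n subr0 exprSr.
    have [zt|tz] := leP z t; first by rewrite hinge_is0// expr0n !mul0r.
    by rewrite [X in _ * X = _]hinge_isB// ltW.
  + apply: (@continuous_comp _ _ _ (hinge t) (fun u => u ^+ n.+1)).
      exact: continuous_hinge.
    exact: exprn_continuous.
  + by rewrite hinge_is0// expr0n.
Unshelve. all: by end_near. Qed.

Lemma der_hinge_sq t x : is_derive x 1 (fun x => hinge t x ^+ 2 / 2) (hinge t x).
Proof.
have -> : (fun x => hinge t x ^+ 2 / 2) = fun x => 2^-1 * hinge t x ^+ 2.
  by apply/funext => z; rewrite mulrC.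
by apply: der_eq (derZ _ (der_hingeX 0 t x)) _; rewrite mulrA mulVf// mul1r.
Qed.

(** The line meets the ball of radius [t] in the chord [|y| <= a]. The hinge
    vanishes on it, and beyond it the second derivative is the explicit function
    [b], which starts from 0 and whose first two derivatives [b1] and [b2] are
    nonnegative. If the line misses the ball, [a = 0] and [b] is the whole
    function. *)
Lemma cvx_hess_hinge k t : 0 < k -> 0 <= t ->
  cvx (hess k (hinge t) (fun x => hinge t x ^+ 2 / 2)).
Proof.
move=> k0 t0.
pose a := Num.sqrt (t ^+ 2 - k ^+ 2).
have a0 : 0 <= a by exact: sqrtr_ge0.
have at_le z : a <= z -> t <= hyp k z.
  move=> az; rewrite -(ler_pXn2r (n := 2))// ?nnegrE ?sqrtr_ge0// hyp_sqr.
  have : a ^+ 2 <= z ^+ 2 by rewrite ler_pXn2r// nnegrE// (le_trans a0).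
  have [tk|tk] := leP (t ^+ 2) (k ^+ 2); first by have := sqr_ge0 z; lra.
  by rewrite /a sqr_sqrtr; lra.
have at_ge z : `|z| <= a -> a != 0 -> hyp k z <= t.
  move=> za an0; rewrite -(ler_pXn2r (n := 2))// ?nnegrE ?sqrtr_ge0// hyp_sqr.
  have : z ^+ 2 <= a ^+ 2.
    by rewrite -(real_normK (num_real z)) ler_pXn2r// nnegrE.
  have [tk|tk] := leP (t ^+ 2) (k ^+ 2).
    by case/eqP: an0; rewrite /a ler0_sqrtr// subr_le0.
  by rewrite /a sqr_sqrtr; lra.
pose q z := (hyp k z)^-1.
pose b z := hyp k z - t - k ^+ 2 / 2 * q z + k ^+ 2 * t ^+ 2 / 2 * q z ^+ 3.
pose b1 z := z * (q z + k ^+ 2 / 2 * q z ^+ 3 - 3 / 2 * k ^+ 2 * t ^+ 2 * q z ^+ 5).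
pose b2 z := (q z + k ^+ 2 / 2 * q z ^+ 3 - 3 / 2 * k ^+ 2 * t ^+ 2 * q z ^+ 5)
  + z * (- z * q z ^+ 3 - 3 / 2 * k ^+ 2 * z * q z ^+ 5
         + 15 / 2 * k ^+ 2 * t ^+ 2 * z * q z ^+ 7).
have db z : is_derive z 1 b (b1 z).
  have hq := der_hypV z k0.
  apply: der_eq (derD (derB (derB (der_hyp z k0) (der_cst t z)) (derZ _ hq))
    (derZ _ (derX 2 hq))) _.
  by rewrite /b1 /q; ring.
have db1 z : is_derive z 1 b1 (b2 z).
  have hq := der_hypV z k0.
  apply: der_eq (derM (der_id z) (derB (derD hq (derZ (k ^+ 2 / 2) (derX 2 hq)))
    (derZ (3 / 2 * k ^+ 2 * t ^+ 2) (derX 4 hq)))) _.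
  by rewrite /b2 /q; ring.
have qz z : a <= z -> [/\ 0 < q z, (k * q z) ^+ 2 <= 1, (t * q z) ^+ 2 <= 1 &
    (z * q z) ^+ 2 = 1 - (k * q z) ^+ 2].
  move=> az; have r0 := hyp_gt0 z k0.
  split; first by rewrite invr_gt0.
  - by rewrite expr_le1// ?divr_ge0 ?(ltW k0) ?(ltW r0)// ler_pdivrMr// mul1r hyp_ge.
  - by rewrite expr_le1// ?divr_ge0 ?(ltW r0)// ler_pdivrMr// mul1r at_le.
  - have e : z ^+ 2 = hyp k z ^+ 2 - k ^+ 2 by rewrite hyp_sqr addrK.
    by rewrite !exprMn e /q; field; rewrite gt_eqF.
have b20 z : a <= z -> 0 <= b2 z.
  move=> /qz[q0 kq tq zq].
  (* All factors are nonnegative because [k] and [t] are at most [hyp k z]. *)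
  have -> : b2 z = 3 / 2 * k ^+ 2 * q z ^+ 3 *
      (4 * (t * q z) ^+ 2 * (1 - (k * q z) ^+ 2) +
       (k * q z) ^+ 2 * (1 - (t * q z) ^+ 2)).
    transitivity (q z + k ^+ 2 / 2 * q z ^+ 3 - 3 / 2 * k ^+ 2 * t ^+ 2 * q z ^+ 5
      - (z * q z) ^+ 2 * q z - 3 / 2 * k ^+ 2 * q z ^+ 3 * (z * q z) ^+ 2
      + 15 / 2 * k ^+ 2 * t ^+ 2 * q z ^+ 5 * (z * q z) ^+ 2).
      by rewrite /b2; ring.
    by rewrite zq; field.
  apply: mulr_ge0; last by apply: addr_ge0; apply: mulr_ge0;
    rewrite ?subr_ge0 ?sqr_ge0// mulr_ge0// sqr_ge0.
  by apply: mulr_ge0; [apply: mulr_ge0; rewrite ?sqr_ge0|exact/exprn_ge0/ltW].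
have b10 z : a <= z -> 0 <= b1 z.
  move=> az; have [q0 kq tq _] := qz z az.
  apply: mulr_ge0; first exact: le_trans az.
  have -> : q z + k ^+ 2 / 2 * q z ^+ 3 - 3 / 2 * k ^+ 2 * t ^+ 2 * q z ^+ 5 =
    q z * ((1 - (k * q z) ^+ 2) + 3 / 2 * (k * q z) ^+ 2 * (1 - (t * q z) ^+ 2)) by field.
  apply: mulr_ge0; first exact: ltW.
  apply: addr_ge0; first by rewrite subr_ge0.
  by apply: mulr_ge0; [apply: mulr_ge0; rewrite ?sqr_ge0|rewrite subr_ge0].
have b1m z w : a <= z -> z <= w -> b1 z <= b1 w.
  move=> az zw; have [c /andP[zc _] E] := mvt zw (fun z _ => db1 z).
  by rewrite -subr_ge0 E mulr_ge0 ?subr_ge0// b20// (le_trans az).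
have := cvx_even_ext a0 (fun z _ => db z) b1m b10.
congr cvx; apply/funext => y; rewrite /hess.
set m := Num.max _ _.
have r0 := hyp_gt0 y k0.
have big : t <= hyp k y -> m = `|y| -> b m = (y / hyp k y) ^+ 2 *
    hinge t (hyp k y) + k ^+ 2 * (hyp k y)^-1 ^+ 3 * (hinge t (hyp k y) ^+ 2 / 2).
  move=> tr ->; rewrite /b /q hyp_abs /hinge (max_idPl _) ?subr_ge0//.
  have e : y ^+ 2 = hyp k y ^+ 2 - k ^+ 2 by rewrite hyp_sqr addrK.
  by rewrite exprMn e; field; rewrite gt_eqF.
have [ya|ya] := leP `|y| a; last first.
  by apply: big; [rewrite -hyp_abs at_le// ltW|rewrite /m (max_idPl (ltW ya))].
have [a_0|an0] := eqVneq a 0.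
  have y0 : `|y| = 0 by apply/eqP; rewrite -normr_le0 normr_id -a_0.
  by apply: big; [rewrite -hyp_abs at_le// y0 a_0|rewrite /m a_0 y0 maxxx].
have at_ : hyp k a = t.
  by apply/eqP; rewrite eq_le at_le// at_ge// ger0_norm.
rewrite /m (max_idPr ya) /b /q at_ /hinge (max_idPr _) ?subr_le0 ?at_ge//.
have tn0 : t != 0 by rewrite -at_ gt_eqF// hyp_gt0.
by rewrite expr0n mul0r !mulr0 addr0; field.
Qed.

(** Nonnegative combinations of hinges plus a constant; the second function is
    the primitive of the first that vanishes at 0. On a bounded interval they
    approximate every even convex function. *)
Inductive hinge_sum : (R -> R) -> (R -> R) -> Prop :=
| hinge_sum0 a : hinge_sum (fun=> a) (fun x => a * x)
| hinge_sumS c t S I : 0 <= c -> 0 <= t -> hinge_sum S I ->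
    hinge_sum (fun x => S x + c * hinge t x)
              (fun x => I x + c * (hinge t x ^+ 2 / 2)).

Lemma cvx_hess_hinge_sum k S I : 0 < k -> hinge_sum S I -> cvx (hess k S I).
Proof.
move=> k0; elim=> [a|c t {}S {}I c0 t0 _ IH].
  have -> : hess k (fun=> a) ( *%R a) = fun=> a.
    apply/funext => y; have r0 := hyp_gt0 y k0.
    have e : y ^+ 2 = hyp k y ^+ 2 - k ^+ 2 by rewrite hyp_sqr addrK.
    by rewrite /hess exprMn e; field; rewrite gt_eqF.
  by move=> u x y _; rewrite -mulrDl addrC subrK mul1r.
move=> u x y u01; have h1 := IH u x y u01.
have h2 := cvx_hess_hinge k0 t0 x y u01.
have e z : hess k (fun x => S x + c * hinge t x)
    (fun x => I x + c * (hinge t x ^+ 2 / 2)) z =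
    hess k S I z + c * hess k (hinge t) (fun x => hinge t x ^+ 2 / 2) z.
  by rewrite /hess; ring.
rewrite !e; nra.
Qed.

Lemma hinge_sum_primitive S I : hinge_sum S I ->
  I 0 = 0 /\ forall x, is_derive x 1 I (S x).
Proof.
elim=> [a|c t {}S {}I c0 t0 _ [IH0 IH]].
  split=> [|x]; first by rewrite mulr0.
  by apply: der_eq (derZ _ (der_id _)) _; rewrite mulr1.
split=> [|x]; first by rewrite IH0 hinge_is0// expr0n mul0r mulr0 addr0.
exact: derD (IH x) (derZ _ (der_hinge_sq _ _)).
Qed.

(** Piecewise linear interpolation on a regular grid of step [h]; the slopes of
    a convex function increase, which makes the coefficients nonnegative. *)
Lemma hinge_sum_approx A (M e : R) : cvx A -> (forall x, A (- x) = A x) ->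
  0 < M -> 0 < e -> exists S I, hinge_sum S I /\
    forall x, 0 <= x <= M -> `|S x - A x| <= e.
Proof.
move=> cA eA M0 e0; have Am := cvx_even_homo cA eA.
(* No slope on [0, M] exceeds that over [M, M + 1]; this fixes the grid step. *)
pose L := A (M + 1) - A M.
have L0 : 0 <= L by rewrite subr_ge0 Am ?lerDl// ltW.
pose h := Num.min 1 (e / (L + 1)).
have h0 : 0 < h by rewrite lt_min ltr01 divr_gt0//; lra.
have h1 : h <= 1 by rewrite ge_min lexx.
have hL : h * L <= e.
  have : h * (L + 1) <= e by rewrite -ler_pdivlMr ?ge_min ?lexx ?orbT//; lra.
  nra.
have hn0 : h != 0 by rewrite gt_eqF.
pose g (j : nat) : R := j%:R * h.
have gS j : g j.+1 = g j + h by rewrite /g -natr1; ring.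
have g0 j : 0 <= g j by rewrite mulr_ge0// ltW.
pose s (j : nat) := (A (g j.+1) - A (g j)) / h.
have sS j : s j <= s j.+1.
  rewrite ler_pM2r ?invr_gt0//.
  have h2 : (0 <= (2^-1 : R) <= 1)%R by apply/andP; split; lra.
  have := cA 2^-1 (g j.+2) (g j) h2.
  have -> : 2^-1 * g j.+2 + (1 - 2^-1) * g j = g j.+1 by rewrite !gS; field.
  lra.
have chord j x : g j <= x <= g j.+1 ->
    A (g j) <= A (g j) + s j * (x - g j) <= A (g j.+1).
  move=> /andP[jx xj]; have s0 : 0 <= s j.
    by rewrite divr_ge0 ?(ltW h0)// subr_ge0 Am// gS lerDl ltW.
  rewrite lerDl mulr_ge0 ?subr_ge0//=.
  have : s j * (x - g j) <= s j * h by rewrite ler_wpM2l// lerBlDl -gS.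
  by rewrite /s divfK//; lra.
have slope_le j : g j <= M -> A (g j.+1) - A (g j) <= h * L.
  move=> jM.
  pose t := h / (M + 1 - g j).
  have d0 : 0 < M + 1 - g j by lra.
  have t01 : 0 <= t <= 1.
    by rewrite divr_ge0 ?(ltW h0) ?(ltW d0)//= ler_pdivrMr// mul1r; lra.
  have c1 := cA t (M + 1) (g j) t01.
  have e1 : t * (M + 1) + (1 - t) * g j = g j.+1.
    by rewrite gS /t; field; rewrite gt_eqF.
  rewrite e1 in c1.
  pose u := (M + 1 - g j)^-1.
  have u01 : 0 <= u <= 1.
    by rewrite invr_ge0 (ltW d0)/= invf_le1//; lra.
  have c2 := cA (1 - u) (M + 1) (g j).
  have u01' : 0 <= 1 - u <= 1 by lra.
  have {c2} := c2 u01'.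
  have -> : (1 - u) * (M + 1) + (1 - (1 - u)) * g j = M.
    by rewrite /u; field; rewrite gt_eqF.
  move=> c2; apply: (@le_trans _ _ (t * (A (M + 1) - A (g j)))); first by lra.
  by rewrite /t -/u -mulrA ler_wpM2l ?(ltW h0)// /L; lra.
pose c (j : nat) := if j is i.+1 then s j - s i else s 0%N.
have c_ge0 j : 0 <= c j.
  case: j => [|j]; last by rewrite subr_ge0.
  by rewrite divr_ge0 ?(ltW h0)// subr_ge0 Am// gS lerDl ltW.
have build m : exists S I, hinge_sum S I /\
    (forall j x, (j < m)%N -> g j <= x <= g j.+1 -> S x = A (g j) + s j * (x - g j))
    /\ forall x, g m.-1 <= x -> S x = A (g m.-1) + (if m is i.+1 then s i else 0) * (x - g m.-1).
  elim: m => [|m [S [I [hS [HS HSm]]]]].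
    exists (fun=> A 0), ( *%R (A 0)); split; first exact: hinge_sum0.
    by split=> // x _; rewrite mul0r addr0 /g mul0r.
  exists (fun x => S x + c m * hinge (g m) x),
         (fun x => I x + c m * (hinge (g m) x ^+ 2 / 2)).
  split; first exact: hinge_sumS.
  have last x : g m <= x -> S x + c m * hinge (g m) x = A (g m) + s m * (x - g m).
    move=> mx; rewrite hinge_isB// HSm.
      case: m {HS HSm} mx => [|m] mx /=; first by rewrite mul0r addr0.
      by rewrite /s gS; field.
    by apply: le_trans mx; case: (m) => //= i; rewrite gS lerDl ltW.
  split; last by [].
  move=> j x; rewrite ltnS leq_eqVlt => /orP[/eqP ->|jm] /andP[jx xj].
    exact: last.
  rewrite hinge_is0 ?mulr0 ?addr0; first by apply: HS; rewrite ?jx.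
  by rewrite (le_trans xj)// ler_wpM2r ?(ltW h0)// ler_nat.
pose m := (Num.truncn (M / h)).+1.
have Mm : M < g m.
  by rewrite /g -ltr_pdivrMr// truncnS_gt.
have [S [I [hS [HS _]]]] := build m; exists S, I; split => // x /andP[x0 xM].
pose j := Num.truncn (x / h).
have /andP[jx xj] : g j <= x <= g j.+1.
  have /andP[j1 j2] := truncn_itv (divr_ge0 x0 (ltW h0)).
  by rewrite /g; apply/andP; split; [rewrite -ler_pdivlMr|rewrite -ler_pdivrMr// ltW].
have jm : (j < m)%N.
  by rewrite ltnS le_truncn// ler_pM2r ?invr_gt0.
rewrite (HS j) ?jx//.
have jxj : g j <= x <= g j.+1 by rewrite jx.
have /andP[l1 l2] := chord j x jxj.
have := Am _ _ (g0 j) jx; have := Am _ _ x0 xj.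
have := slope_le j (le_trans jx xM).
rewrite ler_norml; lra.
Qed.

(** The function [hess k A I] depends linearly on [A], and continuously for
    uniform convergence on bounded intervals. So convexity of the second
    derivative passes from hinges to their combinations and then to every even
    convex function. *)
Lemma cvx_hess f1 f2 k : 0 < k -> cvx f2 -> (forall x, f2 (- x) = f2 x) ->
  f1 0 = 0 -> (forall x, is_derive x 1 f1 (f2 x)) -> cvx (hess k f2 f1).
Proof.
move=> k0 cf2 ef2 f10 df1 t x y t01.
set w := t * x + (1 - t) * y.
pose M := Num.max (hyp k w) (Num.max (hyp k x) (hyp k y)).
have M0 : 0 < M by rewrite lt_max hyp_gt0.
apply/ler_addgt0Pr => e e0.
have e40 : 0 < e / 4 by rewrite divr_gt0.
have [S [I [hS SM]]] := hinge_sum_approx cf2 ef2 M0 e40.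
have [I0 dI] := hinge_sum_primitive hS.
have near z : hyp k z <= M -> `|hess k f2 f1 z - hess k S I z| <= e / 2.
  move=> zM; have r0 := hyp_gt0 z k0; set r := hyp k z in zM r0 *.
  have h1 : `|f2 r - S r| <= e / 4 by rewrite distrC SM// (ltW r0).
  have h2 : `|f1 r - I r| <= e / 4 * r.
    have [c /andP[c0 cr] E] := mvt (ltW r0) (fun u _ => derB (df1 u) (dI u)).
    move: E; rewrite f10 I0 !subr0 => ->.
    by rewrite normrM (gtr0_norm r0) ler_pM2r// distrC SM// c0 (le_trans cr).
  have -> : hess k f2 f1 z - hess k S I z =
    (z / r) ^+ 2 * (f2 r - S r) + k ^+ 2 * r^-1 ^+ 3 * (f1 r - I r).
    by rewrite /hess -/r; ring.
  have c0 : 0 <= k ^+ 2 * r^-1 ^+ 3.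
    by rewrite mulr_ge0 ?sqr_ge0// exprn_ge0// invr_ge0 ltW.
  apply: (le_trans (ler_normD _ _)); rewrite (normrM ((z / r) ^+ 2)).
  rewrite (normrM (k ^+ 2 * _)) (ger0_norm (sqr_ge0 (z / r))) (ger0_norm c0).
  have z1 : (z / r) ^+ 2 <= 1.
    by rewrite expr_div_n ler_pdivrMr ?exprn_gt0// mul1r hyp_sqr lerDl sqr_ge0.
  have k1 : k ^+ 2 * r^-1 ^+ 2 <= 1.
    rewrite exprVn ler_pdivrMr ?exprn_gt0// mul1r.
    by rewrite ler_pXn2r// ?nnegrE ?(ltW k0) ?(ltW r0)// hyp_ge.
  have -> : e / 2 = e / 4 + e / 4 by field.
  apply: lerD.
    apply: (@le_trans _ _ (1 * (e / 4))); last by rewrite mul1r.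
    by apply: ler_pM; rewrite ?sqr_ge0.
  apply: (@le_trans _ _ (k ^+ 2 * r^-1 ^+ 3 * (e / 4 * r))).
    by rewrite ler_wpM2l.
  have -> : k ^+ 2 * r^-1 ^+ 3 * (e / 4 * r) = k ^+ 2 * r^-1 ^+ 2 * (e / 4).
    by field; rewrite gt_eqF.
  by rewrite -[leRHS]mul1r ler_wpM2r// ltW.
have := cvx_hess_hinge_sum k0 hS x y t01.
have := near w _; have := near x _; have := near y _.
rewrite !le_max !lexx !orbT/= => /(_ isT) + /(_ isT) + /(_ isT).
have /andP[t0 t1] := t01.
rewrite -/w !ler_norml => /andP[y1 y2] /andP[x1 x2] /andP[w1 w2] cS.
have : t * hess k S I x <= t * (hess k f2 f1 x + e / 2).
  by apply: ler_wpM2l => //; lra.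
have : (1 - t) * hess k S I y <= (1 - t) * (hess k f2 f1 y + e / 2).
  by apply: ler_wpM2l; lra.
lra.
Qed.

End Radial.

(** * The test functions *)

Section TestClass.
Context {R : realType}.
Implicit Types (f : R -> R) (x y : R).

(** An even function has an odd derivative and an even second derivative; an even
    convex [f2] is smallest at 0, so it is nonnegative as soon as [f2 0] is. *)
Lemma C2upconvP f : C2upconv f -> exists f1 f2 : R -> R,
  [/\ forall x, is_derive x 1 f (f1 x), forall x, is_derive x 1 f1 (f2 x),
      cvx f2, forall x, f2 (- x) = f2 x & f1 0 = 0 /\ forall x, 0 <= f2 x].
Proof.
move=> [[ef df ddf cf] f0 f20].
pose f1 : R -> R := derive1 f; pose f2 : R -> R := derive1n 2 f.
have df1 x : is_derive x 1 f (f1 x) by rewrite /f1 derive1E; exact: derivableP.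
have df2 x : is_derive x 1 f1 (f2 x).
  by rewrite /f2 /= derive1E; exact: derivableP.
have uniq (g : R -> R) (x a b : R) : is_derive x 1 g a -> is_derive x 1 g b -> a = b.
  by move=> h1 h2; rewrite -(derive_val (is_derive := h1)) (derive_val (is_derive := h2)).
have of1 x : f1 (- x) = - f1 x.
  have h := derN_arg (df1 (- x)).
  have e : (fun x => f (- x)) = f by apply/funext.
  by rewrite e in h; rewrite -(uniq _ _ _ _ h (df1 x)) opprK.
have ef2 x : f2 (- x) = f2 x.
  have h := derN_arg (df2 (- x)).
  have e : (fun x => f1 (- x)) = (fun x => - f1 x) by apply/funext.
  rewrite e in h; have h' : is_derive x 1 (fun x => - f1 x) (- f2 x).
    by have := df2 x => h1; exact: is_deriveN.
  by apply: oppr_inj; exact: uniq h h'.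
have cf2 := cvx_of_convex_function cf.
have f10 : f1 0 = 0 by have := of1 0; rewrite oppr0; lra.
have f2_ge0 x : 0 <= f2 x.
  apply: (le_trans f20); have := cvx_even_homo cf2 ef2 (lexx 0) (normr_ge0 x).
  by rewrite -/f2; case: (ger0P x) => _; rewrite ?ef2.
by exists f1, f2; split; [exact: df1|exact: df2|exact: cf2|exact: ef2|split].
Qed.

Lemma C2upconv_homo f : C2upconv f ->
  forall x y, 0 <= x -> x <= y -> f x <= f y.
Proof.
move=> /C2upconvP[f1 [f2 [df df1 _ _ [f10 f20]]]] x y x0 xy.
have [c /andP[xc _] E] := mvt xy (fun z _ => df z).
have c0 : 0 <= c by exact: le_trans xc.
have [e _ E1] := mvt c0 (fun z _ => df1 z).
rewrite f10 !subr0 in E1; rewrite -subr_ge0 E mulr_ge0 ?subr_ge0// E1.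
by rewrite mulr_ge0.
Qed.

Lemma C2upconv_even f : C2upconv f -> forall x, f `|x| = f x.
Proof.
by move=> [[ef _ _ _] _ _] x; have [|] := ger0P x => //.
Qed.

Lemma C2upconv_ge0 f : C2upconv f -> forall x, 0 <= f x.
Proof.
move=> uf x; rewrite -(C2upconv_even uf); have [_ f0 _] := uf.
by apply: le_trans f0 _; exact: C2upconv_homo.
Qed.

(** With [al], [ga], [be] the scalar products [v.v], [v.w], [w.w] of two vectors,
    the functions of [x] are [f |v + x w| + f |v - x w|]. The line [v + x w] is at
    some distance [k] from the origin; for [k = 0] the function [f] itself has
    the convex second derivative, for [k > 0] it is given by [cvx_hess]. *)
Lemma radial_parabola_support f (al be ga : R) : C2upconv f ->
  0 <= al -> 0 <= be -> ga ^+ 2 <= al * be ->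
  exists2 m, 0 <= m & forall x,
    f (Num.sqrt (al + 2 * ga + be)) + f (Num.sqrt (al - 2 * ga + be))
      + m * x ^+ 2 <=
    f (Num.sqrt (al + 2 * ga * x + be * x ^+ 2))
      + f (Num.sqrt (al - 2 * ga * x + be * x ^+ 2)) + m.
Proof.
move=> uf al0 be0 cs.
have [f1 [f2 [df df1 cf2 ef2 [f10 f20]]]] := C2upconvP uf.
have [be_0|ben0] := eqVneq be 0.
  have ga0 : ga = 0.
    by apply/eqP; rewrite -sqrf_eq0 eq_le sqr_ge0 andbT (le_trans cs)// be_0 mulr0.
  exists 0 => // x; rewrite be_0 ga0 !mulr0 !mul0r; lra.
have be1 : 0 < be by rewrite lt_def ben0.
pose b := Num.sqrt be.
have b0 : 0 < b by rewrite sqrtr_gt0.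
have bb : b ^+ 2 = be by rewrite sqr_sqrtr.
pose c := ga / b.
have bc : b * c = ga by rewrite /c mulrC divfK// gt_eqF.
have k0 : 0 <= al - c ^+ 2.
  by rewrite subr_ge0 /c expr_div_n bb ler_pdivrMr.
pose k := Num.sqrt (al - c ^+ 2).
have kk : k ^+ 2 = al - c ^+ 2 by rewrite sqr_sqrtr.
have e1 x : al + 2 * ga * x + be * x ^+ 2 = (c + b * x) ^+ 2 + k ^+ 2.
  by rewrite kk -bb -bc; ring.
have e2 x : al - 2 * ga * x + be * x ^+ 2 = (c - b * x) ^+ 2 + k ^+ 2.
  by rewrite kk -bb -bc; ring.
have [m m0 H] : exists2 m, 0 <= m & forall x,
    f (hyp k (c + b)) + f (hyp k (c - b)) + m * x ^+ 2
      <= f (hyp k (c + b * x)) + f (hyp k (c - b * x)) + m.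
  have [k_0|kn0] := eqVneq k 0.
    have hypE y : f (hyp k y) = f y.
      by rewrite /hyp k_0 expr0n addr0 sqrtr_sqr C2upconv_even.
    have [m m0 H] := parabola_support b c df df1 cf2 f20.
    by exists m => // x; rewrite !hypE.
  have k1 : 0 < k by rewrite lt_def kn0 sqrtr_ge0.
  apply: parabola_support (fun y => der_radial y k1 df)
    (fun y => der2_radial y k1 df1) (cvx_hess k1 cf2 ef2 f10 df1) _ => y.
  have r0 := hyp_gt0 y k1.
  have [e _ E1] := mvt (ltW r0) (fun z _ => df1 z).
  rewrite f10 !subr0 in E1.
  have f1r : 0 <= f1 (hyp k y) by rewrite E1 mulr_ge0// ltW.
  apply: addr_ge0; apply: mulr_ge0 => //; first exact: sqr_ge0.
  by apply: mulr_ge0; [exact: sqr_ge0|rewrite exprn_ge0// invr_ge0 ltW].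
exists m => // x; have := H x; rewrite /hyp -!e1 -!e2.
by have := e1 1; have := e2 1; rewrite !(mulr1, expr1n) => -> ->.
Qed.

End TestClass.

(** * Integrals against the standard normal law *)

Section Gauss.
Context {R : realType}.
Notation mu := (@lebesgue_measure R).
Notation N := (normal_prob (0 : R) 1).
Implicit Types (F : R -> \bar R).
Local Open Scope ereal_scope.

(** The standard normal density is [phi0 * phi x]. The constant is kept apart, as
    it is later absorbed in normalising constants. *)
Definition phi (x : R) : R := expR (- (x ^+ 2 / 2))%R.
Definition phi0 : R := normal_peak (1 : R).

Lemma phi_gt0 x : (0 < phi x)%R. Proof. exact: expR_gt0. Qed.
Lemma phi0_gt0 : (0 < phi0)%R.
Proof. by apply: normal_peak_gt0; exact: oner_neq0. Qed.

Lemma continuous_phi : continuous phi.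
Proof.
have -> : phi = expR \o (fun x => - (x ^+ 2 / 2))%R by [].
move=> x; apply: continuous_comp.
  by apply: cvgN; apply: cvgM; [exact: exprn_continuous|exact: cvg_cst].
exact: continuous_expR.
Qed.

Lemma measurable_phi : measurable_fun setT phi.
Proof. exact: continuous_measurable_fun continuous_phi. Qed.

(** The density is almost everywhere the Radon-Nikodym derivative, by which
    integrals change from one measure to the other. *)
Lemma integral_normal F : measurable_fun setT F -> (forall x, 0 <= F x) ->
  \int[N]_x F x = \int[mu]_x (F x * (phi0 * phi x)%:E).
Proof.
move=> mF F0; have dom := @normal_prob_dominates R 0%R 1%R.
pose g := Radon_Nikodym_SigmaFinite.f N mu.
have ig : mu.-integrable setT g := Radon_Nikodym_SigmaFinite.f_integrable dom.
have mg : measurable_fun setT g := measurable_int _ ig.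
have pdfE x : normal_pdf 0 1 x = (phi0 * phi x)%R.
  by rewrite normal_pdfE ?oner_neq0// /phi0 /phi /normal_fun subr0 expr1n mulNr.
have mp : measurable_fun setT (fun x : R => (phi0 * phi x)%:E).
  by apply/measurable_EFinP; apply: measurable_funM => //; exact: measurable_phi.
have gE : ae_eq mu setT g (fun x => (phi0 * phi x)%:E).
  apply: integral_ae_eq => // A _ mA.
  rewrite -(Radon_Nikodym_SigmaFinite.f_integral dom mA).
  by apply: eq_integral => x _; rewrite pdfE.
rewrite -(Radon_Nikodym_SigmaFinite.change_of_variables dom F0 measurableT mF).
apply: ge0_ae_eq_integral => //.
- exact: emeasurable_funM.
- exact: emeasurable_funM.
- by move=> x _; rewrite mule_ge0// Radon_Nikodym_SigmaFinite.f_ge0.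
- by move=> x _; rewrite mule_ge0// lee_fin mulr_ge0// ltW ?phi0_gt0 ?phi_gt0.
- exact: ae_eqe_mul2l.
Qed.

Lemma measurable_affine (a b : R) : measurable_fun setT (fun x : R => (a * x + b)%R).
Proof. by apply: measurable_funD => //; exact: measurable_funM. Qed.

(** The image of Lebesgue measure by the affine map, rescaled by [`|a|], gives
    intervals their length; Lebesgue measure is the only such measure. *)
Lemma integral_affine F (a b : R) : a != 0%R ->
  measurable_fun setT F -> (forall x, 0 <= F x) ->
  `|a|%:E * \int[mu]_x F (a * x + b)%R = \int[mu]_x F x.
Proof.
move=> a0 mF F0.
pose g (x : measurableTypeR R) : measurableTypeR R := (a * x + b)%R.
have mg : measurable_fun setT g.
  by apply: measurable_funD => //; exact: measurable_funM.
have a1 : (0 <= `|a|)%R by [].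
pose k : {nonneg R} := NngNum a1.
pose nu0 : {measure set (measurableTypeR R) -> \bar R} := mscale k (pushforward mu g).
pose nu := nu0 mg.
have nuE A : measurable A -> mu A = nu A.
  apply: lebesgue_measure_unique => //= _ [[l r]] _ <-.
  rewrite /nu /nu0 /mscale/= /pushforward.
  have [ap|an|/eqP] := ltgtP a 0%R; last by rewrite (negbTE a0).
  - have -> : g @^-1` `]l, r] = `[((r - b) / a)%R, ((l - b) / a)%R[%classic.
      apply/seteqP; split=> x /=; rewrite !in_itv/= /g => /andP[h1 h2]; apply/andP.
        split; [rewrite ler_ndivrMr//|rewrite ltr_ndivlMr//]; lra.
      move: h1 h2; rewrite ler_ndivrMr// ltr_ndivlMr//; split; lra.
    rewrite !lebesgue_measure_itv/= !lte_fin.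
    rewrite ltr_ndivlMr// divfK ?ltr0_neq0// ltrD2r.
    case: ifPn => _; last by rewrite mule0.
    rewrite -EFinM (ltr0_norm ap); congr EFin; field.
    exact: ltr0_neq0.
  - have -> : g @^-1` `]l, r] = `]((l - b) / a)%R, ((r - b) / a)%R]%classic.
      apply/seteqP; split=> x /=; rewrite !in_itv/= /g => /andP[h1 h2]; apply/andP.
        split; [rewrite ltr_pdivrMr//|rewrite ler_pdivlMr//]; lra.
      move: h1 h2; rewrite ltr_pdivrMr// ler_pdivlMr//; split; lra.
    rewrite !lebesgue_measure_itv/= !lte_fin.
    rewrite ltr_pdivlMr// divfK ?lt0r_neq0// ltrD2r.
    case: ifPn => _; last by rewrite mule0.
    rewrite -EFinM (gtr0_norm an); congr EFin; field.
    exact: lt0r_neq0.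
rewrite [RHS](eq_measure_integral nu); last by move=> A mA _; exact: nuE.
rewrite /nu /nu0 ge0_integral_mscale//=.
by rewrite (ge0_integral_pushforward mg).
Qed.

Lemma integral_normalN F : measurable_fun setT F -> (forall x, 0 <= F x) ->
  \int[N]_x F (- x)%R = \int[N]_x F x.
Proof.
move=> mF F0.
have mFN : measurable_fun setT (fun x : R => F (- x)%R).
  exact: (measurable_comp measurableT).
rewrite !integral_normal//.
have m1 : (-1 != 0 :> R)%R by rewrite oppr_eq0 oner_neq0.
rewrite -(@integral_affine (fun x => F x * (phi0 * phi x)%:E) (-1)%R 0%R m1).
- rewrite normrN normr1 mul1e; apply: eq_integral => x _.
  by rewrite mulN1r addr0 /phi sqrrN.
- apply: emeasurable_funM => //; apply/measurable_EFinP.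
  by apply: measurable_funM => //; exact: measurable_phi.
- by move=> x; rewrite mule_ge0// lee_fin mulr_ge0// ltW ?phi0_gt0 ?phi_gt0.
Qed.

(** Rotation invariance of the plane Lebesgue integral: a rotation with
    [c != 0] is an affine change of one variable for each fixed value of the
    other, done once in each direction. *)
Lemma lebesgue_rotation (H : R * R -> \bar R) (c s : R) :
  (c ^+ 2 + s ^+ 2 = 1)%R -> measurable_fun setT H -> (forall x, 0 <= H x) ->
  \int[mu]_x \int[mu]_y H ((c * x + s * y)%R, (c * y - s * x)%R) =
  \int[mu]_x \int[mu]_y H (x, y).
Proof.
move=> cs1 mH H0.
have mpair (T : measurableType _) (f g : T -> R) :
    measurable_fun setT f -> measurable_fun setT g ->
    measurable_fun setT (fun x => H (f x, g x)).
  by move=> mf mg; apply: (measurableT_comp mH); exact: measurable_fun_pair.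
have maff (a b : R) : measurable_fun setT (fun x : R => (a * x + b)%R).
  by apply: measurable_funD => //; exact: measurable_funM.
have mlin (a b : R) : measurable_fun setT (fun x : R * R => (a * x.1 + b * x.2)%R).
  by apply: measurable_funD; apply: measurable_funM.
have affl (a b v : R) : a != 0%R ->
    `|a|%:E * \int[mu]_y H ((a * y + b)%R, v) = \int[mu]_y H (y, v).
  move=> a0; apply: (@integral_affine (fun y => H (y, v))) => //.
  exact: mpair.
have tonelli (G : R * R -> \bar R) : measurable_fun setT G -> (forall x, 0 <= G x) ->
    \int[mu]_x \int[mu]_y G (x, y) = \int[mu]_y \int[mu]_x G (x, y).
  by move=> mG G0; exact: (@fubini_tonelli _ _ _ _ _ mu mu G).
have mF (G : R * R -> \bar R) : measurable_fun setT G -> (forall x, 0 <= G x) ->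
    measurable_fun setT (fun x => \int[mu]_y G (x, y)).
  by move=> mG G0; exact: (@measurable_fun_fubini_tonelli_F _ _ _ _ _ mu G).
have [c0|c0] := eqVneq c 0%R.
  have s1 : (s ^+ 2 = 1)%R by rewrite -cs1 c0 expr0n add0r.
  have s0 : s != 0%R by apply: contra_eq_neq s1 => ->; rewrite expr0n eq_sym oner_neq0.
  have sn0 : (- s != 0)%R by rewrite oppr_eq0.
  have ns : `|s|%R = 1%R by apply/eqP; rewrite -sqrp_eq1// real_normK ?num_real// s1.
  transitivity (\int[mu]_x \int[mu]_y H (y, (- s * x + 0)%R)).
    apply: eq_integral => x _.
    rewrite -(affl s 0%R _ s0) ns mul1e; apply: eq_integral => y _.
    by rewrite c0 !mul0r add0r !addr0 sub0r mulNr.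
  apply: (etrans (tonelli (fun p => H (p.2, (- s * p.1 + 0)%R)) _ (fun=> H0 _))).
    apply: mpair => //; apply: (measurableT_comp (maff _ _)).
    exact: measurable_fst.
  apply: eq_integral => y _ /=.
  rewrite -(@integral_affine (fun x => H (y, x)) (- s)%R 0%R sn0)//.
    by rewrite normrN ns mul1e.
  exact: mpair.
have nc0 : (`|c| != 0)%R by rewrite normr_eq0.
have mG : measurable_fun setT (fun p : R * R => H ((c^-1 * p.1 + s / c * p.2)%R, p.2)).
  exact: mpair.
transitivity (\int[mu]_x ((`|c|^-1)%:E *
    \int[mu]_w H ((c^-1 * x + s / c * w)%R, w))).
  apply: eq_integral => x _.
  rewrite -(@integral_affine (fun w => H ((c^-1 * x + s / c * w)%R, w))
    c (- (s * x))%R c0)//.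
    rewrite muleA -EFinM mulVf// mul1e; apply: eq_integral => y _.
    congr (H (_, _)); transitivity (((c ^+ 2 + s ^+ 2) * x - s ^+ 2 * x) / c + s * y)%R.
      by field.
    by rewrite cs1 mul1r; field.
  apply: mpair => //; under eq_fun do rewrite addrC.
  exact: maff.
rewrite ge0_integralZl ?lee_fin ?invr_ge0//; last 2 first.
  exact: (mF _ mG).
  by move=> x _; exact: integral_ge0.
rewrite (tonelli _ mG)//=.
transitivity ((`|c|^-1)%:E * \int[mu]_w (`|c|%:E * \int[mu]_x H (x, w))).
  congr (_ * _); apply: eq_integral => w _.
  have cV0 : (c^-1 != 0)%R by rewrite invr_eq0.
  by rewrite -(affl _ (s / c * w)%R w cV0) muleA -EFinM normfV mulfV// mul1e.
rewrite ge0_integralZl ?lee_fin//; last 2 first.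
  exact: (@measurable_fun_fubini_tonelli_G _ _ _ _ _ mu H).
  by move=> x _; exact: integral_ge0.
by rewrite muleA -EFinM mulVf// mul1e tonelli.
Qed.

(** The density of a pair of independent standard normals depends only on the
    distance to the origin. *)
Lemma normal_rotation (H : R * R -> \bar R) (c s : R) :
  (c ^+ 2 + s ^+ 2 = 1)%R -> measurable_fun setT H -> (forall x, 0 <= H x) ->
  \int[N]_x \int[N]_y H ((c * x + s * y)%R, (c * y - s * x)%R) =
  \int[N]_x \int[N]_y H (x, y).
Proof.
move=> cs1 mH H0.
pose w (p : R * R) : \bar R := ((phi0 * phi p.1) * (phi0 * phi p.2))%:E.
have w0 p : 0 <= w p by rewrite lee_fin !mulr_ge0// ltW// ?phi0_gt0// phi_gt0.
have mw : measurable_fun setT w.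
  apply/measurable_EFinP; apply: measurable_funM.
    by apply: measurable_funM => //; apply: (measurableT_comp measurable_phi).
  by apply: measurable_funM => //; apply: (measurableT_comp measurable_phi).
have nE (G : R * R -> \bar R) : measurable_fun setT G -> (forall x, 0 <= G x) ->
    \int[N]_x \int[N]_y G (x, y) = \int[mu]_x \int[mu]_y (G (x, y) * w (x, y)).
  move=> mG G0; rewrite integral_normal; last 2 first.
    exact: (@measurable_fun_fubini_tonelli_F _ _ _ _ _ N G).
    by move=> x; exact: integral_ge0.
  apply: eq_integral => x _.
  have mGx : measurable_fun setT (fun y => G (x, y)).
    by apply: (measurableT_comp mG).
  rewrite integral_normal// muleC -ge0_integralZl//.
  - by apply: eq_integral => y _; rewrite /w EFinM muleCA.
  - apply: emeasurable_funM => //; apply/measurable_EFinP.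
    by apply: measurable_funM => //; exact: measurable_phi.
  - by move=> y _; rewrite mule_ge0// lee_fin mulr_ge0// ltW ?phi0_gt0 ?phi_gt0.
  - by rewrite lee_fin mulr_ge0// ltW ?phi0_gt0 ?phi_gt0.
have mrot : measurable_fun setT
    (fun p : R * R => ((c * p.1 + s * p.2)%R, (c * p.2 - s * p.1)%R)).
  apply: measurable_fun_pair.
    by apply: measurable_funD; apply: measurable_funM.
  by apply: measurable_funB; apply: measurable_funM.
apply: (etrans (nE (fun p => H ((c * p.1 + s * p.2)%R, (c * p.2 - s * p.1)%R))
  (measurableT_comp mH mrot) (fun=> H0 _))).
apply: (etrans _ (esym (nE H mH H0))).
apply: (etrans _ (@lebesgue_rotation (fun p => H p * w p) c s cs1 _ _)); last 2 first.
- exact: emeasurable_funM.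
- by move=> p; rewrite mule_ge0.
apply: eq_integral => x _; apply: eq_integral => y _; congr (_ * _%:E).
rewrite /= mulrACA [RHS]mulrACA; congr (_ * _)%R; rewrite /phi -!expRD; congr expR.
transitivity (- ((c ^+ 2 + s ^+ 2) * (x ^+ 2 + y ^+ 2) / 2))%R; last by field.
by rewrite cs1; field.
Qed.

End Gauss.

(** * Trading random signs for normal variables *)

Section Averages.
Context {R : realType} {d : nat}.
Notation N := (normal_prob (0 : R) 1).
Notation point := (d.-tuple R).
Implicit Types (F H : point -> \bar R) (a : point) (b c : 'rV[R]_d) (bs : seq 'rV[R]_d).
Local Open Scope ereal_scope.

Definition translate a (x : R) b : point := [tuple (tnth a i + x * b 0 i)%R | i < d].

Definition nice F := measurable_fun setT F /\ forall a, 0 <= F a.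

Definition gauss_avg b F a := \int[N]_x F (translate a x b).
Definition sign_avg b F a :=
  (F (translate a 1 b) + F (translate a (-1) b)) * (2^-1)%:E.

Definition gauss_avgs bs F := foldr gauss_avg F bs.
Definition sign_avgs bs F := foldr sign_avg F bs.

Lemma translateC a x y b c : translate (translate a x b) y c = translate (translate a y c) x b.
Proof. by apply: eq_from_tnth => i; rewrite !tnth_mktuple; ring. Qed.

Lemma translate0 a x : translate a x 0 = a.
Proof. by apply: eq_from_tnth => i; rewrite !tnth_mktuple mxE mulr0 addr0. Qed.

Lemma measurable_translate b :
  measurable_fun setT (fun p : point * R => translate p.1 p.2 b).
Proof.
apply/measurable_fun_tnthP => i.
rewrite (_ : _ \o _ = fun p : point * R => (tnth p.1 i + p.2 * b 0 i)%R); last first.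
  by apply/funext => p /=; rewrite tnth_mktuple.
apply: measurable_funD; last by apply: measurable_funM.
exact: (measurableT_comp (measurable_tnth i) measurable_fst).
Qed.

Lemma nice_comp F (e : measure_display) (T : measurableType e) (g : T -> point) :
  nice F -> measurable_fun setT g -> measurable_fun setT (fun t => F (g t)).
Proof. by move=> [mF _] mg; exact: measurableT_comp mF mg. Qed.

Lemma measurable_translate1 a b : measurable_fun setT (fun x : R => translate a x b).
Proof. exact: (measurableT_comp (measurable_translate b) (measurable_pair1 a)). Qed.

Lemma measurable_translate2 x b : measurable_fun setT (fun a => translate a x b).
Proof. exact: (measurableT_comp (measurable_translate b) (measurable_pair2 x)). Qed.

Lemma nice_gauss b F : nice F -> nice (gauss_avg b F).
Proof.
move=> nF; split => [|a]; last by apply: integral_ge0 => x _; case: nF.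
apply: (@measurable_fun_fubini_tonelli_F _ _ _ _ _ N (fun p => F (translate p.1 p.2 b))).
  exact: nice_comp (measurable_translate b).
by move=> p; case: nF.
Qed.

Lemma nice_gausss bs F : nice F -> nice (gauss_avgs bs F).
Proof. by move=> nF; elim: bs => //= b bs; exact: nice_gauss. Qed.

Lemma measurable_translate_shift a b c :
  measurable_fun setT (fun p : R * R => translate (translate a p.1 b) p.2 c).
Proof.
exact: (measurableT_comp (measurable_translate c) (measurable_fun_pair
  (measurableT_comp (measurable_translate1 a b) measurable_fst) measurable_snd)).
Qed.

Lemma gauss_avgC b c F : nice F ->
  gauss_avg b (gauss_avg c F) = gauss_avg c (gauss_avg b F).
Proof.
move=> nF; apply/funext => a; rewrite /gauss_avg.
rewrite (fubini_tonelli (m1 := N) (m2 := N) (fun p => F (translate (translate a p.1 b) p.2 c))).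
- by apply: eq_integral => x _; apply: eq_integral => y _; rewrite /= translateC.
- exact: nice_comp (measurable_translate_shift _ _ _).
- by move=> p; case: nF.
Qed.

(** Rotation invariance of the plane normal law, carried over from the two normal
    coefficients to the two directions that they multiply. *)
Lemma gauss_avg_rot b c F (u v : R) : nice F -> (u ^+ 2 + v ^+ 2 = 1)%R ->
  gauss_avg (u *: b - v *: c) (gauss_avg (v *: b + u *: c) F) =
  gauss_avg b (gauss_avg c F).
Proof.
move=> nF uv; apply/funext => a; rewrite /gauss_avg.
rewrite -(@normal_rotation _ (fun p => F (translate (translate a p.1 b) p.2 c)) u v uv).
- apply: eq_integral => x _; apply: eq_integral => y _ /=; congr F.
  by apply: eq_from_tnth => i; rewrite !tnth_mktuple !mxE; ring.
- exact: nice_comp (measurable_translate_shift _ _ _).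
- by move=> p; case: nF.
Qed.

Lemma gauss_avg0 F : nice F -> gauss_avg 0 F = F.
Proof.
move=> nF; apply/funext => a; rewrite /gauss_avg.
under eq_integral do rewrite translate0.
by rewrite integral_cst//= probability_setT mule1.
Qed.

Lemma gauss_avg_le b F H : nice F -> nice H -> (forall a, F a <= H a) ->
  forall a, gauss_avg b F a <= gauss_avg b H a.
Proof.
move=> nF nH FH a; apply: ge0_le_integral => //.
- by move=> x _; case: nF.
- exact: nice_comp (measurable_translate1 _ _).
- exact: nice_comp (measurable_translate1 _ _).
Qed.

Lemma sign_avg_le b F H : (forall a, F a <= H a) ->
  forall a, sign_avg b F a <= sign_avg b H a.
Proof. by move=> FH a; rewrite lee_wpmul2r ?lee_fin ?invr_ge0// leeD. Qed.

Definition sign_le_gauss F := forall b a, sign_avg b F a <= gauss_avg b F a.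

Lemma sign_gaussC b c F : nice F ->
  sign_avg b (gauss_avg c F) = gauss_avg c (sign_avg b F).
Proof.
move=> nF; apply/funext => a; rewrite /sign_avg /gauss_avg.
have mF x : measurable_fun setT (fun y : R => F (translate (translate a y c) x b)).
  by apply: nice_comp => //; exact: (measurableT_comp (measurable_translate2 _ _) (measurable_translate1 _ _)).
have F0 x : 0 <= F x by case: nF.
rewrite ge0_integralZr//; last by move=> x _; rewrite adde_ge0.
  rewrite ge0_integralD//; [|exact: mF..].
  by congr ((_ + _) * _); apply: eq_integral => x _; rewrite translateC.
exact: (emeasurable_funD (mF 1%R) (mF (-1)%R)).
Qed.

(** Averages along different directions commute, so the comparison along [b] can be
    made inside the normal average along [c]. *)
Lemma sign_le_gauss_avg c F : nice F -> sign_le_gauss F ->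
  sign_le_gauss (gauss_avg c F).
Proof.
move=> nF sF b a; rewrite sign_gaussC// gauss_avgC//.
have [mF F0] := nF.
apply: gauss_avg_le => //; last exact: nice_gauss.
split=> [|y]; last by rewrite mule_ge0 ?adde_ge0// lee_fin invr_ge0.
apply: emeasurable_funM => //; apply: emeasurable_funD;
  by apply: nice_comp => //; exact: measurable_translate2.
Qed.

(** The inequality for a single direction survives the averages already taken in
    the other directions, so signs can be traded for normals one at a time. *)
Lemma sign_avgs_le_gauss bs F : nice F -> sign_le_gauss F ->
  forall a, sign_avgs bs F a <= gauss_avgs bs F a.
Proof.
move=> nF sF; elim: bs => [//|b bs IH a /=].
apply: le_trans (sign_avg_le b IH a) _.
suff : sign_le_gauss (gauss_avgs bs F) by apply.
elim: bs {IH} => [//|c bs IH /=]; apply: sign_le_gauss_avg => //.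
exact: nice_gausss.
Qed.

End Averages.

(** * From normal directions to the chi-square law *)

Section Chi.
Context {R : realType}.
Notation N := (normal_prob (0 : R) 1).
Local Open Scope ereal_scope.

Lemma integral_chi0 (h : R -> \bar R) :
  measurable_fun setT h -> (forall x, 0 <= h x) ->
  \int[chi_square 0]_y h y = h 0%R.
Proof. by move=> mh h0; rewrite integral_dirac// diracT mul1e. Qed.

Lemma integral_chiS k (h : R -> \bar R) :
  measurable_fun setT h -> (forall x, 0 <= h x) ->
  \int[chi_square k.+1]_y h y =
  \int[N]_x \int[chi_square k]_y h (y + x ^+ 2)%R.
Proof.
move=> mh h0; rewrite /= ge0_integral_distribution//.
transitivity (\int[(chi_square k \x N)%E]_p h (add_sqr p)) => //.
rewrite fubini_tonelli2//.
exact: (measurableT_comp mh (@measurable_add_sqr R)).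
Qed.

(** One more square can only increase a nondecreasing function of the sum. *)
Lemma chi_square_le k l (h : R -> \bar R) : (k <= l)%N ->
  measurable_fun setT h -> (forall x, 0 <= h x) ->
  (forall x y, (x <= y)%R -> h x <= h y) ->
  \int[chi_square k]_y h y <= \int[chi_square l]_y h y.
Proof.
move=> + mh h0 hm; elim: l => [|l IH]; first by rewrite leqn0 => /eqP ->.
rewrite leq_eqVlt => /orP[/eqP -> //|]; rewrite ltnS => /IH/le_trans; apply.
rewrite integral_chiS//.
rewrite -[leLHS]mule1 -(@probability_setT _ _ _ N) -integral_cst//.
have mp (x : R) : measurable_fun setT (fun y : R => h (y + x ^+ 2)%R).
  by apply: (measurableT_comp mh); exact: measurable_funD.
apply: ge0_le_integral => //.
- by move=> x _; exact: integral_ge0.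
- apply: (@measurable_fun_fubini_tonelli_F _ _ _ _ _ (chi_square l)
    (fun p : R * R => h (p.2 + p.1 ^+ 2)%R)) => //.
  apply: (measurableT_comp mh); apply: measurable_funD => //.
  exact: measurable_funX.
- move=> x _; apply: ge0_le_integral => //.
    exact: mp.
  by move=> y _; apply: hm; rewrite lerDl sqr_ge0.
Qed.

End Chi.

Section Gram.
Context {R : realType} {d : nat}.
Notation N := (normal_prob (0 : R) 1).
Notation point := (d.-tuple R).
Implicit Types (F H : point -> \bar R) (a : point) (b c : 'rV[R]_d) (bs : seq 'rV[R]_d).

(** The covariance matrix of the sum of the directions multiplied by independent
    standard normals. *)
Definition gram bs i j : R := \sum_(b <- bs) b 0 i * b 0 j.

Lemma gram_diag_eq0 bs i : gram bs i i = 0 -> {in bs, forall b, b 0 i = 0}.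
Proof.
move=> g0 b bbs; apply/eqP; rewrite -sqrf_eq0.
have : (\sum_(b <- bs) b 0 i * b 0 i == 0) by apply/eqP.
rewrite psumr_eq0; last by move=> c _; rewrite -expr2 sqr_ge0.
by move=> /allP /(_ b bbs) /=; rewrite -expr2.
Qed.

(** A rotation of two directions can kill the coordinate [i] of one of them, and
    changes neither the normal averages nor the covariance matrix; repeating this
    gathers coordinate [i] in a single direction. *)
Lemma gather_coordinate i bs : exists b bs',
  [/\ forall F, nice F -> gauss_avgs (b :: bs') F = gauss_avgs bs F,
      {in bs', forall c, c 0 i = 0} &
      forall j k, gram (b :: bs') j k = gram bs j k].
Proof.
elim: bs => [|c bs [b [bs' [IH z g]]]].
  exists 0, [::]; split => // [F nF|j k]; first exact: gauss_avg0.
  by rewrite /gram big_cons mxE mul0r add0r.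
pose r := Num.sqrt (c 0 i ^+ 2 + b 0 i ^+ 2).
have rr : r ^+ 2 = c 0 i ^+ 2 + b 0 i ^+ 2.
  by rewrite sqr_sqrtr// addr_ge0 ?sqr_ge0.
have [r0|r0] := eqVneq r 0.
  exists c, (b :: bs'); split => [F nF|e|j k].
  - by rewrite /= -(IH F nF).
  - rewrite inE => /orP[/eqP ->|]; last exact: z.
    apply/eqP; rewrite -sqrf_eq0 eq_le sqr_ge0 andbT.
    have := sqr_ge0 (c 0 i); move: rr; rewrite r0 expr0n/=; lra.
  - by rewrite [LHS]big_cons [RHS]big_cons; congr (_ + _); exact: g.
pose u := c 0 i / r; pose v := - b 0 i / r.
have uv : u ^+ 2 + v ^+ 2 = 1.
  by rewrite /u /v !expr_div_n sqrrN -mulrDl -rr divff// sqrf_eq0.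
exists (u *: c - v *: b), ((v *: c + u *: b) :: bs'); split => [F nF|e|j k].
- rewrite /= -(IH F nF) /= gauss_avg_rot//; exact: nice_gausss.
- rewrite inE => /orP[/eqP ->|]; last exact: z.
  by rewrite !mxE /u /v; field.
- rewrite [LHS]big_cons [RHS]big_cons -[X in _ = _ + X]g.
  rewrite [in LHS]big_cons [in RHS]/gram big_cons !mxE.
  transitivity ((u ^+ 2 + v ^+ 2) * (c 0 j * c 0 k + b 0 j * b 0 k) +
    \sum_(b <- bs') b 0 j * b 0 k); first by ring.
  by rewrite uv mul1r addrA.
Qed.

Definition sqnorm a : R := \sum_(i < d) tnth a i ^+ 2.

Lemma measurable_sqnorm : measurable_fun setT sqnorm.
Proof.
apply: measurable_sum => i; apply: measurable_funX; exact: measurable_tnth.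
Qed.

Lemma nice_radial (h : R -> \bar R) : measurable_fun setT h ->
  (forall x, 0 <= h x)%E -> nice (fun a => h (sqnorm a)).
Proof. by move=> mh h0; split => //; exact: measurableT_comp mh measurable_sqnorm. Qed.

(** The coordinates are split off one at a time. Once coordinate [k] is gathered
    in the direction [b], the covariance matrix forces [b] to be plus or minus
    the k-th coordinate vector, and the remaining directions lie in the span of
    the coordinate vectors before it. *)
Lemma gauss_avgs_chi k bs a (h : R -> \bar R) : (k <= d)%N ->
  measurable_fun setT h -> (forall x, 0 <= h x)%E ->
  (forall i j : 'I_d, gram bs i j = ((i == j) && (i < k)%N)%:R) ->
  (forall i : 'I_d, (i < k)%N -> tnth a i = 0) ->
  gauss_avgs bs (fun v => h (sqnorm v)) a =
  (\int[chi_square k]_y h (sqnorm a + y)%R)%E.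
Proof.
elim: k bs a => [|k IH] bs a kd mh h0 gbs a0; have nh := nice_radial mh h0.
  rewrite integral_chi0 ?addr0//; last first.
    by apply: (measurableT_comp mh); exact: measurable_funD.
  have : {in bs, forall b, b = 0}.
    move=> b bbs; apply/rowP => i; rewrite mxE.
    by apply: gram_diag_eq0 bbs; rewrite gbs andbF.
  elim: bs {gbs} => [//|b bs IHbs] b0 /=.
  rewrite (b0 b) ?mem_head// gauss_avg0.
    by apply: IHbs => c cbs; apply: b0; rewrite inE cbs orbT.
  exact: nice_gausss.
pose i0 := Ordinal kd.
have [b [bs' [gE z g]]] := gather_coordinate i0 bs.
have gi0 j : gram (b :: bs') i0 j = b 0 i0 * b 0 j.
  by rewrite /gram big_cons big_seq big1 ?addr0// => c /z ->; rewrite mul0r.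
have b1 : b 0 i0 ^+ 2 = 1 by rewrite expr2 -gi0 g gbs eqxx ltnSn.
have bn0 : b 0 i0 != 0 by apply: contra_eq_neq b1 => ->; rewrite expr0n eq_sym oner_neq0.
have b0 j : j != i0 -> b 0 j = 0.
  move=> ji; apply: (mulfI bn0); rewrite -gi0 g gbs mulr0.
  by rewrite eq_sym (negbTE ji).
rewrite -gE//= /gauss_avg integral_chiS//; last first.
  by apply: (measurableT_comp mh); exact: measurable_funD.
apply: eq_integral => x _; rewrite IH//; first last.
- move=> i ik; rewrite tnth_mktuple a0 1?ltnS ?(ltnW ik)// b0 ?mulr0 ?addr0//.
  by rewrite -val_eqE/= ltn_eqF.
- move=> i j; have := g i j; rewrite gbs /gram big_cons => /(canRL (addKr _)) ->.
  have [->|ii] := eqVneq i i0.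
    rewrite ltnn andbF.
    have [->|ji] := eqVneq j i0; first by rewrite -expr2 b1 /= ltnSn addNr.
    by rewrite (b0 j)// mulr0 /= oppr0 addr0.
  rewrite (b0 i)// mul0r oppr0 add0r ltnS leq_eqVlt.
  by move: ii; rewrite -val_eqE/= => /negbTE ->.
- exact: ltnW.
- apply: eq_integral => y _; congr h.
  suff -> : sqnorm (translate a x b) = sqnorm a + x ^+ 2 by ring.
  rewrite /sqnorm (bigD1 i0)//= [in RHS](bigD1 i0)//= tnth_mktuple a0 ?ltnSn//.
  rewrite add0r exprMn b1 mulr1 expr0n add0r addrC; congr (_ + _).
  by apply: eq_bigr => i /b0 bi; rewrite tnth_mktuple bi mulr0 addr0.
Qed.

End Gram.

(** * One random sign against one normal variable *)

Section SecondMoment.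
Context {R : realType}.
Notation mu := (@lebesgue_measure R).
Notation N := (normal_prob (0 : R) 1).
Local Open Scope ereal_scope.

(** Compare the masses of [phi] and of its dilates [phi (a x)], [a > 1]: the
    bound [phi x <= phi (a x) + (a^2 - 1)/2 x^2 phi x] gives
    [2 / (a (a + 1)) <= E g^2]; let [a] tend to 1. *)
Lemma normal_second_moment_ge1 : 1 <= \int[N]_x (x ^+ 2)%:E.
Proof.
set M := \int[N]_x _.
have M0 : 0 <= M by apply: integral_ge0 => x _; rewrite lee_fin sqr_ge0.
have mX : measurable_fun setT (fun x : R => x ^+ 2)%R by exact: measurable_funX.
have mass1 : \int[mu]_x (phi0 * phi x)%:E = 1 :> \bar R.
  have := @integral_normal R (cst 1) (measurable_cst _) (fun=> lee01).
  rewrite integral_cst//= probability_setT mule1 => ->.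
  by apply: eq_integral => x _; rewrite mul1e.
have mphi : measurable_fun setT (fun x : R => (phi0 * phi x)%:E).
  by apply/measurable_EFinP; apply: measurable_funM => //; exact: measurable_phi.
have key (a : R) : (1 < a)%R -> 1 <= (a^-1)%:E + ((a ^+ 2 - 1) / 2)%:E * M.
  move=> a1; have a0 : (0 < a)%R by lra.
  have e0 : (0 <= (a ^+ 2 - 1) / 2)%R by rewrite divr_ge0// subr_ge0 expr_ge1// ltW.
  have mphia : measurable_fun setT (fun x : R => (phi0 * phi (a * x + 0)%R)%:E).
    have maff : measurable_fun setT (fun x : R => (a * x + 0)%R).
      by apply: measurable_funD => //; exact: measurable_funM.
    exact: (measurableT_comp mphi maff).
  have -> : (a^-1)%:E = \int[mu]_x (phi0 * phi (a * x + 0)%R)%:E :> \bar R.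
    have /esym := @integral_affine R (fun x => (phi0 * phi x)%:E) a 0%R (lt0r_neq0 a0)
      mphi (fun x => ltW (mulr_gt0 phi0_gt0 (phi_gt0 x))).
    rewrite mass1 => e1; rewrite -[LHS]mule1 {}e1 muleA -EFinM gtr0_norm//.
    by rewrite mulVf ?mul1e// gt_eqF.
  rewrite /M integral_normal//; last 2 first.
  - exact/measurable_EFinP.
  - by move=> x; rewrite lee_fin sqr_ge0.
  have mxp : measurable_fun setT (fun x : R => (x ^+ 2)%:E * (phi0 * phi x)%:E).
    by apply: emeasurable_funM => //; exact/measurable_EFinP.
  rewrite -ge0_integralZl//; last first.
    by move=> x _; rewrite mule_ge0// lee_fin ?sqr_ge0// ltW// mulr_gt0 ?phi0_gt0 ?phi_gt0.
  have p0 (x : R) : 0 <= (phi0 * phi x)%:E.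
    by rewrite lee_fin ltW// mulr_gt0 ?phi0_gt0 ?phi_gt0.
  have q0 (x : R) : 0 <= ((a ^+ 2 - 1) / 2)%:E * ((x ^+ 2)%:E * (phi0 * phi x)%:E).
    by rewrite !mule_ge0// lee_fin sqr_ge0.
  have mq : measurable_fun setT
      (fun x : R => ((a ^+ 2 - 1) / 2)%:E * ((x ^+ 2)%:E * (phi0 * phi x)%:E)).
    exact: emeasurable_funM.
  rewrite -(@ge0_integralD _ _ _ mu setT measurableT _ _ (fun x _ => p0 _) mphia (fun x _ => q0 x) mq).
  rewrite -mass1; apply: ge0_le_integral => //.
  - exact: emeasurable_funD.
  move=> x _; rewrite -!EFinM -EFinD lee_fin addr0.
  have -> : phi (a * x)%R = (phi x * expR (- ((a ^+ 2 - 1) / 2 * x ^+ 2)))%R.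
    by rewrite /phi -expRD; congr expR; field.
  have := expR_ge1Dx (- ((a ^+ 2 - 1) / 2 * x ^+ 2))%R.
  set E := expR _ => h.
  have : (0 < phi0 * phi x)%R by rewrite mulr_gt0 ?phi0_gt0 ?phi_gt0.
  move: h; set p := (phi0 * phi x)%R; rewrite mulrA -/p; nra.
rewrite leNgt; apply/negP => M1.
have [m mE] : exists m, M = m%:E.
  by exists (fine M); rewrite fineK// ge0_fin_numE// (lt_trans M1)// ltry.
rewrite mE lte_fin in M1; rewrite mE lee_fin in M0.
pose a : R := (1 + (1 - m) / 4)%R.
have a1 : (1 < a)%R by rewrite /a; lra.
have := key a a1; rewrite mE -EFinM -EFinD lee_fin.
have a0 : (0 < a)%R by lra.
have -> : (a^-1 + (a ^+ 2 - 1) / 2 * m = 1 - (a - 1) / a * (1 - (a ^+ 2 + a) / 2 * m))%R.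
  by field; rewrite gt_eqF.
have : (0 < (a - 1) / a)%R by rewrite divr_gt0// subr_gt0.
have : (0 < 1 - (a ^+ 2 + a) / 2 * m)%R by rewrite /a; nra.
nra.
Qed.

End SecondMoment.

Section OneStep.
Context {R : realType} {d : nat}.
Notation N := (normal_prob (0 : R) 1).
Local Open Scope ereal_scope.

Lemma continuous_C2upconv (f : R -> R) : C2upconv f -> continuous f.
Proof.
move=> [[_ df _ _] _ _] x; apply: differentiable_continuous.
exact/derivable1_diffP.
Qed.

Lemma measurable_C2upconv (f : R -> R) : C2upconv f ->
  measurable_fun setT (fun y : R => (f (Num.sqrt y))%:E).
Proof.
move=> uf; apply/measurable_EFinP.
apply: (measurableT_comp (continuous_measurable_fun (continuous_C2upconv uf))).
exact: continuous_measurable_fun (@sqrt_continuous R).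
Qed.

Lemma nice_C2upconv (f : R -> R) : C2upconv f ->
  @nice R d (fun a => (f (Num.sqrt (sqnorm a)))%:E).
Proof.
move=> uf; apply: (nice_radial (measurable_C2upconv uf)) => y.
by rewrite lee_fin C2upconv_ge0.
Qed.

(** Integrate the supporting parabola of [parabola_support] over [x]: the odd part
    drops out by the symmetry of the normal law, and the terms in [m] have the sum
    [m (E g^2 - 1)], which is nonnegative. *)
Lemma sign_le_gauss_radial (f : R -> R) : C2upconv f ->
  @sign_le_gauss R d (fun a => (f (Num.sqrt (sqnorm a)))%:E).
Proof.
move=> uf b a.
pose al := sqnorm a; pose be : R := (\sum_(i < d) b 0 i ^+ 2)%R.
pose ga : R := (\sum_(i < d) tnth a i * b 0 i)%R.
have nE x : sqnorm (translate a x b) = (al + 2 * ga * x + be * x ^+ 2)%R.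
  rewrite /sqnorm /al /be /ga mulr_sumr !mulr_suml -!big_split /=.
  by apply: eq_bigr => i _; rewrite tnth_mktuple; ring.
have al0 : (0 <= al)%R by apply: sumr_ge0 => i _; exact: sqr_ge0.
have be0 : (0 <= be)%R by apply: sumr_ge0 => i _; exact: sqr_ge0.
have norm0 x : (0 <= al + 2 * ga * x + be * x ^+ 2)%R.
  by rewrite -nE; apply: sumr_ge0 => i _; exact: sqr_ge0.
have cs : (ga ^+ 2 <= al * be)%R.
  have [be_0|ben0] := eqVneq be 0%R.
    suff -> : ga = 0%R by rewrite be_0 mulr0 expr0n.
    apply: big1 => i _; have /eqP := be_0.
    rewrite psumr_eq0; last by move=> j _; exact: sqr_ge0.
    by move=> /allP /(_ i (mem_index_enum _)); rewrite /= sqrf_eq0 => /eqP ->; rewrite mulr0.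
  have := norm0 (- (ga / be))%R; have be1 : (0 < be)%R by rewrite lt_def ben0.
  have -> : (al + 2 * ga * - (ga / be) + be * (- (ga / be)) ^+ 2 = (al * be - ga ^+ 2) / be)%R.
    by field.
  by rewrite pmulr_lge0 ?invr_gt0// subr_ge0.
have [m m0 H] := radial_parabola_support uf al0 be0 cs.
pose g x := (f (Num.sqrt (sqnorm (translate a x b))))%:E.
have g0 x : 0 <= g x by rewrite lee_fin C2upconv_ge0.
have mg : measurable_fun setT g.
  exact: (nice_comp (nice_C2upconv uf) (measurable_translate1 a b)).
have mgN : measurable_fun setT (fun x : R => g (- x)%R).
  by apply: (measurable_comp measurableT) => //.
have m0E : 0 <= m%:E by rewrite lee_fin.
have msqr : measurable_fun setT (fun x : R => (x ^+ 2)%:E).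
  by apply/measurable_EFinP; exact: measurable_funX.
rewrite /sign_avg /gauss_avg -/(g 1%R) -/(g (-1)%R).
have : (g 1%R + g (-1)%R) + m%:E * \int[N]_x (x ^+ 2)%:E <= (\int[N]_x g x + \int[N]_x g x) + m%:E.
  rewrite -[X in _ <= _ + X + _](integral_normalN mg g0).
  have cstE c : \int[N]_x (cst c x) = c by rewrite integral_cst//= probability_setT mule1.
  rewrite -[X in X + _ <= _](cstE (g 1%R + g (-1)%R)) -[X in _ <= _ + X](cstE m%:E).
  have s0 (x : R) : 0 <= (x ^+ 2)%:E by rewrite lee_fin sqr_ge0.
  have ms0 (x : R) : 0 <= m%:E * (x ^+ 2)%:E by rewrite mule_ge0.
  have mms : measurable_fun setT (fun x : R => m%:E * (x ^+ 2)%:E).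
    exact: emeasurable_funM.
  have c0 (x : R) : 0 <= cst (g 1%R + g (-1)%R) x by rewrite /= adde_ge0.
  have gg0 (x : R) : 0 <= g x + g (- x)%R by rewrite adde_ge0.
  have mgg : measurable_fun setT (fun x : R => g x + g (- x)%R).
    exact: emeasurable_funD.
  have intD (f1 f2 : R -> \bar R) : measurable_fun setT f1 -> measurable_fun setT f2 ->
      (forall x, 0 <= f1 x) -> (forall x, 0 <= f2 x) ->
      \int[N]_x f1 x + \int[N]_x f2 x = \int[N]_x (f1 x + f2 x).
    by move=> m1 m2 h1 h2; rewrite ge0_integralD.
  rewrite -ge0_integralZl// intD// intD// intD//.
  apply: ge0_le_integral => //.
  - by move=> x _; rewrite adde_ge0.
  - exact: emeasurable_funD.
  - exact: emeasurable_funD.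
  move=> x _; rewrite /g !nE -!EFinM -!EFinD lee_fin.
  have := H x; rewrite !(mulrN, mulNr, sqrrN, mulr1, expr1n).
  by [].
have := @normal_second_moment_ge1 R.
move=> /(lee_wpmul2l m0E); rewrite mule1 => M1 le1.
have : (g 1%R + g (-1)%R) + m%:E <= (\int[N]_x g x + \int[N]_x g x) + m%:E.
  by apply: le_trans le1; rewrite leeD2l.
rewrite leeD2rE// => le2.
have -> : \int[N]_x g x = (\int[N]_x g x + \int[N]_x g x) * (2^-1)%:E.
  rewrite -[X in (X + _) * _]mul1e -[X in (_ + X) * _]mul1e -ge0_muleDl ?lee01//.
  by rewrite muleAC -EFinD -EFinM divff ?mul1e.
by rewrite lee_wpmul2r// lee_fin invr_ge0.
Qed.
End OneStep.

(** * The density of the chi distribution *)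

Section ChiDensity.
Context {R : realType}.
Notation mu := (@lebesgue_measure R).
Notation N := (normal_prob (0 : R) 1).
Local Open Scope ereal_scope.

(** In the induction step the new coordinate is written as [z = x m], so that
    [x^2 + z^2 = (s x)^2] with [s^2 = 1 + m^2]; rescaling [x] by [s] separates the
    two variables. The constant is left in the extended reals: its finiteness is
    read off the total mass in [chi_density]. *)
Lemma chi_density_line k : exists2 C : \bar R, 0 <= C &
  forall h : R -> \bar R, measurable_fun setT h -> (forall x, 0 <= h x) ->
  \int[chi_square k.+1]_y h y =
  C * \int[mu]_x (h (x ^+ 2)%R * (`|x| ^+ k * phi x)%:E).
Proof.
elim: k => [|k [C C0 IH]].
  exists phi0%:E => [|h mh h0]; first by rewrite lee_fin ltW// phi0_gt0.
  have mhx : measurable_fun setT (fun x : R => h (x ^+ 2)%R).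
    by apply: (measurableT_comp mh); exact: measurable_funX.
  rewrite integral_chiS//.
  under eq_integral => x _.
    rewrite integral_chi0//; last first.
      by apply: (measurableT_comp mh); exact: measurable_funD.
    rewrite add0r; over.
  rewrite integral_normal// -ge0_integralZl//.
  - by apply: eq_integral => x _; rewrite expr0 mul1r EFinM muleCA.
  - apply: emeasurable_funM => //; apply/measurable_EFinP.
    apply: measurable_funM; last exact: measurable_phi.
    by apply: measurable_funX; exact: normr_measurable.
  - by move=> x _; rewrite mule_ge0// lee_fin mulr_ge0 ?exprn_ge0// ltW// phi_gt0.
  - by rewrite lee_fin ltW// phi0_gt0.
have wk0 j (x : R) : 0 <= (`|x| ^+ j * phi x)%:E.
  by rewrite lee_fin mulr_ge0 ?exprn_ge0// ltW// phi_gt0.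
have mwk j : measurable_fun setT (fun x : R => (`|x| ^+ j * phi x)%:E).
  apply/measurable_EFinP; apply: measurable_funM; last exact: measurable_phi.
  by apply: measurable_funX; exact: normr_measurable.
pose s : R -> R := hyp 1%R.
have s0 m : (0 < s m)%R by exact: hyp_gt0.
have s2 m : (s m ^+ 2 = 1 + m ^+ 2)%R by rewrite /s hyp_sqr expr1n addrC.
have msV j : measurable_fun setT (fun m => ((s m)^-1 ^+ j)%:E).
  apply/measurable_EFinP; apply: measurable_funX; apply: continuous_measurable_fun.
  move=> m; apply: differentiable_continuous; apply/derivable1_diffP.
  by have [] := @der_hypV R 1%R m ltr01.
pose K := \int[mu]_m ((s m)^-1 ^+ k.+2)%:E.
have K0 : 0 <= K by apply: integral_ge0 => m _; rewrite lee_fin exprn_ge0// invr_ge0 ltW.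
exists (phi0%:E * (C * K)) => [|h mh h0].
  by rewrite !mule_ge0// lee_fin ltW// phi0_gt0.
pose G (p : R * R) : \bar R := h (p.1 ^+ 2 + p.2 ^+ 2)%R * (`|p.1| ^+ k * phi p.1 * phi p.2)%:E.
have G0 p : 0 <= G p.
  by rewrite mule_ge0// lee_fin mulr_ge0 ?(mulr_ge0, exprn_ge0)// ltW// phi_gt0.
have mG : measurable_fun setT G.
  apply: emeasurable_funM.
    apply: (measurableT_comp mh); apply: measurable_funD; apply: measurable_funX.
      exact: measurable_fst.
    exact: measurable_snd.
  apply/measurable_EFinP; apply: measurable_funM.
    exact: (measurableT_comp (measurable_funM (measurable_funX k (@normr_measurable R setT)) measurable_phi) measurable_fst).
  exact: (measurableT_comp measurable_phi measurable_snd).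
pose I := \int[mu]_x (h (x ^+ 2)%R * (`|x| ^+ k.+1 * phi x)%:E).
transitivity (phi0%:E * (C * \int[mu]_z \int[mu]_x G (x, z))).
  have mG1 : measurable_fun setT
      (fun p : R * R => h (p.1 ^+ 2 + p.2 ^+ 2)%R * (`|p.1| ^+ k * phi p.1)%:E).
    apply: emeasurable_funM.
      apply: (measurableT_comp mh); apply: measurable_funD; apply: measurable_funX.
        exact: measurable_fst.
      exact: measurable_snd.
    exact: (measurableT_comp (mwk k) measurable_fst).
  pose Az z := \int[mu]_x (h (x ^+ 2 + z ^+ 2)%R * (`|x| ^+ k * phi x)%:E).
  have Az0 z : 0 <= Az z by apply: integral_ge0 => x _; rewrite mule_ge0.
  have mAz : measurable_fun setT Az.
    apply: (@measurable_fun_fubini_tonelli_G _ _ _ _ _ mu _ mG1) => p.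
    by rewrite mule_ge0.
  have mx z : measurable_fun setT (fun x : R => h (x ^+ 2 + z ^+ 2)%R * (`|x| ^+ k * phi x)%:E).
    exact: (measurableT_comp mG1 (measurable_pair2 z)).
  rewrite integral_chiS//.
  transitivity (\int[N]_z (C * Az z)).
    apply: eq_integral => z _; rewrite IH//.
    by apply: (measurableT_comp mh); exact: measurable_funD.
  rewrite ge0_integralZl// muleCA; congr (_ * _).
  rewrite integral_normal// -ge0_integralZl//; last 3 first.
  - apply: (@measurable_fun_fubini_tonelli_G _ _ _ _ _ mu _ mG) => p.
    exact: G0.
  - by move=> z _; apply: integral_ge0 => x _; exact: G0.
  - by rewrite lee_fin ltW// phi0_gt0.
  apply: eq_integral => z _; rewrite EFinM muleCA; congr (_ * _).
  rewrite -ge0_integralZr//; last 2 first.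
  - by move=> x _; rewrite mule_ge0.
  - by rewrite lee_fin ltW// phi_gt0.
    by apply: eq_integral => x _; rewrite -muleA.
  exact: mx.
rewrite -[RHS]muleA -(muleA C); congr (_ * (_ * _)).
pose F x := h (x ^+ 2)%R * (`|x| ^+ k.+1 * phi x)%:E.
have F0 x : 0 <= F x by rewrite mule_ge0.
have mF : measurable_fun setT F.
  apply: emeasurable_funM; last exact: mwk.
  by apply: (measurableT_comp mh); exact: measurable_funX.
have I0 : 0 <= I by apply: integral_ge0 => x _; exact: F0.
pose G2 (p : R * R) := F (s p.2 * p.1)%R * ((s p.2)^-1 ^+ k.+1)%:E.
have G20 p : 0 <= G2 p by rewrite mule_ge0// lee_fin exprn_ge0// invr_ge0 ltW.
have mG2 : measurable_fun setT G2.
  apply: emeasurable_funM.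
    apply: (measurableT_comp mF); apply: measurable_funM => //.
    apply: (measurableT_comp _ measurable_snd).
    apply: continuous_measurable_fun => m; apply: differentiable_continuous.
    by apply/derivable1_diffP; have [] := @der_hyp R 1%R m ltr01.
  exact: (measurableT_comp (msV k.+1) measurable_snd).
transitivity (\int[mu]_x \int[mu]_z G (x, z)).
  by rewrite (fubini_tonelli (m1 := mu) (m2 := mu) G).
transitivity (\int[mu]_x \int[mu]_m G2 (x, m)).
  have D1 (f : R -> \bar R) : measurable_fun setT f ->
      \int[mu]_x f x = \int[mu]_(x in setT `\ 0%R) f x.
    move=> mf; rewrite integral_setD1//; first exact: measurableD.
    exact: measurable_funTS.
  rewrite D1; last exact: (@measurable_fun_fubini_tonelli_F _ _ _ _ _ mu G).
  rewrite [RHS]D1; last exact: (@measurable_fun_fubini_tonelli_F _ _ _ _ _ mu G2).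
  apply: eq_integral => x; rewrite inE => -[_ /= /eqP x0].
  have mGx : measurable_fun setT (fun z => G (x, z)).
    exact: (measurableT_comp mG (measurable_pair1 x)).
  rewrite -(@integral_affine _ (fun z => G (x, z)) x 0%R)//.
  rewrite -ge0_integralZl//; last first.
    exact: (measurableT_comp mGx (measurable_affine x 0%R)).
  apply: eq_integral => m _; rewrite /G2 /F /G /= addr0.
  have e1 : ((s m * x) ^+ 2 = x ^+ 2 + (x * m) ^+ 2)%R.
    by rewrite exprMn s2; ring.
  have e2 : phi (s m * x)%R = (phi x * phi (x * m))%R.
    by rewrite /phi -expRD e1; congr expR; field.
  rewrite e1 e2 muleCA -muleA -!EFinM; congr (_ * _%:E).
  have -> : (`|s m * x| ^+ k.+1 * (phi x * phi (x * m)) * (s m)^-1 ^+ k.+1 =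
      (`|s m * x| / s m) ^+ k.+1 * (phi x * phi (x * m)))%R.
    by rewrite exprMn; ring.
  rewrite normrM (gtr0_norm (s0 m)) (mulrC (s m)) mulfK ?gt_eqF// exprS.
  by ring.
rewrite (fubini_tonelli (m1 := mu) (m2 := mu) G2)//= /K.
rewrite -ge0_integralZr//; [|exact: msV|]; last first.
  by move=> m _; rewrite lee_fin exprn_ge0// invr_ge0 ltW.
apply: eq_integral => m _.
rewrite /G2 /= ge0_integralZr//; last 2 first.
- apply: (measurableT_comp mF); exact: measurable_funM.
- by rewrite lee_fin exprn_ge0// invr_ge0 ltW.
have sm0 : s m != 0%R by rewrite gt_eqF.
rewrite -[in RHS](@integral_affine _ F (s m) 0%R)// gtr0_norm//.
rewrite muleA -EFinM [in RHS]exprSr divfK// muleC; congr (_ * _).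
by apply: eq_integral => x _; rewrite addr0.
Qed.

End ChiDensity.

Section HalfLine.
Context {R : realType}.
Notation mu := (@lebesgue_measure R).
Notation half := (`[0%R, +oo[%classic : set R).
Local Open Scope ereal_scope.

Lemma even_integral (G : R -> \bar R) : measurable_fun setT G ->
  (forall x, 0 <= G x) ->
  \int[mu]_x G `|x|%R = 2%:E * \int[mu]_(x in half) G x.
Proof.
move=> mG G0.
have mGa : measurable_fun setT (fun x : R => G `|x|%R).
  exact: (measurableT_comp mG (@normr_measurable R setT)).
rewrite -(setUv half) ge0_integral_setU//; last 3 first.
- exact: measurableC.
- by rewrite setUv.
- exact/disj_setPCl.
have -> : \int[mu]_(x in half) G `|x|%R = \int[mu]_(x in half) G x.
  by apply: eq_integral => x; rewrite inE/= in_itv/= andbT => x0; rewrite ger0_norm.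
rewrite setCitvr integral_itv_bndo_bndc; last exact: measurable_funTS.
have -> : \int[mu]_(x in `]-oo, 0%R]) G `|x|%R = \int[mu]_(x in half) G x.
  rewrite ge0_integration_by_substitution0//.
  apply: eq_integral => x; rewrite inE/= in_itv/= => x0.
  by rewrite ler0_norm.
by rewrite -[X in X + _]mul1e -[X in _ + X]mul1e -ge0_muleDl ?lee01// -EFinD.
Qed.

(** The total mass 1 makes the constant of [chi_density_line] positive and
    finite. *)
Lemma chi_density k : exists2 c : R, (0 < c)%R &
  forall F : R -> \bar R, measurable_fun setT F -> (forall x, 0 <= F x) ->
  \int[chi_square k.+1]_y F (Num.sqrt y) =
  \int[mu]_(x in half) (F x * (c * x ^+ k * phi x)%:E).
Proof.
have [C C0 H] := chi_density_line (R := R) k.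
have mh (F : R -> \bar R) : measurable_fun setT F ->
    measurable_fun setT (fun y : R => F (Num.sqrt y)).
  move=> mF; apply: (measurableT_comp mF).
  exact: (continuous_measurable_fun (@sqrt_continuous R)).
have mw : measurable_fun setT (fun x : R => (x ^+ k * phi x)%:E).
  apply/measurable_EFinP; apply: measurable_funM; last exact: measurable_phi.
  exact: measurable_funX.
have mwa : measurable_fun setT (fun x : R => (`|x| ^+ k * phi x)%:E).
  apply/measurable_EFinP; apply: measurable_funM; last exact: measurable_phi.
  by apply: measurable_funX; exact: normr_measurable.
have phia (x : R) : phi `|x|%R = phi x by rewrite /phi real_normK// num_real.
have H2 (F : R -> \bar R) : measurable_fun setT F -> (forall x, 0 <= F x) ->
    \int[chi_square k.+1]_y F (Num.sqrt y) =
    C * (2%:E * \int[mu]_(x in half) (F x * (`|x| ^+ k * phi x)%:E)).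
  move=> mF F0; rewrite H//; last exact: mh.
  rewrite -even_integral; last 2 first.
  - exact: emeasurable_funM.
  - by move=> x; rewrite mule_ge0// lee_fin mulr_ge0 ?exprn_ge0// ltW// phi_gt0.
  congr (_ * _); apply: eq_integral => x _.
  by rewrite sqrtr_sqr normr_id phia.
pose J := \int[mu]_(x in half) (`|x| ^+ k * phi x)%:E.
have J0 : 0 <= J.
  by apply: integral_ge0 => x _; rewrite lee_fin mulr_ge0 ?exprn_ge0// ltW// phi_gt0.
have CJ : C * (2%:E * J) = 1.
  have := H2 (cst 1) (measurable_cst _) (fun=> lee01).
  rewrite integral_cst//= probability_setT mule1 => ->.
  by congr (_ * (_ * _)); apply: eq_integral => x _; rewrite mul1e.
have [c Cc] : exists c, C = c%:E.
  case: C C0 CJ {H H2} => [c| |] // _.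
  - by exists c.
  - move: J0; rewrite le_eqVlt => /orP[/eqP <-|J0].
      by rewrite !mule0 => /esym/eqP; rewrite onee_eq0.
    by rewrite gt0_mulye ?mule_gt0// => /eqP.
have c0 : (0 < c)%R.
  rewrite lt_def -lee_fin -Cc C0 andbT; apply: contra_eq_neq CJ => c_0.
  by rewrite Cc c_0 mul0e eq_sym onee_eq0.
exists (c * 2)%R => [|F mF F0]; first exact: mulr_gt0.
rewrite H2// Cc muleA -EFinM -ge0_integralZl//; last 3 first.
- by apply: measurable_funTS; exact: emeasurable_funM.
- by move=> x _; rewrite mule_ge0// lee_fin mulr_ge0 ?exprn_ge0// ltW// phi_gt0.
- by rewrite lee_fin mulr_ge0// ltW.
apply: eq_integral => x; rewrite inE/= in_itv/= andbT => x0.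
by rewrite muleCA -EFinM (ger0_norm x0) mulrA.
Qed.

(** If the nonnegative difference had integral 0 it would vanish almost
    everywhere, but an interval is not negligible. *)
Lemma integral_lt (D : set R) (f g : R -> R) (a b : R) : measurable D ->
  measurable_fun D f -> measurable_fun D g ->
  (forall x, D x -> 0 <= f x <= g x)%R ->
  \int[mu]_(x in D) (g x)%:E < +oo ->
  (a < b)%R -> `]a, b[%classic `<=` D -> (forall x, a < x < b -> f x < g x)%R ->
  \int[mu]_(x in D) (f x)%:E < \int[mu]_(x in D) (g x)%:E.
Proof.
move=> mD mf mg fg goo ab abD flt.
have d0 x : D x -> 0 <= (g x - f x)%:E by move=> /fg/andP[_ h]; rewrite lee_fin subr_ge0.
have mgf : measurable_fun D (fun x => (g x - f x)%:E).
  by apply/measurable_EFinP; exact: measurable_funB.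
have -> : \int[mu]_(x in D) (g x)%:E =
    \int[mu]_(x in D) (f x)%:E + \int[mu]_(x in D) (g x - f x)%:E.
  rewrite -ge0_integralD//.
  - by apply: eq_integral => x _; rewrite -EFinD addrC subrK.
  - by move=> x /fg/andP[h _]; rewrite lee_fin.
  - exact/measurable_EFinP.
have f0 : 0 <= \int[mu]_(x in D) (f x)%:E.
  by apply: integral_ge0 => x /fg/andP[h _]; rewrite lee_fin.
have ffin : \int[mu]_(x in D) (f x)%:E \is a fin_num.
  rewrite ge0_fin_numE//; apply: le_lt_trans goo; apply: ge0_le_integral => //.
  - by move=> x /fg/andP[h _]; rewrite lee_fin.
  - exact/measurable_EFinP.
  - exact/measurable_EFinP.
  - by move=> x /fg/andP[_ h]; rewrite lee_fin.
rewrite lteDl// lt_def integral_ge0 ?andbT; last exact: d0.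
apply/negP => /eqP int0.
have /(ae_eq_integral_abs mu mD mgf)[B [mB muB0 sub]] :
    \int[mu]_(x in D) `|(g x - f x)%:E| = 0.
  by rewrite -[RHS]int0; apply: eq_integral => x; rewrite inE => /d0 h; rewrite gee0_abs.
have : mu `]a, b[%classic <= mu B.
  apply: le_measure; rewrite ?inE//.
  move=> x abx; apply: sub => /= /(_ (abD x abx)) /eqP.
  move: abx; rewrite /= in_itv/= => /flt lt_fg.
  by rewrite eqe subr_eq0 gt_eqF.
rewrite muB0 lebesgue_measure_itv/= lte_fin ab -EFinB lee_fin.
by rewrite leNgt subr_gt0 ab.
Qed.

Lemma cvg_expr_expRN j : (x ^+ j * expR (- x))%R @[x --> +oo%R] --> (0 : R)%R.
Proof.
apply/cvgrPdist_le => e e0; near=> x.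
have x0 : (0 < x)%R by near: x; exact: nbhs_pinfty_gt.
have xe : (j.+1`!%:R / e <= x)%R by near: x; apply: nbhs_pinfty_ge; rewrite num_real.
rewrite sub0r normrN ger0_norm ?mulr_ge0 ?exprn_ge0 ?expR_ge0 ?(ltW x0)//.
have f0 : (0 < j.+1`!%:R :> R)%R by rewrite ltr0n fact_gt0.
have h : (x ^+ j.+1 / j.+1`!%:R <= expR x)%R.
  by apply: le_trans (expR_ge1Dxn j (ltW x0)); rewrite lerDr.
rewrite expRN ler_pdivrMr ?expR_gt0//.
apply: (@le_trans _ _ (e * (x ^+ j.+1 / j.+1`!%:R))%R); last by rewrite ler_pM2l.
rewrite mulrA ler_pdivlMr// exprS mulrA mulrC ler_wpM2r ?exprn_ge0 ?(ltW x0)//.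
by rewrite -ler_pdivrMl// mulrC.
Unshelve. all: by end_near. Qed.

(** The polynomial factor in the antiderivative
    [- exp_poly l n z * expR (- l z)] of [z ^+ n * expR (- l z)], by repeated
    integration by parts. *)
Fixpoint exp_poly (l : R) n (z : R) : R :=
  if n is m.+1 then (z ^+ m.+1 / l + m.+1%:R / l * exp_poly l m z)%R else l^-1%R.

Lemma exp_poly0 l n : exp_poly l n 0 = (n`!%:R / l ^+ n.+1)%R.
Proof.
elim: n => [|n IH] /=; first by rewrite fact0 expr1 mul1r.
rewrite expr0n mul0r add0r IH factS natrM [in RHS]exprS invfM; ring.
Qed.

Lemma der_exp_poly (l : R) n (z : R) : l != 0%R ->
  is_derive z 1%R (exp_poly l n) (l * exp_poly l n z - z ^+ n)%R.
Proof.
move=> l0; elim: n => [|n IH] /=.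
  by rewrite mulfV// expr0 subrr; exact: der_cst.
apply: der_eq (derD (derM (derX n (der_id z)) (der_cst l^-1 z)) (derZ _ IH)) _.
by rewrite !mulr1; field.
Qed.

Lemma cvg_exp_poly (l : R) n : (0 < l)%R ->
  (exp_poly l n z * expR (- (l * z)))%R @[z --> +oo%R] --> (0 : R)%R.
Proof.
move=> l0; have ln0 : l != 0%R by rewrite gt_eqF.
have ly : (l * z)%R @[z --> +oo%R] --> +oo%R.
  by apply: gt0_cvgMry => //; exact: cvg_id.
have mono j : (z ^+ j * expR (- (l * z)))%R @[z --> +oo%R] --> (0 : R)%R.
  have -> : (fun z => z ^+ j * expR (- (l * z)))%R =
      (fun z => l^-1 ^+ j * ((l * z) ^+ j * expR (- (l * z))))%R.
    by apply/funext => z; rewrite mulrA -exprMn mulrA mulVf// mul1r.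
  rewrite -[X in _ --> X](mulr0 (l^-1 ^+ j)%R).
  apply: cvgM; first exact: cvg_cst.
  exact: (cvg_comp (fun z => l * z)%R _ ly (cvg_expr_expRN j)).
elim: n => [|n IH] /=.
  rewrite -[X in _ --> X](mulr0 l^-1%R); apply: cvgM; first exact: cvg_cst.
  by have := mono 0%N; under eq_fun do rewrite expr0 mul1r.
have -> : (fun z => (z ^+ n.+1 / l + n.+1%:R / l * exp_poly l n z) * expR (- (l * z)))%R =
    (fun z => l^-1 * (z ^+ n.+1 * expR (- (l * z))) +
      n.+1%:R / l * (exp_poly l n z * expR (- (l * z))))%R.
  by apply/funext => z; ring.
rewrite -[X in _ --> X](addr0 (0 : R)%R) -[X in _ --> (X + _)%R](mulr0 l^-1%R).
rewrite -[X in _ --> (_ + X)%R](mulr0 (n.+1%:R / l)%R).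
by apply: cvgD; apply: cvgM => //; exact: cvg_cst.
Qed.

Lemma exp_moment (l t : R) n : (0 < l)%R ->
  \int[mu]_(x in `[t, +oo[) ((x - t) ^+ n * expR (- (l * (x - t))))%:E =
  (n`!%:R / l ^+ n.+1)%:E.
Proof.
move=> l0; have ln0 : l != 0%R by rewrite gt_eqF.
pose B (z : R) := (- (exp_poly l n z * expR (- (l * z))))%R.
pose A (x : R) := B (x - t)%R.
pose f (x : R) := ((x - t) ^+ n * expR (- (l * (x - t))))%R.
have dt (x : R) : is_derive x 1%R (fun x : R => x - t)%R 1%R.
  by apply: der_eq (derB (der_id x) (der_cst t x)) _; rewrite subr0.
have dE (z : R) : is_derive z 1%R (fun z : R => expR (- (l * z)) : R)%R
    (- l * expR (- (l * z)))%R.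
  have dl : is_derive z 1%R (fun z : R => - (l * z))%R (- l)%R.
    have -> : (fun z : R => - (l * z))%R = (fun z : R => - l * z)%R.
      by apply/funext => y; rewrite mulNr.
    by apply: der_eq (derZ (- l)%R (der_id z)) _; rewrite mulr1.
  by apply: der_eq (der_comp (f := expR) (g := fun z : R => (- (l * z))%R) (is_derive_expR _) dl) _; rewrite mulrC.
have dB (z : R) : is_derive z 1%R B (z ^+ n * expR (- (l * z)))%R.
  have -> : B = (fun z : R => -1 * (exp_poly l n z * expR (- (l * z))))%R.
    by apply/funext => y; rewrite mulN1r.
  by apply: der_eq (derZ _ (derM (der_exp_poly n z ln0) (dE z))) _; ring.
have dA (x : R) : is_derive x 1%R A (f x).
  by apply: der_eq (der_comp (f := B) (g := fun x : R => (x - t)%R) (dB _) (dt x)) _; rewrite mulr1.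
have cA : continuous A by exact: der_continuous dA.
have cf : continuous f.
  move=> x; apply: cvgM.
    apply: (@continuous_comp _ _ _ (fun x : R => x - t)%R (fun u => u ^+ n)%R).
      exact: (der_continuous dt).
    exact: exprn_continuous.
  apply: (@continuous_comp _ _ _ (fun x : R => x - t)%R (fun z => expR (- (l * z)))%R).
    exact: (der_continuous dt).
  exact: (der_continuous dE).
rewrite (@ge0_continuous_FTC2y R f A t 0%R).
- by rewrite /A /B subrr exp_poly0 mulr0 oppr0 expR0 mulr1 -EFinB sub0r opprK.
- by move=> x tx; rewrite mulr_ge0 ?expR_ge0// exprn_ge0// subr_ge0.
- exact: continuous_subspaceT.
- rewrite -[X in _ --> X](oppr0 R); apply: cvgN.
  apply: (cvg_comp (fun x : R => x - t)%R _ _ (cvg_exp_poly n l0)).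
  exact: cvg_addrr.
- by move=> x _; have [] := dA x.
- exact: cvg_at_right_filter (cA t).
- by move=> x _; rewrite derive1E; have [] := dA x.
Qed.

End HalfLine.

(** * Comparing a strongly log-concave tail with an exponential *)

Section Tail.
Context {R : realType}.
Notation mu := (@lebesgue_measure R).
Notation half := (`[0%R, +oo[%classic : set R).

Lemma integral_from (t : R) (f : R -> \bar R) : 0 <= t ->
  (\int[mu]_(x in half) (if (t <= x)%R then f x else 0) =
   \int[mu]_(x in `[t, +oo[) f x)%E.
Proof.
move=> t0; rewrite integral_mkcond [RHS]integral_mkcond.
apply: eq_integral => x _; rewrite !patchE.
have [tx|xt] := leP t x.
  rewrite !mem_set//= in_itv/= andbT// (le_trans t0)//.
rewrite [X in _ = X]ifF; first by case: ifP.
by apply/negbTE; rewrite notin_setE/= in_itv/= andbT leNgt xt.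
Qed.

(** A strongly log-concave probability density [p] on the half-line: at each point
    [x] the graph of [log p] has a tangent line, below which it stays by at least
    half the squared distance to [x]. *)
Variable p : R -> R.
Hypothesis mp : measurable_fun setT p.
Hypothesis p_ge0 : forall x, 0 <= x -> 0 <= p x.
Hypothesis p_gt0 : forall x, 0 < x -> 0 < p x.
Hypothesis p_mass : (\int[mu]_(x in half) (p x)%:E = 1)%E.
Hypothesis p_tangent : forall x, 0 < x -> exists s, forall z, 0 <= z ->
  p z <= p x * expR (s * (z - x) - (z - x) ^+ 2 / 2).

Variable u : R.
Hypothesis u0 : 0 < u.

Let tailE := (\int[mu]_(x in `[u, +oo[) (p x)%:E)%E.

Lemma tail_sub : `[u, +oo[%classic `<=` half.
Proof.
by move=> x /=; rewrite !in_itv/= !andbT; exact/le_trans/ltW.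
Qed.

Lemma tail_real : exists2 q, 0 < q & tailE = q%:E.
Proof.
have pT (x : R) : `[u, +oo[%classic x -> 0 <= p x.
  by move=> /tail_sub /=; rewrite in_itv/= andbT => /p_ge0.
have le1 : (tailE <= 1)%E.
  rewrite -p_mass; apply: ge0_subset_integral => //.
  - by apply/measurable_EFinP; exact: measurable_funTS.
  - by move=> x /=; rewrite in_itv/= andbT lee_fin => /p_ge0.
  - exact: tail_sub.
have lt1 : (0 < tailE)%E.
  have -> : (0 = \int[mu]_(x in `[u, +oo[) (0 : R)%:E)%E by rewrite integral0.
  apply: (@integral_lt _ _ _ _ u (u + 1)) => //.
  - exact: measurable_funTS.
  - by move=> x /pT ->; rewrite lexx.
  - by apply: le_lt_trans le1 _; rewrite ltry.
  - by rewrite ltrDl.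
  - by move=> x /=; rewrite !in_itv/= andbT => /andP[/ltW].
  - by move=> x /andP[ux _]; rewrite p_gt0// (lt_trans u0).
exists (fine tailE); last by rewrite fineK// ge0_fin_numE ?(ltW lt1)// (le_lt_trans le1)// ltry.
by rewrite fine_gt0// lt1 (le_lt_trans le1)// ltry.
Qed.

Variable q : R.
Hypothesis q0 : 0 < q.
Hypothesis qE : tailE = q%:E.

Let l := p u / q.
Let l0 : 0 < l. Proof. by rewrite divr_gt0// p_gt0. Qed.

(** The exponential function that agrees with [p] at [u] and has the same tail mass
    past [u]. *)
Definition expo x := p u * expR (- (l * (x - u))).

Lemma expo_gt0 x : 0 < expo x. Proof. by rewrite mulr_gt0 ?p_gt0 ?expR_gt0. Qed.

Lemma expo_u : expo u = p u. Proof. by rewrite /expo subrr mulr0 oppr0 expR0 mulr1. Qed.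

Lemma expo_shift x z : expo z = expo x * expR (- (l * (z - x))).
Proof. by rewrite /expo -mulrA -expRD; congr (_ * expR _); ring. Qed.

Lemma measurable_expo : measurable_fun setT expo.
Proof.
apply: measurable_funM => //; apply: (measurableT_comp (@measurable_expR R)).
apply: measurable_funN; apply: measurable_funM => //; exact: measurable_funB.
Qed.

Lemma expo_moment t n :
  (\int[mu]_(x in `[t, +oo[) ((x - t) ^+ n * expo x)%:E =
   (expo t * (n`!%:R / l ^+ n.+1))%:E)%E.
Proof.
rewrite EFinM -(@exp_moment R l t n l0) -ge0_integralZl//.
- apply: eq_integral => x _; rewrite -EFinM; congr EFin.
  by rewrite (expo_shift t x); ring.
- apply/measurable_EFinP; apply: measurable_funM.
    by apply: measurable_funX; exact: measurable_funB.
  apply: (measurableT_comp (@measurable_expR R)).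
  by apply: measurable_funN; apply: measurable_funM => //; exact: measurable_funB.
- move=> x /=; rewrite in_itv/= andbT => tx.
  by rewrite lee_fin mulr_ge0 ?expR_ge0// exprn_ge0// subr_ge0.
- by rewrite lee_fin ltW// expo_gt0.
Qed.

Lemma expo_tail : (\int[mu]_(x in `[u, +oo[) (expo x)%:E = q%:E)%E.
Proof.
have := expo_moment u 0; under eq_integral do rewrite expr0 mul1r.
move=> ->; rewrite expo_u fact0 expr1 mul1r /l invf_div mulrC divfK// gt_eqF//.
exact: p_gt0.
Qed.

(** Otherwise [p] would lie past [u] below an exponential that agrees with [expo]
    at [u] and decays faster, and its tail mass would be less than [q]. *)
Lemma slope_ge0 : exists2 s, 0 <= s & forall z, 0 <= z ->
  p z <= expo z * expR (s * (z - u) - (z - u) ^+ 2 / 2).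
Proof.
have [s H] := p_tangent u0; exists (s + l); last first.
  move=> z z0; have := H z z0; rewrite /expo -mulrA -expRD.
  have -> // : - (l * (z - u)) + ((s + l) * (z - u) - (z - u) ^+ 2 / 2) =
    s * (z - u) - (z - u) ^+ 2 / 2 by ring.
rewrite leNgt; apply/negP => sl.
have s0 : 0 < - s by have := l0; lra.
suff : (q%:E < q%:E :> \bar R)%E by rewrite ltxx.
rewrite -[X in (X < _)%E]qE.
apply: (@le_lt_trans _ _ (\int[mu]_(x in `[u, +oo[)
   ((p u)%:E * ((x - u) ^+ 0 * expR (- (- s * (x - u))))%:E)))%E.
  apply: ge0_le_integral => //.
  - by move=> x /tail_sub /=; rewrite in_itv/= andbT lee_fin => /p_ge0.
  - by apply/measurable_EFinP; exact: measurable_funTS.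
  - apply: emeasurable_funM => //; apply/measurable_EFinP.
    apply: measurable_funM; first by apply: measurable_funX; exact: measurable_funB.
    apply: (measurableT_comp (@measurable_expR R)).
    by apply: measurable_funN; apply: measurable_funM => //; exact: measurable_funB.
  - move=> x /tail_sub /=; rewrite in_itv/= andbT => x0.
    rewrite -EFinM lee_fin expr0 mul1r; apply: (le_trans (H x x0)).
    rewrite ler_pM2l ?p_gt0// ler_expR mulNr opprK lerBlDr lerDl.
    by rewrite divr_ge0// sqr_ge0.
rewrite ge0_integralZl//; last 3 first.
- apply/measurable_EFinP.
  apply: measurable_funM; first by apply: measurable_funX; exact: measurable_funB.
  apply: (measurableT_comp (@measurable_expR R)).
  by apply: measurable_funN; apply: measurable_funM => //; exact: measurable_funB.
- by move=> x _; rewrite lee_fin expr0 mul1r expR_ge0.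
- by rewrite lee_fin ltW// p_gt0.
rewrite exp_moment// -EFinM lte_fin fact0 expr1 mul1r ltr_pdivrMr//.
have pq : p u = l * q by rewrite /l divfK// gt_eqF.
by rewrite pq mulrC ltr_pM2l//; lra.
Qed.

Lemma p_le_expo x : 0 <= x <= u -> p x <= expo x.
Proof.
move=> /andP[x0 xu]; have [s s0 H] := slope_ge0.
apply: (le_trans (H x x0)); rewrite ler_piMr ?(ltW (expo_gt0 _))//.
rewrite expR_le1; have := sqr_ge0 (x - u); nra.
Qed.

(** [log p - log expo] is concave and vanishes at [u]: if it is nonnegative at
    [y], it is so between [u] and [y]. *)
Lemma expo_le_p x y : u <= x -> x <= y -> expo y <= p y -> expo x <= p x.
Proof.
move=> ux xy Ey; have x0 : 0 < x by exact: lt_le_trans ux.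
have [s H] := p_tangent x0.
have key z : 0 <= z -> expo z <= p z -> (s + l) * (z - x) <= 0 -> expo x <= p x.
  move=> z0 Ez sz; have := le_trans Ez (H z z0).
  rewrite (expo_shift x z) => h.
  have e : expR (s * (z - x) - (z - x) ^+ 2 / 2) <= expR (- (l * (z - x))).
    rewrite ler_expR; have := sqr_ge0 (z - x); lra.
  rewrite -(ler_pM2r (expR_gt0 (- (l * (z - x))))); apply: (le_trans h).
  by rewrite ler_pM2l// p_gt0.
have [sl|sl] := leP 0 (s + l).
  by apply: (key u) => //; rewrite ?expo_u ?(ltW u0)//; nra.
apply: (key y) => //; first by rewrite (le_trans (ltW x0)).
by nra.
Qed.

(** The quadratic term in [slope_ge0] bounds the set of points where
    [expo <= p]; take its supremum. *)
Lemma crossing : exists2 z, u <= z &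
  (forall x, u <= x < z -> expo x <= p x) /\ (forall x, z < x -> p x < expo x).
Proof.
have [s s0 H] := slope_ge0.
pose A : set R := [set y | u <= y /\ expo y <= p y].
have Au : A u by split; rewrite ?expo_u.
have Aub : ubound A (u + 2 * s).
  move=> y [uy Ey]; rewrite leNgt; apply/negP => yb.
  have y0 : 0 <= y by rewrite (le_trans (ltW u0)).
  have := le_trans Ey (H y y0); rewrite ler_pMr ?expo_gt0// leNgt expR_lt1.
  by move=> /negP; apply; nra.
have supA : has_sup A by split; [exists u|exists (u + 2 * s)].
exists (sup A); first by apply: ub_le_sup => //; exists (u + 2 * s).
split=> x.
  move=> /andP[ux xs].
  have [y [uy Ey]] := sup_adherent (etrans (subr_gt0 x _) xs) supA.
  rewrite subKr => xy.
  by apply: (expo_le_p ux (ltW xy)).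
move=> sx; rewrite ltNge; apply/negP => Ex.
have : x <= sup A.
  apply: ub_le_sup; first by exists (u + 2 * s).
  split => //; apply: le_trans (ltW sx); apply: ub_le_sup => //.
  by exists (u + 2 * s).
by rewrite leNgt sx.
Qed.

Section Compare.
Variable w : R -> R.
Hypothesis mw : measurable_fun setT w.
Hypothesis w_ge0 : forall x, 0 <= x -> 0 <= w x.
Hypothesis w_homo : forall x y, 0 <= x -> x <= y -> w x <= w y.

Let Iw := (\int[mu]_(x in half) (w x * p x)%:E)%E.
Let Jw := (\int[mu]_(x in half) (w x * expo x)%:E)%E.
Hypothesis Jfin : (Jw < +oo)%E.

(** Before [u] we have [p <= expo]. On [u, +oo[ the difference [expo - p] has
    integral 0 and changes sign only at the crossing point [z], from negative to
    positive, so that [(w - w z) (expo - p)] is nonnegative. The comparison of [a]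
    with [b] expresses this with nonnegative integrands only. *)
Lemma tail_compare : (Iw <= Jw)%E /\
  ((forall x y, u <= x -> x < y -> w x < w y) -> (Iw < Jw)%E).
Proof.
have [z uz [zlo zhi]] := crossing.
have z0 : 0 <= z by rewrite (le_trans (ltW u0)).
pose ind (f : R -> R) x := if u <= x then f x else 0.
have mind (f : R -> R) : measurable_fun setT f -> measurable_fun setT (ind f).
  move=> mf; apply: measurable_fun_ifT => //.
  by apply: measurable_fun_ler.
pose a x := w x * p x + w z * ind expo x.
pose b x := w x * expo x + w z * ind p x.
have ab x : 0 <= x -> a x <= b x.
  move=> x0; rewrite /a /b /ind; have [ux|xu] := leP u x; last first.
    by rewrite !mulr0 !addr0 ler_wpM2l ?w_ge0// p_le_expo// x0 ltW.
  have [xz|zx|->] := ltgtP x z.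
  - by have := zlo x; rewrite ux xz => /(_ isT); have := w_homo x0 (ltW xz); nra.
  - by have := zhi x zx; have := w_homo z0 (ltW zx); nra.
  - by lra.
have a0 x : 0 <= x -> 0 <= a x.
  move=> x0; rewrite /a /ind; apply: addr_ge0; first by rewrite mulr_ge0 ?w_ge0 ?p_ge0.
  by case: ifP => _; rewrite mulr_ge0 ?w_ge0// ltW// expo_gt0.
have ma : measurable_fun setT a.
  by apply: measurable_funD; apply: measurable_funM => //; apply: mind; exact: measurable_expo.
have mb : measurable_fun setT b.
  apply: measurable_funD; apply: measurable_funM => //; last exact: mind.
  exact: measurable_expo.
have tailint (f g : R -> R) : measurable_fun setT f -> measurable_fun setT g ->
    (forall x, 0 <= x -> 0 <= f x) -> (forall x, 0 <= x -> 0 <= g x) ->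
    (\int[mu]_(x in `[u, +oo[) (g x)%:E = q%:E)%E ->
    (\int[mu]_(x in half) (w x * f x + w z * ind g x)%:E =
     \int[mu]_(x in half) (w x * f x)%:E + (w z * q)%:E)%E.
  move=> mf mg f0 g0 gq.
  have g1 x : half x -> (0 <= (ind g x)%:E)%E.
    by rewrite /= in_itv/= andbT => x0; rewrite /ind lee_fin; case: ifP => // _; exact: g0.
  have mig : measurable_fun half (EFin \o ind g).
    by apply/measurable_EFinP; apply: measurable_funTS; exact: mind.
  have -> : ((w z * q)%:E = \int[mu]_(x in half) ((w z)%:E * (ind g x)%:E))%E.
    rewrite ge0_integralZl//; last by rewrite lee_fin w_ge0.
    rewrite EFinM -gq -(@integral_from u)//; last exact: ltW.
    by congr (_ * _)%E; apply: eq_integral => x _; rewrite /ind; case: ifP.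
  rewrite -ge0_integralD//.
  - move=> x /=; rewrite in_itv/= andbT => x0.
    by rewrite lee_fin mulr_ge0 ?w_ge0 ?f0.
  - by apply/measurable_EFinP; apply: measurable_funTS; exact: measurable_funM.
  - by move=> x /g1 ?; rewrite mule_ge0// lee_fin w_ge0.
  - by apply: emeasurable_funM.
have E0 x : 0 <= x -> 0 <= expo x by move=> _; rewrite ltW// expo_gt0.
have Ia := tailint p expo mp measurable_expo p_ge0 E0 expo_tail.
have Jb := tailint expo p measurable_expo mp E0 p_ge0 qE.
have Jbfin : (\int[mu]_(x in half) (b x)%:E < +oo)%E.
  by rewrite /b Jb lte_add_pinfty// ltry.
have hx x : half x -> 0 <= x by rewrite /= in_itv/= andbT.
split.
  have : (\int[mu]_(x in half) (a x)%:E <= \int[mu]_(x in half) (b x)%:E)%E.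
    apply: ge0_le_integral => //.
    - by move=> x /hx x0; rewrite lee_fin a0.
    - by apply/measurable_EFinP; exact: measurable_funTS.
    - by apply/measurable_EFinP; exact: measurable_funTS.
    - by move=> x /hx x0; rewrite lee_fin ab.
  by rewrite /a /b Ia Jb leeD2rE.
move=> w_lt.
have : (\int[mu]_(x in half) (a x)%:E < \int[mu]_(x in half) (b x)%:E)%E.
  apply: (@integral_lt _ _ _ _ z (z + 1)) => //.
  - exact: measurable_funTS.
  - exact: measurable_funTS.
  - by move=> x /hx x0; rewrite a0// ab.
  - by rewrite ltrDl.
  - by move=> x /=; rewrite !in_itv/= andbT => /andP[/ltW /(le_trans z0)].
  - move=> x /andP[zx _]; rewrite /a /b /ind (le_trans uz (ltW zx)).
    have := zhi x zx; have := w_lt z x uz zx; nra.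
by rewrite /a /b Ia Jb lteD2rE.
Qed.

End Compare.

End Tail.

(** * The upper bound for the extremal ratio *)

Section TestFunctions.
Context {R : realType}.
Implicit Types (f : R -> R) (x y : R).

Lemma C2upconv_intro f (f1 f2 : R -> R) : (forall x, f (- x) = f x) ->
  (forall x, is_derive x 1 f (f1 x)) -> (forall x, is_derive x 1 f1 (f2 x)) ->
  cvx f2 -> 0 <= f 0 -> 0 <= f2 0 -> C2upconv f.
Proof.
move=> ef df df1 cf2 f0 f20.
have e1 : derive1 f = f1.
  by apply/funext => x; rewrite derive1E; have [] := df x.
have e2 : derive1n 2 f = f2.
  by apply/funext => x; rewrite /= e1 derive1E; have [] := df1 x.
split=> //; last by rewrite e2.
split=> //.
- by rewrite e1 => x; have [dfx _] := df1 x; exact: dfx.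
- by rewrite e2; exact: convex_function_of_cvx.
Qed.

Lemma C2upconv1 : C2upconv (fun=> 1 : R).
Proof.
apply: (@C2upconv_intro _ (fun=> 0) (fun=> 0)) => // t x y _.
by rewrite !mulr0 addr0.
Qed.

Lemma C2upconv_sqr : C2upconv (fun x : R => x ^+ 2).
Proof.
apply: (@C2upconv_intro _ (fun x => 2 * x) (fun=> 2)) => // [x|x|x|t x y _].
- by rewrite sqrrN.
- by apply: der_eq (derX 1 (der_id x)) _; rewrite mulr1.
- by apply: der_eq (derZ 2 (der_id x)) _; rewrite mulr1.
- by lra.
Qed.

Lemma cvx_hinge (t : R) : cvx (hinge t).
Proof.
move=> s x y /andP[s0 s1]; rewrite /hinge ge_max.
have h (z : R) : z - t <= Num.max (z - t) 0 by rewrite le_max lexx.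
have h0 (z : R) : 0 <= Num.max (z - t) 0 by rewrite le_max lexx orbT.
have := h x; have := h y; have := h0 x; have := h0 y.
by move=> *; apply/andP; split; nra.
Qed.

(** For [0 <= t] this is [(|x| - t)_+ ^ 3]. *)
Definition hinge_cube (t x : R) := hinge t x ^+ 3 + hinge t (- x) ^+ 3.

Lemma hinge_cube_ge0 (t x : R) : 0 <= t -> 0 <= x ->
  hinge_cube t x = hinge t x ^+ 3.
Proof.
move=> t0 x0; rewrite /hinge_cube [hinge t (- x)]hinge_is0 ?expr0n ?addr0//.
by rewrite (le_trans _ t0)// oppr_le0.
Qed.

Lemma C2upconv_hinge_cube (t : R) : 0 <= t -> C2upconv (hinge_cube t).
Proof.
move=> t0.
apply: (@C2upconv_intro _ (fun x => 3 * (hinge t x ^+ 2) - 3 * (hinge t (- x) ^+ 2))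
    (fun x => 6 * hinge t x + 6 * hinge t (- x))) => [x|x|x|s x y s01||].
- by rewrite /hinge_cube opprK addrC.
- exact: derD (der_hingeX 1 t x) (derN_arg (der_hingeX 1 t (- x))).
- apply: der_eq (derB (derZ 3 (der_hingeX 0 t x))
    (derZ 3 (derN_arg (der_hingeX 0 t (- x))))) _.
  by ring.
- have := cvx_hinge t x y s01; have := cvx_hinge t (- x) (- y) s01.
  by rewrite !mulrN -opprD; lra.
- by rewrite /hinge_cube oppr0 hinge_is0// expr0n addr0.
- by rewrite oppr0 hinge_is0// mulr0 addr0.
Qed.

End TestFunctions.

Section Numerics.
Context {R : realType}.

Lemma expR_ge_quad (x : R) : 0 <= x -> 1 + x + x ^+ 2 / 2 <= expR x.
Proof.
move=> x0; pose g y : R := expR y - (1 + y + y ^+ 2 * 2^-1).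
have dg (y : R) : is_derive y 1 g (expR y - (1 + y)).
  apply: der_eq (derB (is_derive_expR y) (derD (derD (der_cst 1 y) (der_id y))
    (derM (derX 1 (der_id y)) (der_cst 2^-1 y)))) _.
  by field.
have [c _ e] := mvt x0 (fun y _ => dg y).
have : 0 <= g x - g 0.
  by rewrite e mulr_ge0 ?subr_ge0// expR_ge1Dx.
rewrite /g expR0; lra.
Qed.

(** The claim is [e^(3 - v) > 9/2]. For [v <= 29/20] this follows from
    [e^(31/20) > 9/2], which the fourth power of a quadratic Taylor polynomial at
    [31/80] shows. *)
Lemma cube_constant_small (v : R) : v <= 29 / 20 -> expR v < 2 * expR 3 / 9.
Proof.
move=> v0; have : 9 / 2 < expR (31 / 20 : R).
  have -> : 31 / 20 = 4%:R * (31 / 80) :> R by field.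
  rewrite expRM_natl; have h : 0 <= 31 / 80 :> R by lra.
  have := expR_ge_quad h => h2.
  set y := expR _ in h2 *.
  have h3 : 19 / 13 <= y by lra.
  have h4 : 17 / 8 <= y * y by nra.
  have -> : y ^+ 4 = (y * y) * (y * y) by ring.
  nra.
have -> : expR 3 = expR v * expR (3 - v) :> R by rewrite -expRD subrKC.
have : expR (31 / 20) <= expR (3 - v) :> R by rewrite ler_expR; lra.
have := expR_gt0 v; nra.
Qed.

(** With [w = (3 - v) / 2] the claim reads [3 < v e^w]; the quadratic Taylor
    polynomial of [e^w] is sharp enough as [w < 31/40]. *)
Lemma cube_constant_middle (v : R) : 29 / 20 < v < 3 ->
  2 * expR v / v ^+ 2 < 2 * expR 3 / 9.
Proof.
move=> /andP[v1 v3]; pose w := (3 - v) / 2.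
have w0 : 0 < w by rewrite /w; lra.
have w1 : w < 31 / 40 by rewrite /w; lra.
have vE : v = 3 - 2 * w by rewrite /w; field.
have h : 3 < v * expR w.
  have := expR_ge_quad (ltW w0).
  have v0 : 0 < v by lra.
  move=> /(ler_wpM2l (ltW v0)); apply: lt_le_trans; rewrite vE.
  have -> : (3 - 2 * w) * (1 + w + w ^+ 2 / 2) = 3 + w * (1 - w / 2 - w ^+ 2) by field.
  rewrite ltrDl mulr_gt0//; nra.
have -> : expR 3 = expR v * expR w ^+ 2 :> R.
  by rewrite -expRM_natl -expRD; congr expR; rewrite vE; ring.
rewrite ltr_pdivrMr ?exprn_gt0 ?mulr_gt0//; last by lra.
have : 9 < (v * expR w) ^+ 2 by nra.
rewrite exprMn; have := expR_gt0 v; nra.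
Qed.

End Numerics.

Section QBound.
Context {R : realType}.
Notation mu := (@lebesgue_measure R).
Notation half := (`[0%R, +oo[%classic : set R).

(** Use [log z <= log x + z / x - 1] for the power; the Gaussian factor supplies
    the quadratic term exactly. *)
Lemma chi_tangent (c : R) k : 0 < c -> forall x, 0 < x -> exists s, forall z, 0 <= z ->
  c * z ^+ k * phi z <= c * x ^+ k * phi x * expR (s * (z - x) - (z - x) ^+ 2 / 2).
Proof.
move=> c0 x x0; exists (k%:R / x - x) => z z0.
have xn0 : x != 0 by rewrite gt_eqF.
have zk : z ^+ k <= x ^+ k * expR (k%:R * (z / x - 1)).
  rewrite expRM_natl -exprMn; apply: lerXn2r; rewrite ?nnegrE ?mulr_ge0 ?expR_ge0 ?(ltW x0)//.
  have := expR_ge1Dx (z / x - 1); rewrite subrKC => h.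
  by rewrite mulrC -ler_pdivrMr.
have -> : phi z = phi x * expR (- x * (z - x) - (z - x) ^+ 2 / 2).
  by rewrite /phi -expRD; congr expR; field.
have -> : expR ((k%:R / x - x) * (z - x) - (z - x) ^+ 2 / 2) =
   expR (k%:R * (z / x - 1)) * expR (- x * (z - x) - (z - x) ^+ 2 / 2).
  by rewrite -expRD; congr expR; field.
set e1 := expR _ in zk *; set e2 := expR _.
have e20 : 0 < phi x * e2 by rewrite mulr_gt0 ?phi_gt0 ?expR_gt0.
have -> : c * z ^+ k * (phi x * e2) = (c * (phi x * e2)) * z ^+ k by ring.
have -> : c * x ^+ k * phi x * (e1 * e2) = (c * (phi x * e2)) * (x ^+ k * e1) by ring.
by rewrite ler_wpM2l// mulr_ge0 ?ltW.
Qed.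

Lemma Q_le k (u : R) f : C2upconv f -> 0 < f u ->
  (Q k u <= (\int[chi_square k]_y (f (Num.sqrt y))%:E) * ((f u)^-1)%:E)%E.
Proof.
by move=> uf fu; apply: ereal_inf_lbound; exists f => //; rewrite unlock.
Qed.

(** Bounding [E f(chi)] by the integral of [f] against [expo], three test
    functions suffice. The constant 1 gives [e^v q], the square gives
    [2 e^v / v^2 q], and [(|x| - t)_+ ^ 3] gives [6 e^y / y^3 q] with
    [y = l (u - t)]. The last bound is least at [y = 3], where it is
    [2 e^3 / 9 q]; this needs [t >= 0], that is [3 <= v]. In that case strictness
    comes from the comparison of the integrals, otherwise from the numerical
    inequality. *)
Lemma Q_lt k (u : R) : 0 <= u ->
  (Q k.+1 u < (2 * expR 3 / 9)%:E * chi_square k.+1 [set y : R | (u <= Num.sqrt y)%R])%E.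
Proof.
move=> u_ge0.
have Q1 : (Q k.+1 u <= 1)%E.
  apply: le_trans (Q_le k.+1 C2upconv1 ltr01) _.
  by rewrite integral_cst//= probability_setT invr1 !mule1.
have C1 : 1 < 2 * expR 3 / 9 :> R.
  by rewrite -[ltLHS]expR0; apply: cube_constant_small; lra.
have [u_0|un0] := eqVneq u 0.
  have -> : [set y : R | u <= Num.sqrt y] = setT.
    by apply/seteqP; split=> // y _ /=; rewrite u_0 sqrtr_ge0.
  by rewrite probability_setT mule1; apply: (le_lt_trans Q1); rewrite lte_fin.
have u0 : 0 < u by rewrite lt_def un0.
have [c c0 H] := chi_density (R := R) k.
pose p (x : R) := c * x ^+ k * phi x.
have mp : measurable_fun setT p.
  apply: measurable_funM; last exact: measurable_phi.
  by apply: measurable_funM => //; exact: measurable_funX.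
have p_ge0 x : 0 <= x -> 0 <= p x.
  by move=> x0; rewrite !mulr_ge0 ?exprn_ge0 ?(ltW c0)// ltW// phi_gt0.
have p_gt0 x : 0 < x -> 0 < p x.
  by move=> x0; rewrite !mulr_gt0 ?exprn_gt0// phi_gt0.
have chiE (w : R -> R) : measurable_fun setT w -> (forall x, 0 <= w x) ->
    (\int[chi_square k.+1]_y (w (Num.sqrt y))%:E =
     \int[mu]_(x in half) (w x * p x)%:E)%E.
  by move=> mw w0; rewrite (H (EFin \o w))//; exact/measurable_EFinP.
have p_mass : (\int[mu]_(x in half) (p x)%:E = 1)%E.
  transitivity (\int[@chi_square R k.+1]_y ((cst 1 : R -> R) (Num.sqrt y))%:E)%E.
    rewrite (chiE (cst 1))//.
    by apply: eq_integral => x _; rewrite mul1r.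
  apply: (etrans (integral_cst (@chi_square R k.+1) measurableT 1%E)).
  by rewrite mul1e; exact: (@probability_setT _ _ _ (chi_square k.+1)).
have tan := chi_tangent k c0.
have [q q0 qE] := tail_real mp p_ge0 p_gt0 p_mass u0.
have -> : chi_square k.+1 [set y : R | (u <= Num.sqrt y)%R] = q%:E.
  pose A := [set y : R | (u <= Num.sqrt y)%R].
  have mA : measurable A.
    have -> : A = Num.sqrt @^-1` `[u, +oo[%classic.
      by apply/seteqP; split=> y /=; rewrite in_itv/= andbT.
    rewrite -[X in measurable X]setTI.
    exact: (continuous_measurable_fun (@sqrt_continuous R)).
  pose w : R -> R := \1_(`[u, +oo[%classic).
  have mw : measurable_fun setT w by exact: measurable_indic.
  have w0 x : 0 <= w x by rewrite /w indicE.
  have := chiE w mw w0.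
  have -> : (\int[chi_square k.+1]_y (w (Num.sqrt y))%:E = chi_square k.+1 A)%E.
    rewrite -[in RHS](setIT A) -integral_indic//; apply: eq_integral => y _.
    congr EFin; rewrite /w !indicE; congr (_%:R); congr nat_of_bool.
    by apply/idP/idP => /set_mem /= h; apply/mem_set => /=; move: h; rewrite /A /= in_itv/= andbT.
  move=> ->; rewrite -qE -(@integral_from R u) ?(ltW u0)//.
  apply: eq_integral => x _; rewrite /w indicE.
  have [ux|xu] := leP u x; first by rewrite mem_set ?mul1r//= in_itv/= ux.
  by rewrite memNset ?mul0r//= in_itv/= andbT leNgt xu.
pose l := p u / q.
have pu : 0 < p u by exact: p_gt0.
have l0 : 0 < l by rewrite divr_gt0.
pose E' := expo p u q.
have compare := tail_compare mp p_ge0 p_gt0 tan u0 q0 qE.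
have moment t n : (\int[mu]_(x in `[t, +oo[) ((x - t) ^+ n * E' x)%:E =
   (E' t * (n`!%:R / l ^+ n.+1))%:E)%E := expo_moment p_gt0 u0 q0 t n.
have E'E t : E' t = l * q * expR (l * (u - t)).
  rewrite /E' /expo -/l /l divfK ?gt_eqF//; congr (_ * expR _); ring.
pose v := l * u.
have v0 : 0 < v by rewrite mulr_gt0.
have E'0 : E' 0 = l * q * expR v by rewrite E'E subr0.
have moment0 n : (\int[mu]_(x in half) (x ^+ n * E' x)%:E =
    (q * expR v * (n`!%:R / l ^+ n))%:E)%E.
  have := moment 0 n; rewrite E'0 => e.
  rewrite (_ : q * expR v * (n`!%:R / l ^+ n) =
    l * q * expR v * (n`!%:R / l ^+ n.+1)); last first.
    have ln0 : l != 0 by rewrite gt_eqF.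
    have lnn0 : l ^+ n != 0 by rewrite expf_neq0.
    by rewrite (exprS l); field; rewrite ?ln0 ?lnn0.
  by rewrite -e; apply: eq_integral => x _; rewrite subr0.
have Xhomo n (x y : R) : 0 <= x -> x <= y -> x ^+ n <= y ^+ n.
  by move=> x0 xy; apply: lerXn2r; rewrite ?nnegrE// (le_trans x0).
have [v1|v1] := leP v (29 / 20).
  apply: le_lt_trans Q1 _; rewrite -EFinM lte_fin.
  have mX0 : measurable_fun setT (fun x : R => x ^+ 0) by exact: measurable_funX.
  have [] := compare _ mX0 (fun x x0 => exprn_ge0 0 x0) (Xhomo 0%N).
    by rewrite -/E' moment0 ltry.
  rewrite -/E' moment0 expr0 fact0 divr1 mulr1.
  under eq_integral do rewrite mul1r.
  rewrite p_mass lee_fin => h _; apply: le_lt_trans h _.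
  by rewrite mulrC ltr_pM2r// cube_constant_small.
have [v3|v3] := ltP v 3.
  have mX2 : measurable_fun setT (fun x : R => x ^+ 2) by exact: measurable_funX.
  have [] := compare _ mX2 (fun x x0 => exprn_ge0 2 x0) (Xhomo 2%N).
    by rewrite -/E' moment0 ltry.
  rewrite -/E' moment0 -chiE//; last by move=> x; exact: sqr_ge0.
  move=> h _; have u2 : 0 < u ^+ 2 by rewrite exprn_gt0.
  apply: le_lt_trans (Q_le k.+1 C2upconv_sqr u2) _.
  apply: (@le_lt_trans _ _ ((q * expR v * (2`!%:R / l ^+ 2))%:E * ((u ^+ 2)^-1)%:E)%E).
    by rewrite lee_wpmul2r// lee_fin invr_ge0 ltW.
  rewrite -!EFinM lte_fin.
  have -> : q * expR v * (2`!%:R / l ^+ 2) * (u ^+ 2)^-1 = 2 * expR v / v ^+ 2 * q.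
    have -> : 2`!%N = 2%N by [].
    by rewrite /v; field; rewrite !gt_eqF.
  by rewrite ltr_pM2r// cube_constant_middle// v1.
pose t := u - 3 / l.
have t0 : 0 <= t by rewrite subr_ge0 ler_pdivrMr// mulrC.
have tu : t < u by rewrite ltrBlDr ltrDl divr_gt0.
have uf := C2upconv_hinge_cube t0.
have mh : measurable_fun setT (fun x : R => hinge t x ^+ 3).
  have mht : measurable_fun setT (hinge t) := continuous_measurable_fun (@continuous_hinge R t).
  exact: (measurable_funX 3 mht).
have hinge0 (x : R) : 0 <= hinge t x by rewrite le_max lexx orbT.
have hhomo (x y : R) : 0 <= x -> x <= y -> hinge t x ^+ 3 <= hinge t y ^+ 3.
  move=> _ xy; apply: lerXn2r; rewrite ?nnegrE//.
  by rewrite /hinge ge_max !le_max lexx orbT lerD2r xy.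
have J : (\int[mu]_(x in half) (hinge t x ^+ 3 * E' x)%:E =
    (q * expR 3 * (6 / l ^+ 3))%:E)%E.
  have := moment t 3; rewrite E'E => e.
  have -> : q * expR 3 * (6 / l ^+ 3) =
      l * q * expR (l * (u - t)) * (3`!%:R / l ^+ 4).
    have -> : l * (u - t) = 3 by rewrite /t; field; rewrite gt_eqF.
    have -> : 3`!%N = 6%N by [].
    by field; rewrite gt_eqF.
  rewrite -e -(@integral_from R t)//; apply: eq_integral => x _.
  have [tx|xt] := leP t x; first by rewrite hinge_isB.
  by rewrite hinge_is0 ?(ltW xt)// expr0n mul0r.
have [_ lt] := compare _ mh (fun x _ => exprn_ge0 3 (hinge0 x)) hhomo
  (eq_ind_r (fun z => (z < +oo)%E) (ltry _) J).
have fu : hinge_cube t u = (3 / l) ^+ 3.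
  by rewrite hinge_cube_ge0 ?(ltW u0)// hinge_isB ?(ltW tu)// /t subKr.
have fu0 : 0 < hinge_cube t u by rewrite fu exprn_gt0// divr_gt0.
apply: le_lt_trans (Q_le k.+1 uf fu0) _.
have -> : (\int[chi_square k.+1]_y (hinge_cube t (Num.sqrt y))%:E =
    \int[mu]_(x in half) (hinge t x ^+ 3 * p x)%:E)%E.
  rewrite -chiE//; last by move=> x; exact: exprn_ge0.
  by apply: eq_integral => y _; rewrite hinge_cube_ge0// sqrtr_ge0.
have -> : ((2 * expR 3 / 9)%:E * q%:E =
    (q * expR 3 * (6 / l ^+ 3))%:E * ((hinge_cube t u)^-1)%:E :> \bar R)%E.
  rewrite -!EFinM; congr EFin; rewrite fu; field.
  by rewrite gt_eqF.
rewrite lte_pmul2r// ?lte_fin ?invr_gt0//.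
rewrite -J; apply: lt => x y ux xy.
rewrite !hinge_isB ?(ltW (lt_le_trans tu _))//; last by rewrite (le_trans ux)// ltW.
by rewrite ltrXn2r// ?nnegrE ?subr_ge0 ?(ltW (lt_le_trans tu _))//; lra.
Qed.

End QBound.

(** * The statistic in an orthonormal basis of the column space *)

Section Decomposition.
Context {R : rcfType}.

Lemma mulmx_tr_eq0 m n (A : 'M[R]_(m, n)) : A *m A^T = 0 -> A = 0.
Proof.
move=> A0; apply/matrixP => i j; rewrite mxE; apply/eqP; rewrite -sqrf_eq0.
have /eqP : (A *m A^T) i i = 0 by rewrite A0 mxE.
rewrite mxE psumr_eq0; last by move=> k _; rewrite mxE -expr2 sqr_ge0.
by move=> /allP /(_ j (mem_index_enum _)); rewrite mxE /= -expr2.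
Qed.

(** Gram-Schmidt on the columns, a column being appended to [U] only if it is
    independent of the previous ones; the right inverse [D] records that [C] has
    full row rank. *)
Lemma orthonormal_decomposition n d (M : 'M[R]_(n, d)) :
  exists r (U : 'M[R]_(n, r)) (C : 'M[R]_(r, d)) (D : 'M[R]_(d, r)),
  [/\ (r <= d)%N, U^T *m U = 1%:M, C *m D = 1%:M & M = U *m C].
Proof.
elim: d M => [|d IH] M.
  exists 0%N, 0, 0, 0; split => //; first by apply/matrixP => -[].
    by apply/matrixP => -[].
  by apply/matrixP => i [].
pose m := lsubmx (M : 'M[R]_(n, 1 + d)); pose M' := rsubmx (M : 'M[R]_(n, 1 + d)).
have -> : M = row_mx m M' by rewrite hsubmxK.
have [r [U [C [D [rd UU CD M'E]]]]] := IH M'; rewrite M'E.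
pose a := U^T *m m; pose v := m - U *m a.
have Uv : U^T *m v = 0 by rewrite mulmxBr mulmxA UU mul1mx subrr.
have mE : m = v + U *m a by rewrite subrK.
have [v0|vn0] := eqVneq v 0.
  exists r, U, (row_mx a C : 'M[R]_(r, 1 + d)), (col_mx (0 : 'rV[R]_r) D : 'M[R]_(1 + d, r)); split => //; first exact: leqW.
    by apply: (etrans (mul_row_col a C 0 D)); rewrite mulmx0 add0r.
  by rewrite [RHS](@mul_mx_row _ n r 1 d U a C) {1}mE v0 add0r.
pose s := (v^T *m v) 0 0.
have sE : v^T *m v = s%:M by rewrite [LHS]mx11_scalar.
have s0 : 0 < s.
  rewrite lt_def; apply/andP; split.
    apply: contra_neq vn0 => s_0; apply: trmx_inj; rewrite trmx0.
    by apply: mulmx_tr_eq0; rewrite trmxK sE s_0 raddf0.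
  by rewrite /s mxE sumr_ge0// => i _; rewrite mxE -expr2 sqr_ge0.
pose nu := Num.sqrt s.
have nu0 : nu != 0 by rewrite gt_eqF// sqrtr_gt0.
have nunu : nu * nu = s by rewrite -expr2 sqr_sqrtr// ltW.
exists r.+1, (row_mx (nu^-1 *: v) U : 'M[R]_(n, 1 + r)),
  (block_mx nu%:M 0 a C : 'M[R]_(1 + r, 1 + d)),
  (block_mx (nu^-1)%:M 0 (- (nu^-1 *: (D *m a))) D : 'M[R]_(1 + d, 1 + r)).
split => //.
- rewrite [LHS](_ : _ = col_mx (nu^-1 *: v)^T U^T *m row_mx (nu^-1 *: v) U); last first.
    by rewrite -tr_row_mx.
  rewrite mul_col_row UU.
  apply: (etrans _ (esym (scalar_mx_block 1 r (1 : R)))); congr block_mx.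
  + by rewrite [(_ *: v)^T]linearZ -scalemxAl -scalemxAr sE scalerA scale_scalar_mx -invfM nunu mulVf// gt_eqF.
  + by rewrite [(_ *: v)^T]linearZ -scalemxAl -[v^T *m U]trmxK trmx_mul trmxK Uv trmx0 scaler0.
  + by rewrite -scalemxAr Uv scaler0.
- rewrite [LHS](@mulmx_block _ 1 r 1 d 1 r) !mulmx0 !mul0mx !addr0 add0r CD.
  apply: (etrans _ (esym (scalar_mx_block 1 r (1 : R)))).
  rewrite -scalar_mxM mulfV// mulmxN -scalemxAr mulmxA CD mul1mx.
  by rewrite mul_mx_scalar subrr.
- rewrite [RHS](@mul_row_block _ n 1 r 1 d) mulmx0 add0r.
  apply: (congr2 (@row_mx R n 1 d)) => //.
  by rewrite mul_mx_scalar scalerA mulfV// scale1r.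
Qed.

Lemma gram_unit r d (C : 'M[R]_(r, d)) (D : 'M[R]_(d, r)) :
  C *m D = 1%:M -> C *m C^T \in unitmx.
Proof.
move=> CD; rewrite -row_free_unit; apply/inj_row_free => x xCC.
suff xC : x *m C = 0 by rewrite -[x]mulmx1 -CD mulmxA xC mul0mx.
by apply: mulmx_tr_eq0; rewrite trmx_mul mulmxA -[_ *m C *m C^T]mulmxA xCC mul0mx.
Qed.

(** The matrix is positive definite. *)
Lemma ridge_unit r d (A : 'M[R]_(r, d)) (t e : R) : 0 <= t -> 0 < e ->
  t *: (A^T *m A) + e%:M \in unitmx.
Proof.
move=> t0 e0; rewrite -row_free_unit; apply/inj_row_free => x.
move=> /(congr1 (fun y => (y *m x^T) 0 0)).
rewrite mul0mx mulmxDr mulmxDl -scalemxAr -scalemxAl mul_mx_scalar -scalemxAl.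
rewrite [RHS]mxE mxE [X in X + _ = _]mxE [X in _ + X = _]mxE => h.
have sq m (y : 'rV[R]_m) : 0 <= (y *m y^T) 0 0.
  by rewrite mxE sumr_ge0// => i _; rewrite mxE -expr2 sqr_ge0.
have h1 : 0 <= (x *m (A^T *m A) *m x^T) 0 0.
  by rewrite mulmxA -mulmxA -[A *m x^T]trmxK trmx_mul trmxK sq.
apply: mulmx_tr_eq0; rewrite [LHS]mx11_scalar.
have := sq _ x; set xx := (x *m x^T) 0 0 in h *.
move=> xx0; have -> : xx = 0 by nra.
by rewrite raddf0.
Qed.

End Decomposition.

Section Limit.
Context {R : realType}.

(** Each entry is a rational function of [e] whose denominator [\det (A + e%:M)]
    does not vanish at 0. *)
Lemma cvg_resolvent r m n (A : 'M[R]_r) (X : 'M[R]_(m, r)) (Y : 'M[R]_(r, n)) i j :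
  A \in unitmx ->
  (X *m invmx (A + e%:M) *m Y) i j @[e --> (0 : R)^'+] --> (X *m invmx A *m Y) i j.
Proof.
move=> uA.
pose P : 'M[{poly R}]_r := map_mx polyC A + 'X%:M.
have PE e : map_mx (horner_eval e) P = A + e%:M.
  apply/matrixP => a b; rewrite !mxE.
  by rewrite [LHS]/horner_eval hornerD hornerMn hornerC hornerX.
pose den := \det P.
pose num := (map_mx polyC X *m \adj P *m map_mx polyC Y) i j.
have denE e : \det (A + e%:M) = den.[e] by rewrite -PE det_map_mx.
have numE e : (X *m \adj (A + e%:M) *m Y) i j = num.[e].
  have -> : num.[e] = map_mx (horner_eval e) (map_mx polyC X *m \adj P *m map_mx polyC Y) i j.
    by rewrite mxE.
  rewrite !map_mxM map_mx_adj PE -!map_mx_comp.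
  by congr ((_ *m _ *m _) _ _); apply/matrixP => a b; rewrite !mxE /= /horner_eval hornerC.
have resE e : den.[e] != 0 -> (X *m invmx (A + e%:M) *m Y) i j = num.[e] / den.[e].
  move=> d0; have u : A + e%:M \in unitmx by rewrite unitmxE denE unitfE.
  by rewrite /invmx u -scalemxAr -scalemxAl mxE denE numE mulrC.
have A0 : A + 0%:M = A by rewrite raddf0 addr0.
have den0 : den.[0] != 0 by rewrite -denE A0 -unitfE -unitmxE.
have -> : (X *m invmx A *m Y) i j = num.[0] / den.[0] by rewrite -resE// A0.
have cden : den.[e] @[e --> (0 : R)] --> den.[0] by exact: continuous_horner.
have lim0 : num.[e] / den.[e] @[e --> (0 : R)] --> num.[0] / den.[0].
  by apply: cvgM; [exact: continuous_horner|exact: cvgV].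
apply: cvg_at_right_filter.
apply: cvg_trans lim0; apply: near_eq_cvg; near=> e.
rewrite resE//; near: e.
exact: cvgr_neq0 cden den0.
Unshelve. all: by end_near. Qed.

End Limit.

Section Statistic.
Context {R : realType} {n d : nat}.
Hypothesis n0 : (0 < n)%N.
Implicit Types x : 'I_n -> 'rV[R]_d.

Definition resolvent_form x (e : R) : R :=
  (sample_mean x *m invmx (sample_S x + e%:M) *m (sample_mean x)^T) 0 0.

Let nu : 'rV[R]_n := const_mx 1.

Lemma sum_rows x : \sum_(i < n) x i = nu *m \matrix_i x i.
Proof.
apply/rowP => j; rewrite summxE mxE; apply: eq_bigr => i _.
by rewrite !mxE mul1r.
Qed.

Lemma sum_outer x : \sum_(i < n) (x i)^T *m x i = (\matrix_i x i)^T *m \matrix_i x i.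
Proof.
apply/matrixP => a b; rewrite summxE mxE; apply: eq_bigr => i _.
by rewrite !mxE big_ord1 !mxE.
Qed.

(** The identity [(t C C^T + e) C = C (t C^T C + e)] replaces the d x d resolvent,
    whose limit may be singular, by an r x r one whose limit is invertible. *)
Lemma resolvent_cvg x r (U : 'M[R]_(n, r)) (C : 'M[R]_(r, d)) (D : 'M[R]_(d, r)) :
  U^T *m U = 1%:M -> C *m D = 1%:M -> \matrix_i x i = U *m C ->
  resolvent_form x e @[e --> 0^'+] -->
    n%:R^-1 * \sum_(j < r) (\sum_(i < n) U i j) ^+ 2.
Proof.
move=> UU CD ME; pose t : R := n%:R^-1.
have t0 : 0 < t by rewrite invr_gt0 ltr0n.
have tn0 : t != 0 by rewrite gt_eqF.
pose N := C *m C^T.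
have uN : t *: N \in unitmx.
  by rewrite unitmxZ ?unitfE// (gram_unit CD).
have formE e : 0 < e -> resolvent_form x e =
    t ^+ 2 * ((nu *m U) *m invmx (t *: N + e%:M) *m (N *m (nu *m U)^T)) 0 0.
  move=> e0; rewrite /resolvent_form /sample_mean /sample_S sum_rows sum_outer ME -/t.
  have -> : (U *m C)^T *m (U *m C) = C^T *m C.
    by rewrite trmx_mul -mulmxA [U^T *m _]mulmxA UU mul1mx.
  have uB := ridge_unit C (ltW t0) e0.
  have uB' : t *: N + e%:M \in unitmx.
    by have := ridge_unit C^T (ltW t0) e0; rewrite trmxK.
  set B := t *: (C^T *m C) + e%:M in uB *; set B' := t *: N + e%:M in uB' *.
  have BC : B' *m C = C *m B.
    by rewrite mulmxDl mulmxDr scalar_mxC -scalemxAl -scalemxAr mulmxA.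
  have CB : C *m invmx B = invmx B' *m C.
    by rewrite -[LHS](mulKmx uB') [B' *m _]mulmxA BC -mulmxA mulmxV// mulmx1.
  rewrite mulmxA; set w := nu *m U.
  have -> : (t *: (w *m C)) *m invmx B *m (t *: (w *m C))^T =
      t ^+ 2 *: (w *m invmx B' *m (N *m w^T)).
    have -> : (t *: (w *m C))^T = t *: (C^T *m w^T).
      by rewrite [LHS]linearZ /= [in LHS]trmx_mul.
    rewrite -!scalemxAl -scalemxAr scalerA -expr2; congr (_ *: _).
    by rewrite -[w *m C *m invmx B]mulmxA CB /N !mulmxA.
  by rewrite mxE.
have -> : n%:R^-1 * \sum_(j < r) (\sum_(i < n) U i j) ^+ 2 =
    t ^+ 2 * ((nu *m U) *m invmx (t *: N) *m (N *m (nu *m U)^T)) 0 0.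
  have -> : nu *m U *m invmx (t *: N) *m (N *m (nu *m U)^T) =
      t^-1 *: (nu *m U *m (nu *m U)^T).
    rewrite -mulmxA [invmx _ *m _]mulmxA.
    have -> : invmx (t *: N) *m N = t^-1%:M.
      have : invmx (t *: N) *m (t *: N) = 1%:M by rewrite mulVmx.
      rewrite -scalemxAr => /(congr1 (fun A => t^-1 *: A)).
      by rewrite scalerA mulVf// scale1r => ->; rewrite scale_scalar_mx mulr1.
    by rewrite mul_scalar_mx -scalemxAr.
  rewrite mxE mulrA (_ : t ^+ 2 * t^-1 = t) -/t; last by field.
  congr (_ * _).
  rewrite mxE; apply: eq_bigr => j _; rewrite !mxE -expr2; congr (_ ^+ 2).
  by apply: eq_bigr => i _; rewrite mxE mul1r.
have lim : t ^+ 2 * ((nu *m U) *m invmx (t *: N + e%:M) *m (N *m (nu *m U)^T)) 0 0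
    @[e --> 0^'+] --> t ^+ 2 * ((nu *m U) *m invmx (t *: N) *m (N *m (nu *m U)^T)) 0 0.
  by apply: cvgM; [exact: cvg_cst|exact: cvg_resolvent].
apply: cvg_trans lim; apply: near_eq_cvg; near=> e.
by rewrite formE.
Unshelve. all: by end_near. Qed.

Lemma Rsquared_cvg x : resolvent_form x e @[e --> 0^'+] --> Rsquared x.
Proof.
have [r [U [C [D [_ UU CD ME]]]]] := orthonormal_decomposition (\matrix_i x i).
have h := resolvent_cvg UU CD ME.
by rewrite /Rsquared (cvg_lim _ h).
Qed.

Lemma RsquaredE x r (U : 'M[R]_(n, r)) (C : 'M[R]_(r, d)) (D : 'M[R]_(d, r)) :
  U^T *m U = 1%:M -> C *m D = 1%:M -> \matrix_i x i = U *m C ->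
  Rsquared x = n%:R^-1 * \sum_(j < r) (\sum_(i < n) U i j) ^+ 2.
Proof. by move=> UU CD ME; exact: (cvg_lim _ (resolvent_cvg UU CD ME)). Qed.

(** Changing the signs of the rows keeps an orthonormal basis of the column
    space orthonormal. *)
Lemma Rstat_signs x r (U : 'M[R]_(n, r)) (C : 'M[R]_(r, d)) (D : 'M[R]_(d, r))
    (s : 'I_n -> R) : (forall i, s i ^+ 2 = 1) ->
  U^T *m U = 1%:M -> C *m D = 1%:M -> \matrix_i x i = U *m C ->
  Num.sqrt n%:R * Rstat (fun i => s i *: x i) =
  Num.sqrt (\sum_(j < r) (\sum_(i < n) s i * U i j) ^+ 2).
Proof.
move=> s1 UU CD ME; pose U' : 'M[R]_(n, r) := \matrix_(i, j) (s i * U i j).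
have UU' : U'^T *m U' = 1%:M.
  rewrite -UU; apply/matrixP => a b; rewrite !mxE; apply: eq_bigr => i _.
  by rewrite !mxE mulrACA -expr2 s1 mul1r.
have ME' : \matrix_i (s i *: x i) = U' *m C.
  apply/matrixP => i j; rewrite !mxE.
  have := congr1 (fun A : 'M[R]_(n, d) => A i j) ME; rewrite !mxE => ->.
  by rewrite mulr_sumr; apply: eq_bigr => k _; rewrite !mxE mulrA.
rewrite /Rstat (RsquaredE UU' CD ME').
have nn : 0 < n%:R :> R by rewrite ltr0n.
rewrite -sqrtrM; last exact: ltW.
rewrite mulrA mulfV ?gt_eqF// mul1r; congr Num.sqrt.
by apply: eq_bigr => j _; congr (_ ^+ 2); apply: eq_bigr => i _; rewrite mxE.
Qed.

End Statistic.

Section MeasurableStatistic.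
Context {R : realType} {disp : measure_display} {T : measurableType disp}.

Definition measurable_mx m n (A : T -> 'M[R]_(m, n)) :=
  forall i j, measurable_fun setT (fun t => A t i j).

Lemma measurable_mulmx m n p (A : T -> 'M[R]_(m, n)) (B : T -> 'M[R]_(n, p)) :
  measurable_mx A -> measurable_mx B -> measurable_mx (fun t => A t *m B t).
Proof.
move=> mA mB i j; under eq_fun do rewrite mxE.
by apply: measurable_sum => k; exact: measurable_funM.
Qed.

Lemma measurable_det n (A : T -> 'M[R]_n) : measurable_mx A ->
  measurable_fun setT (fun t => \det (A t)).
Proof.
move=> mA; rewrite /determinant; apply: measurable_sum => s.
by apply: measurable_funM => //; apply: measurable_prod => i _; exact: mA.
Qed.

Lemma measurable_adj n (A : T -> 'M[R]_n) : measurable_mx A ->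
  measurable_mx (fun t => \adj (A t)).
Proof.
move=> mA i j; under eq_fun do rewrite mxE.
rewrite /cofactor; apply: measurable_funM => //; apply: measurable_det => a b.
by under eq_fun do rewrite !mxE; exact: mA.
Qed.

Lemma measurable_invr (f : T -> R) : measurable_fun setT f ->
  measurable_fun setT (fun t => (f t)^-1).
Proof.
move=> mf.
(* The inverse of a square is a power with real exponent, hence measurable; the
   factor [f t] makes the formula hold at 0 too. *)
have -> : (fun t => (f t)^-1) = (fun t => f t * powR (f t ^+ 2) (-1)).
  apply/funext => t; rewrite powR_inv1 ?sqr_ge0//.
  have [->|f0] := eqVneq (f t) 0; first by rewrite invr0 mul0r.
  by field.
apply: measurable_funM => //.
apply: (@measurableT_comp _ _ _ _ _ _ (fun z : R => powR z (-1))).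
  exact: measurable_powR.
exact: measurable_funX.
Qed.

Lemma measurable_invmx n (A : T -> 'M[R]_n) : measurable_mx A ->
  (forall t, A t \in unitmx) -> measurable_mx (fun t => invmx (A t)).
Proof.
move=> mA uA i j.
under eq_fun do rewrite /invmx uA mxE.
apply: measurable_funM; last exact: measurable_adj.
by apply: measurable_invr; exact: measurable_det.
Qed.

(** The statistic is the limit along [e = 1 / (k + 1)] of rational functions of
    the entries. *)
Lemma measurable_Rsquared n d (x : T -> 'I_n -> 'rV[R]_d) : (0 < n)%N ->
  (forall i j, measurable_fun setT (fun t => x t i 0 j)) ->
  measurable_fun setT (fun t => Rsquared (x t)).
Proof.
move=> n0 mx.
have mM : measurable_mx (fun t => \matrix_i x t i).
  by move=> i j; under eq_fun do rewrite mxE; exact: mx.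
have mtr m p (A : T -> 'M[R]_(m, p)) : measurable_mx A -> measurable_mx (fun t => (A t)^T).
  by move=> mA i j; under eq_fun do rewrite mxE; exact: mA.
have mean : measurable_mx (fun t => sample_mean (x t)).
  move=> i j; rewrite /sample_mean; under eq_fun do rewrite sum_rows mxE.
  by apply: measurable_funM => //; apply: measurable_mulmx.
have form e : 0 < e -> measurable_fun setT (fun t => resolvent_form (x t) e).
  move=> e0; apply: measurable_mulmx; last exact: mtr.
  apply: measurable_mulmx => //; apply: measurable_invmx => [i j|t].
    rewrite /sample_S; under eq_fun do rewrite sum_outer !mxE.
    apply: measurable_funD => //; apply: measurable_funM => //.
    by apply: (measurable_sum) => k; apply: measurable_funM; [exact: mtr|exact: mM].
  by rewrite /sample_S sum_outer ridge_unit// invr_ge0.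
apply: (@measurable_fun_cvg _ _ _ _ (fun k t => resolvent_form (x t) k.+1%:R^-1)).
  by move=> k; apply: form; rewrite invr_gt0.
move=> t _; have /(cvg_at_rightP _ _) := Rsquared_cvg n0 (x:=x t) => h; apply: (h (fun k => k.+1%:R^-1)); split.
  by move=> k; rewrite invr_gt0.
exact: cvg_harmonic.
Qed.

End MeasurableStatistic.

(** * Averaging over the signs *)

Section SignSum.
Context {R : realType} {d : nat}.
Notation point := (d.-tuple R).
Implicit Types (F : point -> \bar R) (a : point).

Definition signs n (s : n.-tuple bool) (i : 'I_n) : R := (-1) ^+ tnth s i.

Lemma signs_sqr n (s : n.-tuple bool) i : signs s i ^+ 2 = 1.
Proof. by rewrite /signs -exprM mulnC exprM sqrrN expr1n expr1n. Qed.

Lemma sign_avgs_sum n (b : 'I_n -> 'rV[R]_d) F a : (forall v, 0 <= F v)%E ->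
  sign_avgs [seq b i | i <- enum 'I_n] F a =
  ((2^-1 ^+ n)%:E * \sum_(s : n.-tuple bool)
     F [tuple (tnth a j + \sum_(i < n) signs s i * b i 0 j)%R | j < d])%E.
Proof.
move=> F0; elim: n b a => [|n IH] b a.
  rewrite enum_ord0 /= expr0 mul1e (big_pred1 [tuple]).
    congr F; apply: eq_from_tnth => j; rewrite tnth_mktuple big_ord0 addr0//.
  by move=> s; apply/esym/eqP; exact: tuple0.
rewrite enum_ordSl /= -map_comp /sign_avg !IH.
rewrite -ge0_muleDr ?sume_ge0// exprS EFinM [(_^-1%:E * _)%E]muleC -!muleA.
congr (_ * _)%E; rewrite muleC; congr (_ * _)%E.
rewrite [RHS](reindex (fun p : bool * n.-tuple bool => [tuple of p.1 :: p.2])) /=; last first.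
  exists (fun s => (thead s, [tuple of behead s])) => [[c s] _|s _] /=.
    by congr (_, _); apply: val_inj.
  by rewrite [RHS]tuple_eta; apply: val_inj.
rewrite -(pair_bigA _ (fun c (s : n.-tuple bool) => F [tuple (tnth a j +
   \sum_(i < n.+1) signs [tuple of c :: s] i * b i 0 j)%R | j < d])) /=.
rewrite big_bool /= addeC.
by congr (_ + _)%E; apply: eq_bigr => s _; congr F; apply: eq_from_tnth => j;
  rewrite !tnth_mktuple big_ord_recl addrA /signs tnth0 ?expr0 ?expr1;
  congr (_ + _)%R; apply: eq_bigr => i _; rewrite tnthS.
Qed.

End SignSum.

Section SignedTail.
Context {R : realType} {n d : nat}.
Hypothesis n0 : (0 < n)%N.

Definition resign (s : n.-tuple bool) (y : 'I_n -> 'rV[R]_d) i : 'rV[R]_d :=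
  signs s i *: y i.

Definition exceeds (u : R) (y : 'I_n -> 'rV[R]_d) : bool :=
  u <= Num.sqrt n%:R * Rstat y.

(** Take as directions the rows of an orthonormal basis [U] of the column space:
    their signed sums have the lengths [sqrt n R] of the resigned samples, and
    orthonormality says that the covariance matrix of their normal sum is the
    identity, of size the rank. *)
Lemma signed_mean_le (y : 'I_n -> 'rV[R]_d) f : C2upconv f ->
  ((2^-1 ^+ n)%:E * \sum_(s : n.-tuple bool)
      (f (Num.sqrt n%:R * Rstat (resign s y)))%:E
    <= \int[chi_square d]_z (f (Num.sqrt z))%:E)%E.
Proof.
move=> uf; have [r [U [C [D [rd UU CD ME]]]]] := orthonormal_decomposition (\matrix_i y i).
pose h (z : R) := (f (Num.sqrt z))%:E.
have mh : measurable_fun setT h := measurable_C2upconv uf.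
have h0 z : (0 <= h z)%E by rewrite lee_fin C2upconv_ge0.
apply: (@le_trans _ _ (\int[chi_square r]_z h z)%E); last first.
  apply: chi_square_le => // v w vw; rewrite lee_fin.
  by apply: C2upconv_homo => //; rewrite ?sqrtr_ge0// ler_wsqrtr.
pose b (i : 'I_n) : 'rV[R]_r := row i U.
pose o : r.-tuple R := [tuple 0 | j < r].
have o0 j : tnth o j = 0 by rewrite tnth_mktuple.
have -> : (\int[chi_square r]_z h z)%E =
    gauss_avgs [seq b i | i <- enum 'I_n] (fun v => h (sqnorm v)) o.
  rewrite (gauss_avgs_chi (k := r))//.
    have -> : sqnorm o = 0 by rewrite /sqnorm big1// => j _; rewrite o0 expr0n.
    by apply: eq_integral => z _; rewrite add0r.
  move=> i j; rewrite ltn_ord andbT /gram big_map big_enum /=.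
  have := congr1 (fun A : 'M[R]_r => A i j) UU; rewrite !mxE => <-.
  by apply: eq_bigr => k _; rewrite !mxE.
have nF := @nice_C2upconv R r f uf.
apply: le_trans (sign_avgs_le_gauss _ nF (sign_le_gauss_radial uf) o).
rewrite sign_avgs_sum; last by case: nF.
rewrite le_eqVlt; apply/orP; left; apply/eqP; congr (_ * _)%E; apply: eq_bigr => s _; congr (f _)%:E.
rewrite /resign (Rstat_signs n0 (signs_sqr s) UU CD ME); congr Num.sqrt.
rewrite /sqnorm; apply: eq_bigr => j _; rewrite tnth_mktuple o0 add0r; congr (_ ^+ 2).
by apply: eq_bigr => i _; rewrite mxE.
Qed.

(** Markov's inequality: [f] is nonnegative, and nondecreasing on the
    half-line. *)
Lemma signed_tail_le (y : 'I_n -> 'rV[R]_d) u : 0 <= u ->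
  ((2^-1 ^+ n)%:E * \sum_(s : n.-tuple bool) ((exceeds u (resign s y))%:R)%:E
    <= Q d u)%E.
Proof.
move=> u0; apply/ereal_infP => _ [f [uf fu] <-]; rewrite [in leRHS]unlock.
apply: (@le_trans _ _ (((2^-1 ^+ n)%:E * \sum_(s : n.-tuple bool)
      (f (Num.sqrt n%:R * Rstat (resign s y)))%:E) * ((f u)^-1)%:E)%E); last first.
  apply: lee_wpmul2r; first by rewrite lee_fin invr_ge0 ltW.
  exact: (signed_mean_le y uf).
rewrite -muleA; apply: lee_wpmul2l; first by rewrite lee_fin exprn_ge0// invr_ge0.
rewrite !sumEFin -EFinM lee_fin mulr_suml; apply: ler_sum => s _.
rewrite /exceeds; case: (leP u) => uz; last by apply: mulr_ge0; rewrite ?invr_ge0 ?(ltW fu)// (C2upconv_ge0 uf).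
by rewrite ler_pdivlMr// mul1r; apply: C2upconv_homo.
Qed.

End SignedTail.

Section SignedSample.
Context {R : realType} {disp : measure_display} {T : measurableType disp}.
Variable P : probability T R.
Context {n d : nat}.
Local Open Scope ereal_scope.

Lemma measure_bigsetU_le (I : Type) (r : seq I) (A : I -> set T) :
  (forall i, measurable (A i)) ->
  P (\big[setU/set0]_(i <- r) A i) <= \sum_(i <- r) P (A i).
Proof.
move=> mA; elim: r => [|i r IH]; first by rewrite !big_nil measure0.
rewrite !big_cons; apply: le_trans (leeD2l _ IH).
apply: measureU2 => //; exact: bigsetU_measurable.
Qed.

Lemma rademacher_ae (e : {RV P >-> R}) : rademacher P e ->
  P [set w | e w != 1 /\ e w != -1]%R = 0.
Proof.
move=> [e1 e2].
have m1 (c : R) : measurable [set w | e w = c].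
  by rewrite (_ : mkset _ = e @^-1` [set c])// -[X in measurable X]setTI;
     exact: measurable_funP.
have -> : [set w | e w != 1 /\ e w != -1]%R =
    ~` ([set w | e w = 1%R] `|` [set w | e w = -1]%R).
  by apply/seteqP; split=> w /=; [move=> [/eqP h /eqP k] []|
     move=> /not_orP[/eqP h /eqP k]].
rewrite probability_setC; last by apply: measurableU; exact: m1.
rewrite measureU; [|exact: m1..|]; last first.
  apply/seteqP; split=> // w [/= -> /eqP].
  by rewrite -subr_eq0 opprK (_ : 1 + 1 = 2%:R)%R// pnatr_eq0.
transitivity (1 - ((2^-1)%:E + (2^-1)%:E) : \bar R).
  by congr (_ - (_ + _)); [exact: e1|exact: e2].
have -> : (2^-1)%:E + (2^-1)%:E = 1 :> \bar R by rewrite -EFinD; congr EFin; field.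
by rewrite subee.
Qed.

Lemma joint_signs (eps : 'I_n -> {RV P >-> R}) (s : n.-tuple bool) :
  mutually_independent P eps -> (forall i, rademacher P (eps i)) ->
  P (joint eps @^-1` [set e | forall i, tnth e i = signs s i]) = (2^-1 ^+ n)%:E.
Proof.
move=> ind rad.
have := ind (fun i => [set signs s i]) (fun i => measurable_set1 _).
under eq_bigr => i _.
  have -> : P (eps i @^-1` [set signs s i]) = (2^-1)%:E.
    have [h1 h2] := rad i; rewrite /signs; case: (tnth s i).
      by rewrite expr1 -h2.
    by rewrite expr0 -h1.
  over.
rewrite prodEFin prodr_const card_ord => <-; congr (P _).
apply/seteqP; split=> w /=; first by move=> h i _ /=; rewrite -h tnth_mktuple.
by move=> h i; rewrite tnth_mktuple; exact: h.
Qed.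

End SignedSample.

Section SymmetricSample.
Context {R : realType} {disp : measure_display} {T : measurableType disp} {n d : nat}.
Local Open Scope ereal_scope.

Definition signed_tail u (s : n.-tuple bool) : set (n.-tuple (d.-tuple R)) :=
  [set x | exceeds u (resign s (fun i => rowvec (tnth x i)))].

Lemma measurable_signed_tail u s : (0 < n)%N -> measurable (signed_tail u s).
Proof.
move=> n0.
have m : measurable_fun setT (fun x : n.-tuple (d.-tuple R) =>
    (Num.sqrt n%:R * Rstat (resign s (fun i => rowvec (tnth x i))))%R).
  apply: measurable_funM => //.
  apply: (measurableT_comp (continuous_measurable_fun (@sqrt_continuous R))).
  apply: measurable_Rsquared => // i j; rewrite /resign.
  under eq_fun do rewrite !mxE.
  apply: measurable_funM => //.
  exact: (measurableT_comp (measurable_tnth j) (measurable_tnth i)).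
rewrite (_ : signed_tail u s = setT `&` (fun x : n.-tuple (d.-tuple R) =>
    (Num.sqrt n%:R * Rstat (resign s (fun i => rowvec (tnth x i))))%R) @^-1` `[u, +oo[%classic).
  exact: m.
by apply/seteqP; split=> x /=; rewrite in_itv/= andbT /signed_tail /exceeds //; case.
Qed.

Lemma rows_joint (e : measure_display) (W : measurableType e)
    (Z : 'I_n -> W -> d.-tuple R) w :
  (fun i => rowvec (tnth (joint Z w) i)) = (fun i => rowvec (Z i w)).
Proof. by apply/funext => i; rewrite tnth_mktuple. Qed.

(** By symmetry the sample may be replaced by the resigned copy. Up to the null
    event that some [eps i] is not a sign, the event splits according to the [2 ^ n]
    sign vectors; each has probability [2 ^ - n] independently of the copy [Y], and
    [signed_tail_le] bounds the sum under the integral over [Y] pointwise. *)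
Lemma exceeds_le_Q (P : probability T R) (X : 'I_n -> {RV P >-> d.-tuple R}) (u : R) :
  (0 < n)%N -> orthant_symmetric X -> (0 <= u)%R ->
  P [set w | exceeds u (fun i => rowvec (X i w))] <= Q d u.
Proof.
move=> n0 [d2 [T' [P' [Y [eps [_ indeps rad indep law]]]]]] u0.
pose B := signed_tail u [tuple false | i < n].
have resign1 (y : 'I_n -> 'rV[R]_d) : resign [tuple false | i < n] y = y.
  by apply/funext => i; rewrite /resign /signs tnth_mktuple expr0 scale1r.
have -> : [set w | exceeds u (fun i => rowvec (X i w))] = joint X @^-1` B.
  by apply/seteqP; split=> w; rewrite /B /signed_tail /= resign1 rows_joint.
rewrite law; last exact: measurable_signed_tail.
pose S s := [set e : n.-tuple R | forall i, tnth e i = signs s i].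
have mS s : measurable (S s).
  rewrite (_ : S s = \bigcap_(i in [set: 'I_n]) (fun e => tnth e i) @^-1` [set signs s i]).
    apply: fin_bigcap_measurable => // i _.
    rewrite -[X in measurable X]setTI; exact: measurable_tnth.
  by apply/seteqP; split=> e /= h i; [move=> _; exact: h|exact: h].
have mY : measurable_fun setT (joint Y).
  apply/measurable_fun_tnthP => i.
  by rewrite (_ : _ \o _ = Y i)//; apply/funext => w /=; rewrite tnth_mktuple.
pose V w := joint (fun i w => [tuple eps i w * tnth (Y i w) j | j < d]%R) w.
have mV : measurable_fun setT V.
  apply/measurable_fun_tnthP => i; apply/measurable_fun_tnthP => j.
  rewrite (_ : _ \o _ = fun w => (eps i w * tnth (Y i w) j)%R); last first.
    by apply/funext => w /=; rewrite !tnth_mktuple.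
  by apply: measurable_funM => //; exact: (measurableT_comp (measurable_tnth j)).
have me : measurable_fun setT (joint eps).
  apply/measurable_fun_tnthP => i.
  by rewrite (_ : _ \o _ = eps i)//; apply/funext => w /=; rewrite tnth_mktuple.
pose G s := joint eps @^-1` (S s) `&` joint Y @^-1` (signed_tail u s).
pose Z i := [set w | eps i w != 1 /\ eps i w != -1]%R.
have mG s : measurable (G s).
  apply: measurableI; rewrite -[X in measurable X]setTI.
    exact: me.
  by apply: mY => //; exact: measurable_signed_tail.
have mZ i : measurable (Z i).
  have mc (c : R) : measurable (~` (eps i @^-1` [set c])).
    by apply: measurableC; rewrite -[X in measurable X]setTI; exact: measurable_funP.
  rewrite (_ : Z i = ~` (eps i @^-1` [set 1%R]) `&` ~` (eps i @^-1` [set (-1)%R])).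
    exact: measurableI.
  by apply/seteqP; split=> w [/= /eqP h /eqP k].
apply: (@le_trans _ _ (P' ((\big[setU/set0]_s G s) `|` (\big[setU/set0]_i Z i)))).
  apply: le_measure; rewrite ?inE.
  - by rewrite -[X in measurable X]setTI; apply: mV => //; exact: measurable_signed_tail.
  - by apply: measurableU; exact: bigsetU_measurable.
  - move=> w /= Bw.
    have [[i Zi]|nZ] := pselect (exists i, Z i w).
      by right; rewrite (bigD1 i)//=; left.
    pose s := [tuple eps i w == -1 | i < n]%R.
    have se i : eps i w = signs s i.
      rewrite /signs tnth_mktuple; case: eqP => [->|/eqP e1]; first by rewrite expr1.
      rewrite expr0; apply/eqP; apply: contrapT => /negP e2.
      by apply: nZ; exists i; split.
    left; rewrite (bigD1 s)//=; left; split => /=.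
      by move=> i; rewrite tnth_mktuple.
    move: Bw; rewrite /B /signed_tail /= resign1.
    rewrite (_ : (fun i => _) = resign s (fun i => rowvec (tnth (joint Y w) i)))//.
    apply/funext => i; rewrite /resign; apply/rowP => j.
    by rewrite !mxE !tnth_mktuple se.
apply: (le_trans (measureU2 _ _ _)).
- exact: bigsetU_measurable.
- exact: bigsetU_measurable.
apply: (le_trans (leeD (measure_bigsetU_le _ _ mG) (measure_bigsetU_le _ _ mZ))).
rewrite [X in _ + X]big1 ?adde0; last by move=> i _; exact: rademacher_ae.
pose t s w : \bar R := (((exceeds u (resign s (fun i => rowvec (Y i w))))%:R : R)%:E).
have mA s : measurable (joint Y @^-1` (signed_tail u s)).
  by rewrite -[X in measurable X]setTI; apply: mY => //; exact: measurable_signed_tail.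
have tE s : t s = fun w => (\1_(joint Y @^-1` (signed_tail u s)) w)%:E.
  apply/funext => w; rewrite indicE; congr (_%:R)%:E; congr nat_of_bool.
  by rewrite -(rows_joint Y); apply/idP/idP; rewrite inE.
have mt s : measurable_fun setT (t s) by rewrite tE; apply/measurable_EFinP.
have PB s : P' (joint Y @^-1` (signed_tail u s)) = \int[P']_w t s w.
  by rewrite tE -[X in P' X]setIT -integral_indic.
have PG s : P' (G s) = \int[P']_w ((2^-1 ^+ n)%:E * t s w).
  rewrite indep//; last exact: measurable_signed_tail.
  rewrite joint_signs// PB -ge0_integralZl//.
  by move=> w _; rewrite lee_fin.
under eq_bigr do rewrite PG.
have c0 : (0 <= (2^-1 ^+ n : R)%:E) by rewrite lee_fin exprn_ge0// invr_ge0.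
rewrite -ge0_integral_sum//; last 2 first.
- by move=> s; apply: measurable_funeM; exact: mt.
- by move=> s w _; rewrite mule_ge0// lee_fin.
rewrite -[leRHS]mule1 -(@probability_setT _ _ _ P') -integral_cst//.
apply: ge0_le_integral => //.
- by move=> w _; apply: sume_ge0 => s _; rewrite mule_ge0// lee_fin.
- by apply: emeasurable_sum => s; apply: measurable_funeM; exact: mt.
- by move=> w _; rewrite -ge0_sume_distrr; [exact: signed_tail_le|move=> s _; rewrite lee_fin].
Qed.
End SymmetricSample.

Theorem theorem6p2 (R : realType) (n d : nat) (hn : (1 <= n)%N)
    (hd : (1 <= d)%N) (disp : measure_display) (T : measurableType disp)
    (P : probability T R) (X : 'I_n -> {RV P >-> d.-tuple R})
    (hX : orthant_symmetric X) (u : R) (hu : 0 <= u) :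
  (P [set w | (u <= Num.sqrt n%:R * Rstat (fun i => rowvec (X i w)))%R]
     <= Q d u)%E
  /\ (Q d u < (2 * expR 3 / 9)%:E *
              chi_square d [set y : R | (u <= Num.sqrt y)%R])%E.
Proof.
case: d hd X hX => [//|k] _ X hX; split; last exact: Q_lt.
exact: exceeds_le_Q.
Qed.
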